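(* Let $0<\alpha<2\pi$ and let $A=(A_{11},A_{12},\mathrm{Id}_\ell)$ be a monic elliptic tuple with standard root $V=(S+i\,\mathrm{Id}_\ell)D$. For $\lambda\in\mathbb{C}\setminus\{0\}$, the model problem for $A$ with angle $\alpha$ and Dirichlet boundary conditions has a solution $r^\lambda v\neq0$ if and only if $$0\in\sigma(M_{\lambda,\alpha})\quad\text{for}\quad M_{\lambda,\alpha}=Z_\alpha^{\lambda_+}-\overline{Z_\alpha}^{\,\lambda_-},$$ where $Z_\alpha=\cos(\alpha)\,\mathrm{Id}_\ell+\sin(\alpha)\,D^{1/2}SD^{1/2}+i\sin(\alpha)\,D$.
   Context: **Monic elliptic tuples.** $A=(A_{11},A_{12},\mathrm{Id}_\ell)$ with $A_{11},A_{12}\in\operatorname{Mat}_\ell(\mathbb{R})$ symmetric is a monic elliptic tuple if $A_{11}$ is positive definite and $L_A(\xi)=A_{11}\xi_1^2+2A_{12}\xi_1\xi_2+\mathrm{Id}_\ell\,\xi_2^2$ satisfies $\det L_A(\xi)\neq0$ for all $\xi\in\mathbb{R}^2\setminus\{0\}$. Write $L_A(\partial_{x_1},\partial_{x_2})=A_{11}\partial_{x_1}^2+2A_{12}\partial_{x_1}\partial_{x_2}+\partial_{x_2}^2$. Its standard root is the unique $V\in\operatorname{Mat}_\ell(\mathbb{C})$ with $\sigma(V)\subset\{\operatorname{Im}z>0\}$ and $L_A(1,\beta)=(V^*-\beta\,\mathrm{Id}_\ell)(V-\beta\,\mathrm{Id}_\ell)$ for all $\beta\in\mathbb{C}$; it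 can be written $V=(S+i\,\mathrm{Id}_\ell)D$ with $S,D\in\operatorname{Mat}_\ell(\mathbb{R})$ symmetric, $D$ positive definite ($D=\operatorname{Im}V$, $S=(\operatorname{Re}V)D^{-1}$). **Complex powers.** For $z\in\mathbb{C}\setminus\{0\}$ and $\lambda\in\mathbb{C}$, $z^{\lambda_\pm}:=\exp(\lambda\log_\pm z)$ with $\log_\pm z:=\log|z|+i\arg_\pm z$, $\arg_+z\in[0,2\pi)$, $\arg_-z\in(-2\pi,0]$. Powers of matrices are defined by the holomorphic functional calculus. For $0<\alpha<2\pi$ the spectra of $Z_\alpha$ and of its entrywise complex conjugate $\overline{Z_\alpha}$ do not meet $[0,\infty)$. **Model problem.** Use polar coordinates on the angle $\mathcal{K}_\alpha=\{r>0,0\le\varphi\le\alpha\}$ with sides $\Gamma^-=\{\varphi=0\}$, $\Gamma^+=\{\varphi=\alpha\}$. A solution $r^\lambda v$ of the model problem with Dirichlet boundary conditions is a function $u(r,\varphi)=r^\lambda v(\varphi)$, $v:[0,\alpha]\to\mathbb{C}^\ell$ smooth, with $L_A(\partial_{x_1},\partial_{x_2})u=0$ on $\mathcal{K}_\alpha$ and $u=0$ on $\Gamma^-\cup\Gamma^+$. *)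

(* Defs.v *)
From HB Require Import structures.
From mathcomp Require Import all_boot all_order all_algebra.
From mathcomp Require Import complex.
From mathcomp Require Import all_classical all_reals all_analysis.
Set Implicit Arguments.
Unset Strict Implicit.
Unset Printing Implicit Defensive.
Import Order.TTheory GRing.Theory Num.Theory.
Import numFieldNormedType.Exports.

Local Open Scope classical_set_scope.
Local Open Scope ring_scope.
Local Open Scope complex_scope.
Local Open Scope sesquilinear_scope.

(* Complex numbers are pairs over R; on R[i] the order is partial and
   0 <= z means that z is real and nonnegative. *)

Section Matrices.
Context {R : realType} {l : nat}.

Definition positive_definite (A : 'M[R]_l) : Prop :=
  A^T = A /\ forall x : 'cV[R]_l, x != 0 -> 0 < (x^T *m A *m x) 0 0.

Definition posdef_sqrt (D : 'M[R]_l) : 'M[R]_l :=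
  xget 0 [set Q | positive_definite Q /\ Q *m Q = D].

Definition complex_mx (A : 'M[R]_l) : 'M[R[i]]_l := map_mx (real_complex R) A.

Definition conj_mx (Z : 'M[R[i]]_l) : 'M[R[i]]_l := map_mx Num.conj Z.

Definition spectrum (Z : 'M[R[i]]_l) : set R[i] := [set mu | eigenvalue Z mu].

End Matrices.

Section EllipticTuples.
Context {R : realType} {l : nat}.

Definition symbol (F : comNzRingType) (A11 A12 : 'M[F]_l) (x1 x2 : F)
    : 'M[F]_l :=
  x1 ^+ 2 *: A11 + (2 * (x1 * x2)) *: A12 + (x2 ^+ 2)%:M.

Definition monic_elliptic (A11 A12 : 'M[R]_l) : Prop :=
  [/\ positive_definite A11, A12^T = A12 &
      forall x1 x2 : R, (x1, x2) != (0, 0) -> \det (symbol A11 A12 x1 x2) != 0].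

Definition standard_root (A11 A12 : 'M[R]_l) (V : 'M[R[i]]_l) : Prop :=
  (forall mu, spectrum V mu -> 0 < complex.Im mu) /\
  (forall beta : R[i],
     symbol (complex_mx A11) (complex_mx A12) 1 beta
     = (V ^t* - beta%:M) *m (V - beta%:M)).

Definition standard_root_decomposition (V : 'M[R[i]]_l) (S D : 'M[R]_l)
    : Prop :=
  [/\ S^T = S, positive_definite D &
      V = (complex_mx S + 'i%C%:M) *m complex_mx D].

End EllipticTuples.

Section ComplexPowers.
Context {R : realType}.
Implicit Type z : R[i].

Definition modulus z : R := complex.Re `|z|.

Definition cexp z : R[i] :=
  (expR (complex.Re z))%:C * (cos (complex.Im z) +i* sin (complex.Im z)).

(* acos (Re z / |z|), in [0, pi], is the unsigned angle between z and the
   positive real half-line. *)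
Definition arg_plus z : R :=
  let t := acos (complex.Re z / modulus z) in
  if 0 <= complex.Im z then t else 2 * pi - t.

Definition arg_minus z : R :=
  let t := acos (complex.Re z / modulus z) in
  if complex.Im z <= 0 then - t else t - 2 * pi.

Definition log_plus z : R[i] := ln (modulus z) +i* arg_plus z.
Definition log_minus z : R[i] := ln (modulus z) +i* arg_minus z.

Definition pow_plus (lambda z : R[i]) : R[i] := cexp (lambda * log_plus z).
Definition pow_minus (lambda z : R[i]) : R[i] := cexp (lambda * log_minus z).

Definition real_pow (r : R) (lambda : R[i]) : R[i] :=
  cexp (lambda * (ln r)%:C).

End ComplexPowers.

Section HolomorphicCalculus.
Context {R : realType} {l : nat}.

Definition complex_integral (a b : R) (h : R -> R[i]) : R[i] :=
  (\int[lebesgue_measure]_(t in `[a, b]) complex.Re (h t))%R +i*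
  (\int[lebesgue_measure]_(t in `[a, b]) complex.Im (h t))%R.

Definition circle_integral (g : R[i] -> R[i]) (c : R[i]) (rho : R) : R[i] :=
  complex_integral 0 (2 * pi) (fun t =>
    g (c + rho%:C * cexp (0 +i* t)) * (0 +i* rho * cexp (0 +i* t))).

(* The closed discs of radius rho around the eigenvalues of Z lie in Om and are
   pairwise disjoint, so that the circles bounding them form a cycle in Om
   around the spectrum of Z. *)
Definition admissible_radius (Om : set R[i]) (Z : 'M[R[i]]_l) : set R :=
  [set rho | [/\ 0 < rho,
    forall mu z, spectrum Z mu -> modulus (z - mu) <= rho -> Om z &
    forall mu nu, spectrum Z mu -> spectrum Z nu -> mu != nu ->
      2 * rho < modulus (mu - nu)]].

(* f(Z) = (2 pi i)^-1 * (integral of f(z) (z - Z)^-1 dz), for f holomorphic on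
   the open set Om containing the spectrum of Z. By Cauchy's theorem the value
   does not depend on which admissible radius is selected. *)
Definition holomorphic_calculus (Om : set R[i]) (f : R[i] -> R[i])
    (Z : 'M[R[i]]_l) : 'M[R[i]]_l :=
  let rho := xget 0 (admissible_radius Om Z) in
  \matrix_(i, j) ((0 +i* (2 * pi))^-1 *
    \sum_(mu \in spectrum Z)
      circle_integral (fun z => f z * invmx (z%:M - Z) i j) mu rho).

Definition slit_plane : set R[i] := [set z | ~ (0 <= z)].

Definition mxpow_plus (Z : 'M[R[i]]_l) (lambda : R[i]) : 'M[R[i]]_l :=
  holomorphic_calculus slit_plane (pow_plus lambda) Z.

Definition mxpow_minus (Z : 'M[R[i]]_l) (lambda : R[i]) : 'M[R[i]]_l :=
  holomorphic_calculus slit_plane (pow_minus lambda) Z.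

Definition Zmx (S D : 'M[R]_l) (alpha : R) : 'M[R[i]]_l :=
  (cos alpha)%:C%:M
  + (sin alpha)%:C *: complex_mx (posdef_sqrt D *m S *m posdef_sqrt D)
  + (0 +i* sin alpha) *: complex_mx D.

Definition Mmx (S D : 'M[R]_l) (alpha : R) (lambda : R[i]) : 'M[R[i]]_l :=
  mxpow_plus (Zmx S D alpha) lambda
  - mxpow_minus (conj_mx (Zmx S D alpha)) lambda.

End HolomorphicCalculus.

Section ModelProblem.
Context {R : realType} {l : nat}.

(* Derivatives of all orders exist in the open interval and extend continuously
   to the closed one; g n is the n-th derivative of f. *)
Definition smooth_on_itv (a b : R) (f : R -> R) : Prop :=
  exists g : nat -> R -> R,
    [/\ forall t, a <= t <= b -> g 0%N t = f t,
        forall n, {within `[a, b], continuous (g n)} &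
        forall n t, a < t < b -> is_derive t 1 (g n) (g n.+1 t)].

Definition smooth_cV (a b : R) (v : R -> 'cV[R[i]]_l) : Prop :=
  forall i, smooth_on_itv a b (fun t => complex.Re (v t i 0)) /\
            smooth_on_itv a b (fun t => complex.Im (v t i 0)).

Definition cV_derive (v : R -> 'cV[R[i]]_l) (t : R) : 'cV[R[i]]_l :=
  \col_i (derive1 (fun s => complex.Re (v s i 0)) t +i*
          derive1 (fun s => complex.Im (v s i 0)) t).

Definition partial1 (u : R -> R -> 'cV[R[i]]_l) (x1 x2 : R) : 'cV[R[i]]_l :=
  cV_derive (fun t => u t x2) x1.

Definition partial2 (u : R -> R -> 'cV[R[i]]_l) (x1 x2 : R) : 'cV[R[i]]_l :=
  cV_derive (fun t => u x1 t) x2.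

Definition elliptic_operator (A11 A12 : 'M[R]_l) (u : R -> R -> 'cV[R[i]]_l)
    (x1 x2 : R) : 'cV[R[i]]_l :=
  complex_mx A11 *m partial1 (partial1 u) x1 x2
  + 2 *: (complex_mx A12 *m partial1 (partial2 u) x1 x2)
  + partial2 (partial2 u) x1 x2.

(* A function given in polar coordinates (r, phi), 0 <= phi < 2 pi, read in
   Cartesian coordinates. *)
Definition cartesian (u : R -> R -> 'cV[R[i]]_l) (x1 x2 : R) : 'cV[R[i]]_l :=
  u (modulus (x1 +i* x2)) (arg_plus (x1 +i* x2)).

Definition power_ansatz (lambda : R[i]) (v : R -> 'cV[R[i]]_l) (r phi : R)
    : 'cV[R[i]]_l :=
  real_pow r lambda *: v phi.

(* Since v is smooth on [0, alpha], the equation holds up to the sides of the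
   angle as soon as it holds in the interior. *)
Definition dirichlet_solution (A11 A12 : 'M[R]_l) (alpha : R) (lambda : R[i])
    (v : R -> 'cV[R[i]]_l) : Prop :=
  [/\ smooth_cV 0 alpha v,
      forall r phi, 0 < r -> 0 < phi < alpha ->
        elliptic_operator A11 A12 (cartesian (power_ansatz lambda v))
          (r * cos phi) (r * sin phi) = 0 &
      forall r, 0 < r -> power_ansatz lambda v r 0 = 0 /\
                         power_ansatz lambda v r alpha = 0].

End ModelProblem.

(* Main.v *)
Require Import Defs.
From HB Require Import structures.
From mathcomp Require Import all_boot all_order all_algebra.
From mathcomp Require Import complex.
From mathcomp Require Import all_classical all_reals all_analysis.
From mathcomp Require Import ring lra.
Set Implicit Arguments.
Unset Strict Implicit.
Unset Printing Implicit Defensive.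
Import Order.TTheory GRing.Theory Num.Theory.
Import numFieldNormedType.Exports.
Local Open Scope classical_set_scope.
Local Open Scope ring_scope.
Local Open Scope complex_scope.
Local Open Scope sesquilinear_scope.

(** Let [W] be the adjoint of [V], [U] its entrywise conjugate, and [turnmx V phi] the matrix
    [cos phi + sin phi V]. Comparing coefficients in the factorization of the symbol gives
    [A11 = W V] and [2 A12 = - (W + V)]. Hence the operator is the product of [W d1 - d2] and
    [V d1 - d2]. As the coefficients are real, both [V] and [U] solve
    [A11 + 2 A12 X + X ^ 2 = 0], and all functions [f (x1 + x2 V) c] and
    [f (x1 + x2 U) c] are solutions. For [f] a power
    this gives the solutions [r ^ lambda (y phi - z phi)] with
    [y phi = (turnmx V phi) ^ lambda c] and [z phi = (turnmx U phi) ^ lambda c].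

    For [0 < phi < 2 pi] the eigenvalues of [turnmx V phi] run counterclockwise from 1 and
    those of [turnmx U phi] clockwise, without meeting the positive axis again. This is why
    the branch plus belongs to [V] and the branch minus to [U]: with these branches both
    powers are smooth in [phi] and tend to the identity at [phi = 0]. So [y - z] vanishes
    at 0, and it vanishes at [alpha] exactly when [c] is in the kernel of the difference of
    the two powers at [alpha]. Since [Z_alpha] is [turnmx V alpha] conjugated by the real
    matrix [D ^ (1/2)], this difference is similar to [M] ([Mmx_kernel]).

    Every solution that vanishes at 0 is of this form when [lambda] is not 0: the derivative
    of [y - z] at 0 is [lambda (V - U) c] with [V - U = 2 i D] invertible, so [c] can be
    adjusted to the derivative of the given solution, and uniqueness applies
    ([dirichlet_representation]). Uniqueness follows from the factorization, which reduces
    the equation to two first-order systems in [phi], and from [turn_equation_unique].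

    The functional calculus enters only through its values on generalized eigenvectors,
    where it is a Taylor polynomial ([holomorphic_calculus_eigencol]). This is Cauchy's
    formula for [z ^ kappa / (z - mu) ^ (j + 1)] on small circles ([cauchy_kernelE]), which
    follows from the mean value property and integration by parts. As generalized
    eigenvectors span, the properties of [y] and [z] ([power_solution]) and the behaviour
    under similarity ([mxpow_intertwine]) are verified on them. The translation between
    the Cartesian operator and the ordinary differential equation in [phi] is
    [elliptic_operator_polar]. *)

Local Notation Re := complex.Re.
Local Notation Im := complex.Im.

(** * Complex-valued functions of a real variable *)

Section Calculus.
Context {R : realType}.
Implicit Types (f g : R -> R[i]) (t : R) (z w d e : R[i]).

(** Componentwise, so that the calculus of real functions of a real variable applies. *)
Definition cderive f t d : Prop :=
  is_derive t 1 (fun s => Re (f s)) (Re d) /\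
  is_derive t 1 (fun s => Im (f s)) (Im d).

Lemma ReD z w : Re (z + w) = Re z + Re w. Proof. by case: z; case: w. Qed.
Lemma ImD z w : Im (z + w) = Im z + Im w. Proof. by case: z; case: w. Qed.
Lemma ReN z : Re (- z) = - Re z. Proof. by case: z. Qed.
Lemma ImN z : Im (- z) = - Im z. Proof. by case: z. Qed.
Lemma ReM z w : Re (z * w) = Re z * Re w - Im z * Im w.
Proof. by case: z; case: w. Qed.
Lemma ImM z w : Im (z * w) = Re z * Im w + Im z * Re w.
Proof. by case: z; case: w. Qed.

Lemma eq_ReIm z w : Re z = Re w -> Im z = Im w -> z = w.
Proof. by case: z => a b; case: w => c d /= -> ->. Qed.

Lemma eqC_ReIm z : z = Re z +i* Im z. Proof. by case: z. Qed.

Lemma cderive_eq f t d e : cderive f t d -> d = e -> cderive f t e.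
Proof. by move=> h <-. Qed.

Lemma cderive_near f g t d :
  (\forall s \near t, f s = g s) -> cderive f t d -> cderive g t d.
Proof.
move=> fg [h1 h2]; split; [apply: near_eq_is_derive h1|apply: near_eq_is_derive h2];
  by apply: filterS fg => s ->.
Qed.

Lemma cderive_unique f t d e : cderive f t d -> cderive f t e -> d = e.
Proof.
move=> [h1 h2] [h3 h4]; apply: eq_ReIm.
- by rewrite -(@derive_val _ _ _ _ _ _ _ h1) (@derive_val _ _ _ _ _ _ _ h3).
- by rewrite -(@derive_val _ _ _ _ _ _ _ h2) (@derive_val _ _ _ _ _ _ _ h4).
Qed.

Lemma cderive_cst z t : cderive (fun _ => z) t 0.
Proof. by split; exact: is_derive_cst. Qed.

Lemma cderiveD f g t d e :
  cderive f t d -> cderive g t e -> cderive (fun s => f s + g s) t (d + e).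
Proof.
move=> [h1 h2] [h3 h4]; split.
- rewrite ReD; under eq_fun do rewrite ReD; exact: is_deriveD.
- rewrite ImD; under eq_fun do rewrite ImD; exact: is_deriveD.
Qed.

Lemma cderiveN f t d : cderive f t d -> cderive (fun s => - f s) t (- d).
Proof.
move=> [h1 h2]; split.
- rewrite ReN; under eq_fun do rewrite ReN; exact: is_deriveN.
- rewrite ImN; under eq_fun do rewrite ImN; exact: is_deriveN.
Qed.

Lemma is_derive_mul (f g : R -> R) t (d e : R) : is_derive t 1 f d ->
  is_derive t 1 g e -> is_derive t 1 (fun s => f s * g s) (d * g t + f t * e).
Proof.
move=> h1 h2; apply: (is_derive_eq (is_deriveM h1 h2)).
by rewrite addrC /GRing.scale/= [g t * _]mulrC.
Qed.

Lemma is_derive_add (f g : R -> R) t (d e : R) : is_derive t 1 f d ->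
  is_derive t 1 g e -> is_derive t 1 (fun s => f s + g s) (d + e).
Proof. exact: is_deriveD. Qed.

Lemma is_derive_opp (f : R -> R) t (d : R) : is_derive t 1 f d ->
  is_derive t 1 (fun s => - f s) (- d).
Proof. exact: is_deriveN. Qed.

Lemma is_derive_sub (f g : R -> R) t (d e : R) : is_derive t 1 f d ->
  is_derive t 1 g e -> is_derive t 1 (fun s => f s - g s) (d - e).
Proof. exact: is_deriveB. Qed.

Lemma cderiveM f g t d e : cderive f t d -> cderive g t e ->
  cderive (fun s => f s * g s) t (d * g t + f t * e).
Proof.
move=> [h1 h2] [h3 h4]; split.
- under eq_fun do rewrite ReM.
  apply: (is_derive_eq (is_derive_sub (is_derive_mul h1 h3) (is_derive_mul h2 h4))).
  by rewrite ReD !ReM; ring.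
- under eq_fun do rewrite ImM.
  apply: (is_derive_eq (is_derive_add (is_derive_mul h1 h4) (is_derive_mul h2 h3))).
  by rewrite ImD !ImM; ring.
Qed.

Lemma cderiveZ z f t d : cderive f t d -> cderive (fun s => z * f s) t (z * d).
Proof.
move=> h; apply: cderive_eq; first exact: cderiveM (cderive_cst z t) h.
by rewrite mul0r add0r.
Qed.

Lemma cderive_real (f : R -> R) t (d : R) :
  is_derive t 1 f d -> cderive (fun s => (f s)%:C) t d%:C.
Proof. by move=> h; split=> //=; exact: is_derive_cst. Qed.

Lemma cderive_sum (I : Type) (r : seq I) (P : pred I) (F : I -> R -> R[i])
    (D : I -> R[i]) t :
  (forall i, P i -> cderive (F i) t (D i)) ->
  cderive (fun s => \sum_(i <- r | P i) F i s) t (\sum_(i <- r | P i) D i).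
Proof.
move=> h; elim: r => [|i r ih].
  rewrite big_nil; under eq_fun do rewrite big_nil; exact: cderive_cst.
rewrite big_cons; under eq_fun do rewrite big_cons.
by case: ifP => // Pi; apply: cderiveD => //; exact: h.
Qed.

Lemma cexpD z w : cexp (z + w) = cexp z * cexp w.
Proof.
case: z w => a b [c d]; rewrite /cexp /= expRD cosD sinD; simpc.
by apply: eq_ReIm => /=; ring.
Qed.

Lemma cexp0 : cexp 0 = 1 :> R[i].
Proof. by rewrite /cexp /= expR0 cos0 sin0 mul1r. Qed.

Lemma cexp_neq0 z : cexp z != 0.
Proof.
apply/eqP => h; have := cexpD z (- z); rewrite h subrr cexp0 mul0r.
by apply/eqP; rewrite oner_eq0.
Qed.

Lemma cexpN z : cexp (- z) = (cexp z)^-1.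
Proof.
apply: (mulfI (cexp_neq0 z)); rewrite -cexpD subrr cexp0 divff //.
exact: cexp_neq0.
Qed.

Lemma Re_cexp z : Re (cexp z) = expR (Re z) * cos (Im z).
Proof. by rewrite /cexp ReM /= mul0r subr0. Qed.
Lemma Im_cexp z : Im (cexp z) = expR (Re z) * sin (Im z).
Proof. by rewrite /cexp ImM /= mul0r addr0. Qed.

Lemma is_derive_comp1 (f g : R -> R) t (d e : R) : is_derive t 1 g e ->
  is_derive (g t) 1 f d -> is_derive t 1 (fun s => f (g s)) (d * e).
Proof.
by move=> h2 h1; apply: (is_derive_eq (is_derive1_comp h1 h2)).
Qed.

Lemma is_derive_inv (f : R -> R) t (d : R) : is_derive t 1 f d -> f t != 0 ->
  is_derive t 1 (fun s => (f s)^-1) (- (f t ^- 2 * d)).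
Proof.
move=> h f0; apply: (is_derive_eq (is_deriveV f0 h)).
by rewrite /GRing.scale /= mulNr.
Qed.

Lemma cderive_exp f t d :
  cderive f t d -> cderive (fun s => cexp (f s)) t (cexp (f t) * d).
Proof.
move=> [h1 h2]; split.
- under eq_fun do rewrite Re_cexp.
  apply: (is_derive_eq (is_derive_mul
    (is_derive_comp1 h1 (is_derive_expR _)) (is_derive_comp1 h2 (is_derive_cos _)))).
  by rewrite ReM Re_cexp Im_cexp; ring.
- under eq_fun do rewrite Im_cexp.
  apply: (is_derive_eq (is_derive_mul
    (is_derive_comp1 h1 (is_derive_expR _)) (is_derive_comp1 h2 (is_derive_sin _)))).
  by rewrite ImM Re_cexp Im_cexp; ring.
Qed.

Definition sqmod z : R := Re z ^+ 2 + Im z ^+ 2.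

Lemma sqmod_ge0 z : 0 <= sqmod z.
Proof. by rewrite addr_ge0 // sqr_ge0. Qed.

Lemma sqmod_gt0 z : z != 0 -> 0 < sqmod z.
Proof.
move=> z0; rewrite lt_neqAle sqmod_ge0 andbT eq_sym.
rewrite /sqmod paddr_eq0 ?sqr_ge0 // !sqrf_eq0.
by apply: contra z0; case: z => a b /= /andP[/eqP-> /eqP->].
Qed.

Lemma modulusE z : modulus z = Num.sqrt (sqmod z).
Proof. by case: z => a b; rewrite /modulus normc_def. Qed.

Lemma normc_modulus z : `|z| = (modulus z)%:C.
Proof. by rewrite modulusE normc_def. Qed.

Lemma modulus_sqr z : modulus z ^+ 2 = sqmod z.
Proof. by rewrite modulusE sqr_sqrtr // sqmod_ge0. Qed.

Lemma modulus_ge0 z : 0 <= modulus z.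
Proof. by rewrite modulusE sqrtr_ge0. Qed.

Lemma modulus_gt0 z : (0 < modulus z) = (z != 0).
Proof. by rewrite -ltcR -normc_modulus normr_gt0. Qed.

Lemma modulusM z w : modulus (z * w) = modulus z * modulus w.
Proof. by apply: complexI; rewrite rmorphM -!normc_modulus normrM. Qed.

Lemma modulusD z w : modulus (z + w) <= modulus z + modulus w.
Proof. by rewrite -lecR rmorphD -!normc_modulus; exact: ler_normD. Qed.

Lemma modulusN z : modulus (- z) = modulus z.
Proof. by apply: complexI; rewrite -!normc_modulus normrN. Qed.

Lemma modulus0 : modulus 0 = 0 :> R.
Proof. by apply: complexI; rewrite -normc_modulus normr0. Qed.

Lemma modulusV z : modulus z^-1 = (modulus z)^-1.
Proof. by apply: complexI; rewrite fmorphV -!normc_modulus normfV. Qed.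

Lemma modulus_real (x : R) : modulus x%:C = `|x|.
Proof. by rewrite modulusE /sqmod /= expr0n addr0 sqrtr_sqr. Qed.

Lemma invc_sqmod z : z != 0 -> z^-1 = (Re z / sqmod z) +i* (- (Im z / sqmod z)).
Proof.
move=> z0; apply: (mulfI z0); rewrite divff //.
have s0 : sqmod z != 0 by rewrite gt_eqF // sqmod_gt0.
apply: eq_ReIm; rewrite ?ReM ?ImM /=; move: s0; rewrite /sqmod => s0; field.
  exact: s0.
exact: s0.
Qed.

Lemma cderiveV f t d : f t != 0 -> cderive f t d ->
  cderive (fun s => (f s)^-1) t (- d / f t ^+ 2).
Proof.
move=> f0 [h1 h2].
have s0 := sqmod_gt0 f0.
have hs : is_derive t 1 (fun s => sqmod (f s))
    (2 * (Re (f t) * Re d + Im (f t) * Im d)).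
  rewrite /sqmod; under eq_fun do rewrite !expr2.
  apply: (is_derive_eq (is_derive_add (is_derive_mul h1 h1) (is_derive_mul h2 h2))).
  by ring.
have hV : is_derive t 1 (fun s => (sqmod (f s))^-1)
    (- (sqmod (f t) ^- 2 * (2 * (Re (f t) * Re d + Im (f t) * Im d)))).
  by apply: (is_derive_inv hs); rewrite gt_eqF.
have E : (fun s => (Re (f s) * (sqmod (f s))^-1) +i*
    (- (Im (f s) * (sqmod (f s))^-1))) = (fun s => (f s)^-1).
  apply/funext => s; have [->|/invc_sqmod -> //] := eqVneq (f s) 0.
  by rewrite /= invr0 !mul0r oppr0.
rewrite -E; split => /=.
- apply: (is_derive_eq (is_derive_mul h1 hV)).
  move: s0; rewrite -(exprVn (f t)) (invc_sqmod f0) expr2 !(ReM, ImM, ReN, ImN) /= /sqmod => s0.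
  by field; rewrite gt_eqF.
- apply: (is_derive_eq (is_derive_opp (is_derive_mul h2 hV))).
  move: s0; rewrite -(exprVn (f t)) (invc_sqmod f0) expr2 !(ReM, ImM, ReN, ImN) /= /sqmod => s0.
  by field; rewrite gt_eqF.
Qed.

Lemma modulus_cexp z : modulus (cexp z) = expR (Re z).
Proof.
rewrite modulusE /sqmod Re_cexp Im_cexp !exprMn -mulrDr cos2Dsin2 mulr1.
by rewrite sqrtr_sqr ger0_norm // expR_ge0.
Qed.

Lemma modulus_cis (t : R) : modulus (cexp (0 +i* t)) = 1.
Proof. by rewrite modulus_cexp /= expR0. Qed.

Lemma normRe_modulus z : `|Re z| <= modulus z.
Proof. by rewrite modulusE -sqrtr_sqr ler_sqrt ?sqmod_ge0 // lerDl sqr_ge0. Qed.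

Lemma normIm_modulus z : `|Im z| <= modulus z.
Proof. by rewrite modulusE -sqrtr_sqr ler_sqrt ?sqmod_ge0 // lerDr sqr_ge0. Qed.

(** Continuity is relative to [A] because the functions below are only continuous from
    the right at the angle 0. *)
Definition ccont (A : set R) f : Prop :=
  {within A, continuous (fun s => Re (f s))} /\
  {within A, continuous (fun s => Im (f s))}.

Lemma ccont_eq A f g : {in A, f =1 g} -> ccont A f -> ccont A g.
Proof.
move=> fg [h1 h2]; split.
- have E : {in A, (fun s => Re (f s)) =1 (fun s => Re (g s))}.
    by move=> x /fg ->.
  exact: (subspace_eq_continuous E).
- have E : {in A, (fun s => Im (f s)) =1 (fun s => Im (g s))}.
    by move=> x /fg ->.
  exact: (subspace_eq_continuous E).
Qed.

Lemma ccont_cst A z : ccont A (fun _ => z).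
Proof. by split=> x; apply: cvg_cst. Qed.

Lemma ccontD A f g : ccont A f -> ccont A g -> ccont A (fun s => f s + g s).
Proof.
move=> [h1 h2] [h3 h4]; split => x.
- by under eq_fun do rewrite ReD; apply: cvgD; [exact: h1|exact: h3].
- by under eq_fun do rewrite ImD; apply: cvgD; [exact: h2|exact: h4].
Qed.

Lemma ccontN A f : ccont A f -> ccont A (fun s => - f s).
Proof.
move=> [h1 h2]; split => x.
- by under eq_fun do rewrite ReN; apply: cvgN; exact: h1.
- by under eq_fun do rewrite ImN; apply: cvgN; exact: h2.
Qed.

Lemma ccontM A f g : ccont A f -> ccont A g -> ccont A (fun s => f s * g s).
Proof.
move=> [h1 h2] [h3 h4]; split => x.
- under eq_fun do rewrite ReM.
  by apply: cvgB; apply: cvgM; [exact: h1|exact: h3|exact: h2|exact: h4].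
- under eq_fun do rewrite ImM.
  by apply: cvgD; apply: cvgM; [exact: h1|exact: h4|exact: h2|exact: h3].
Qed.

Lemma ccont_exp A f : ccont A f -> ccont A (fun s => cexp (f s)).
Proof.
move=> [h1 h2]; split => x.
- under eq_fun do rewrite Re_cexp.
  apply: cvgM.
    by apply: continuous_comp; [exact: h1|exact: continuous_expR].
  by apply: continuous_comp; [exact: h2|exact: continuous_cos].
- under eq_fun do rewrite Im_cexp.
  apply: cvgM.
    by apply: continuous_comp; [exact: h1|exact: continuous_expR].
  by apply: continuous_comp; [exact: h2|exact: continuous_sin].
Qed.

Lemma ccont_sum A (I : Type) (r : seq I) (P : pred I) (F : I -> R -> R[i]) :
  (forall i, P i -> ccont A (F i)) ->
  ccont A (fun s => \sum_(i <- r | P i) F i s).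
Proof.
move=> h; elim: r => [|i r ih].
  under eq_fun do rewrite big_nil; exact: ccont_cst.
under eq_fun do rewrite big_cons.
by case Pi: (P i) => //; apply: ccontD => //; exact: h.
Qed.

Lemma is_derive_continuous (f : R -> R) t (d : R) :
  is_derive t 1 f d -> {for t, continuous f}.
Proof.
by move=> h; apply/differentiable_continuous/derivable1_diffP; apply: ex_derive.
Qed.

Lemma cderive_ccont A f (d : R -> R[i]) :
  (forall t, cderive f t (d t)) -> ccont A f.
Proof.
move=> h; split; apply: continuous_subspaceT => x; have [h1 h2] := h x.
- exact: is_derive_continuous h1.
- exact: is_derive_continuous h2.
Qed.

Lemma real_cst_of_derive0 (f : R -> R) (a b : R) :
  (forall t, a < t < b -> is_derive t 1 f 0) ->
  {within `[a, b], continuous f} -> forall t, a <= t <= b -> f t = f a.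
Proof.
move=> h hc t /andP[]; rewrite le_eqVlt => /orP[/eqP<- //|at_ tb].
have sub : `[a, t] `<=` `[a, b].
  by apply: subset_itvl; rewrite bnd_simp.
have hd x : x \in `]a, t[%R -> is_derive x 1 f ((fun _ => 0) x).
  by rewrite in_itv /= => /andP[ax xt]; apply: h; rewrite ax (lt_le_trans xt).
have [x _] := MVT at_ hd (continuous_subspaceW sub hc).
by move=> /eqP; rewrite mul0r subr_eq0 => /eqP.
Qed.

Lemma cst_of_cderive0 f (a b : R) :
  (forall t, a < t < b -> cderive f t 0) -> ccont `[a, b] f ->
  forall t, a <= t <= b -> f t = f a.
Proof.
move=> h [c1 c2] t tab; apply: eq_ReIm.
- by apply: (@real_cst_of_derive0 (fun s => Re (f s)) a b) => // s /h[].
- by apply: (@real_cst_of_derive0 (fun s => Im (f s)) a b) => // s /h[].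
Qed.

End Calculus.

(** * Logarithms and the curve [cos phi + sin phi * mu] *)

Section Logarithm.
Context {R : realType}.
Implicit Types (f : R -> R[i]) (t x : R) (z d mu : R[i]).

(** An open condition on the real coordinates, hence stable along continuous curves. *)
Lemma slit_planeP z : slit_plane z <-> Re z < modulus z.
Proof.
rewrite /slit_plane /= lecE /=; have m0 := modulus_ge0 z.
split=> [h|].
  rewrite ltNge; apply/negP => mR; apply: h.
  have R0 : 0 <= Re z by exact: le_trans mR.
  rewrite R0 andbT -sqrf_eq0 -(addrK (Re z ^+ 2) (Im z ^+ 2)) [Im z ^+ 2 + _]addrC.
  rewrite -[X in X - _]/(sqmod z) -modulus_sqr eq_le subr_le0 subr_ge0.
  rewrite ler_sqr ?nnegrE // mR ler_sqr ?nnegrE // -[leLHS]ger0_norm //.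
  rewrite modulusE -sqrtr_sqr ler_sqrt ?sqmod_ge0 // lerDl sqr_ge0 //.
move=> mR /andP[/eqP I0 R0]; move: mR.
by rewrite modulusE /sqmod I0 expr0n addr0 sqrtr_sqr ger0_norm // ltxx.
Qed.

Lemma slit_plane_neq0 z : slit_plane z -> z != 0.
Proof. by move=> h; apply/eqP => z0; apply: h; rewrite z0. Qed.

(** The principal logarithm, off the closed negative half-line. By the half-angle formula
    its argument is one smooth expression, whereas [acos] would need charts and is not
    differentiable at the endpoints of its domain. *)
Definition plog z : R[i] := ln (modulus z) +i* (2 * atan (Im z / (modulus z + Re z))).

Lemma half_angle z : 0 < modulus z + Re z ->
  1 + (Im z / (modulus z + Re z)) ^+ 2 = 2 * modulus z / (modulus z + Re z).
Proof.
move=> h; have h0 := lt0r_neq0 h.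
apply/eqP; rewrite -subr_eq0; apply/eqP.
have -> : 1 + (Im z / (modulus z + Re z)) ^+ 2 - 2 * modulus z / (modulus z + Re z)
  = (sqmod z - modulus z ^+ 2) / (modulus z + Re z) ^+ 2.
  by rewrite /sqmod; field.
by rewrite modulus_sqr subrr mul0r.
Qed.

Lemma plog_dom_modulus_gt0 z : 0 < modulus z + Re z -> 0 < modulus z.
Proof.
move=> h; rewrite modulus_gt0; apply/eqP => z0; move: h.
by rewrite z0 modulus0 addr0 ltxx.
Qed.

Lemma cos_2atan z : 0 < modulus z + Re z ->
  cos (2 * atan (Im z / (modulus z + Re z))) = Re z / modulus z.
Proof.
move=> h; have m0 := plog_dom_modulus_gt0 h.
rewrite mulr2n mulrDl mul1r cosD -!expr2 sin2cos2 cos_atan exprVn sqr_sqrtr.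
  by rewrite half_angle //; field; rewrite !gt_eqF.
by rewrite addr_ge0 // sqr_ge0.
Qed.

Lemma sin_2atan z : 0 < modulus z + Re z ->
  sin (2 * atan (Im z / (modulus z + Re z))) = Im z / modulus z.
Proof.
move=> h; have m0 := plog_dom_modulus_gt0 h.
have c0 : cos (atan (Im z / (modulus z + Re z))) != 0.
  by rewrite gt_eqF // cos_gt0_pihalf // atan_gtNpi2 atan_ltpi2.
rewrite mulr2n mulrDl mul1r sinD.
have E : sin (atan (Im z / (modulus z + Re z))) =
    Im z / (modulus z + Re z) * cos (atan (Im z / (modulus z + Re z))).
  have := atanK (Im z / (modulus z + Re z)); rewrite /tan => yE.
  by rewrite -{2}yE divfK.
rewrite E.
transitivity (2 * (Im z / (modulus z + Re z)) *
  cos (atan (Im z / (modulus z + Re z))) ^+ 2); first by ring.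
rewrite cos_atan exprVn sqr_sqrtr.
  by rewrite half_angle //; field; rewrite !gt_eqF.
by rewrite addr_ge0 // sqr_ge0.
Qed.

Lemma cexp_plog z : 0 < modulus z + Re z -> cexp (plog z) = z.
Proof.
move=> h; have m0 := plog_dom_modulus_gt0 h.
apply: eq_ReIm; rewrite ?Re_cexp ?Im_cexp /=.
- by rewrite lnK ?posrE // cos_2atan // mulrC divfK // gt_eqF.
- by rewrite lnK ?posrE // sin_2atan // mulrC divfK // gt_eqF.
Qed.

Lemma is_derive_modulus f t d : f t != 0 -> cderive f t d ->
  is_derive t 1 (fun s => modulus (f s))
    ((Re (f t) * Re d + Im (f t) * Im d) / modulus (f t)).
Proof.
move=> f0 [h1 h2]; have s0 := sqmod_gt0 f0.
have hs := is_derive_add (is_derive_mul h1 h1) (is_derive_mul h2 h2).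
have E : (fun s => modulus (f s)) =
   fun s => Num.sqrt (Re (f s) * Re (f s) + Im (f s) * Im (f s)).
  by apply/funext => s; rewrite modulusE /sqmod !expr2.
rewrite E.
have p0 : 0 < Re (f t) * Re (f t) + Im (f t) * Im (f t) by rewrite -!expr2.
apply: (is_derive_eq (is_derive_comp1 hs (is_derive1_sqrt p0))).
rewrite modulusE /sqmod !expr2; move: p0; rewrite -sqrtr_gt0.
move: (Num.sqrt _) => q q0.
by field; rewrite gt_eqF.
Qed.

Lemma cderive_plog f t d : 0 < modulus (f t) + Re (f t) -> cderive f t d ->
  cderive (fun s => plog (f s)) t (d / f t).
Proof.
move=> h cf; have m0 := plog_dom_modulus_gt0 h.
have f0 : f t != 0 by rewrite -modulus_gt0.
have hm := is_derive_modulus f0 cf; have [h1 h2] := cf.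
have ha := half_angle h; have msq := modulus_sqr (f t).
split => /=.
- apply: (is_derive_eq (is_derive_comp1 hm (is_derive1_ln m0))).
  rewrite (invc_sqmod f0) ReM /= -msq; by field; rewrite gt_eqF.
- have hq := is_derive_add hm h1.
  have hV := is_derive_inv hq (lt0r_neq0 h).
  have hat := is_derive_comp1 (is_derive_mul h2 hV) (is_derive1_atan _).
  apply: (is_derive_eq (is_derive_mul (is_derive_cst (2 : R) t 1) hat)).
  rewrite mul0r add0r ha (invc_sqmod f0) ImM /= -msq /GRing.scale /=.
  apply/eqP; rewrite -subr_eq0; apply/eqP.
  set m := modulus (f t) in h m0 msq *; set a := Re (f t) in h msq *.
  set b := Im (f t) in msq *.
  transitivity (Im d * (m ^+ 2 - (a ^+ 2 + b ^+ 2)) / (m ^+ 2 * (m + a))).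
    by field; rewrite !gt_eqF.
  by rewrite msq subrr mulr0 mul0r.
Qed.

Lemma arg_plus_polar (r theta : R) : 0 < r -> 0 <= theta < 2 * pi ->
  arg_plus ((r * cos theta) +i* (r * sin theta)) = theta.
Proof.
move=> r0 /andP[t0 t2].
have -> : arg_plus ((r * cos theta) +i* (r * sin theta)) =
  if 0 <= sin theta then acos (cos theta) else 2 * pi - acos (cos theta).
  rewrite /arg_plus modulusE /sqmod /= !exprMn -mulrDr cos2Dsin2 mulr1.
  by rewrite sqrtr_sqr gtr0_norm // pmulr_rge0 // mulrAC divff ?gt_eqF // mul1r.
have [tp|tp] := leP theta pi.
  by rewrite sin_ge0_pi ?t0 // cosK // in_itv /= t0.
have s0 : sin theta < 0.
  rewrite -[theta](subrK pi) sinDpi oppr_lt0 sin_gt0_pi //.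
  by rewrite subr_gt0 tp /= ltrBlDr; lra.
rewrite leNgt s0 /= -cosN -(cosD2pi (- theta)) cosK; first by rewrite mulr_natl; ring.
by rewrite in_itv /= mulr2n; apply/andP; split; lra.
Qed.

Lemma polarE z : z = (modulus z * (Re z / modulus z)) +i* (modulus z * (Im z / modulus z)).
Proof.
have [->|z0] := eqVneq z 0.
  by rewrite modulus0 !mul0r.
have m0 : modulus z != 0 by rewrite gt_eqF // modulus_gt0.
by apply: eq_ReIm; rewrite /= mulrC divfK.
Qed.

(** The two cuts are exchanged by [z |-> - z], so all smoothness properties of [log_plus]
    come from those of [plog]. *)
Lemma log_plusE z : slit_plane z -> log_plus z = plog (- z) + (0 +i* pi).
Proof.
move=> /slit_planeP h.
have h' : 0 < modulus (- z) + Re (- z) by rewrite modulusN ReN subr_gt0.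
apply: eq_ReIm; first by rewrite /= addr0 modulusN.
rewrite /=; set x := 2 * atan _.
have C : - cos x = Re z / modulus z.
  by rewrite /x cos_2atan // ReN modulusN mulNr opprK.
have Sn : - sin x = Im z / modulus z.
  by rewrite /x sin_2atan // ImN modulusN mulNr opprK.
have m0 : 0 < modulus z by rewrite -modulusN; exact: plog_dom_modulus_gt0 h'.
rewrite {1}(polarE z) -C -Sn -cosDpi -sinDpi arg_plus_polar //.
have := atan_gtNpi2 (Im (- z) / (modulus (- z) + Re (- z))).
have := atan_ltpi2 (Im (- z) / (modulus (- z) + Re (- z))).
by rewrite /x; move: (atan _) => y *; lra.
Qed.

Lemma cexp_pi : cexp (0 +i* pi) = -1 :> R[i].
Proof.
by apply: eq_ReIm; rewrite ?Re_cexp ?Im_cexp ?ReN ?ImN /= expR0 mul1r ?cospi ?sinpi ?oppr0.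
Qed.

Lemma cexp_log_plus z : slit_plane z -> cexp (log_plus z) = z.
Proof.
move=> h; rewrite log_plusE // cexpD cexp_pi cexp_plog ?mulrN1 ?opprK //.
by rewrite modulusN ReN subr_gt0; exact/slit_planeP.
Qed.

Lemma near_slit_plane f t d : cderive f t d -> slit_plane (f t) ->
  \forall s \near t, slit_plane (f s).
Proof.
move=> cf h; have f0 := slit_plane_neq0 h.
have hm := is_derive_sub (is_derive_modulus f0 cf) cf.1.
have h0 : 0 < modulus (f t) - Re (f t) by rewrite subr_gt0; exact/slit_planeP.
have n1 : \forall s \near t, 0 < modulus (f s) - Re (f s).
  exact: (cvgr_gt _ (is_derive_continuous hm)).
by apply: filterS n1 => s; rewrite subr_gt0 => /slit_planeP.
Qed.

Lemma cderive_log_plus f t d : slit_plane (f t) ->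
  cderive f t d -> cderive (fun s => log_plus (f s)) t (d / f t).
Proof.
move=> h cf.
apply: (@cderive_near _ (fun s => plog (- f s) + (0 +i* pi))).
  by apply: filterS (near_slit_plane cf h) => s hs; rewrite log_plusE.
have h' : 0 < modulus (- f t) + Re (- f t).
  by rewrite modulusN ReN subr_gt0; exact/slit_planeP.
apply: cderive_eq.
  by apply: cderiveD; [exact: (cderive_plog h' (cderiveN cf))|exact: cderive_cst].
by rewrite addr0 invrN mulNr mulrN opprK.
Qed.

Lemma arg_minus_conj z : arg_minus z = - arg_plus z^*.
Proof.
case: z => a b; rewrite /arg_minus /arg_plus /= oppr_ge0 !modulusE /sqmod /= sqrrN.
by case: ifP => // _; rewrite opprB.
Qed.

(** Both branches are cut along the same half-line, so on the slit plane the powers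
    [z ^ lambda_-] and [z ^ lambda_+] differ by a constant factor only. *)
Lemma log_minusE z : slit_plane z -> log_minus z = log_plus z - (0 +i* (2 * pi)).
Proof.
move=> h; apply: eq_ReIm; rewrite /= ?oppr0 ?addr0 //.
rewrite /arg_minus /arg_plus.
case: (ltgtP (Im z) 0) => [_|_|I0].
- by rewrite addrAC subrr add0r.
- by [].
- have R0 : Re z < 0.
    by rewrite ltNge; apply/negP => R0; apply: h; rewrite lecE /= I0 eqxx R0.
  have -> : Re z / modulus z = -1.
    rewrite modulusE /sqmod I0 expr0n addr0 sqrtr_sqr ltr0_norm // invrN mulrN.
    by rewrite divff // lt_eqF.
  by rewrite acosN1; ring.
Qed.

Lemma cderive_log_minus f t d : slit_plane (f t) ->
  cderive f t d -> cderive (fun s => log_minus (f s)) t (d / f t).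
Proof.
move=> h cf; apply: (@cderive_near _ (fun s => log_plus (f s) - (0 +i* (2 * pi)))).
  by apply: filterS (near_slit_plane cf h) => s hs; rewrite log_minusE.
apply: cderive_eq.
  by apply: cderiveD; [exact: (cderive_log_plus h cf)|exact: cderive_cst].
by rewrite addr0.
Qed.

Lemma cexp_2pi : cexp (0 +i* (2 * pi)) = 1 :> R[i].
Proof.
have -> : 0 +i* (2 * pi) = (0 +i* pi) + (0 +i* pi) :> R[i].
  by apply: eq_ReIm; rewrite /= ?addr0 // mulr_natl mulr2n.
by rewrite cexpD cexp_pi mulrNN mulr1.
Qed.

Lemma cexp_log_minus z : slit_plane z -> cexp (log_minus z) = z.
Proof.
move=> h; rewrite log_minusE // cexpD cexpN cexp_2pi invr1 mulr1.
exact: cexp_log_plus.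
Qed.

(** On its closed half-plane each branch agrees with [plog], which is smooth across the
    positive axis; this is what makes the branches one-sidedly continuous there. *)
Lemma log_plus_upper z : 0 <= Im z -> 0 < modulus z + Re z -> log_plus z = plog z.
Proof.
move=> I0 h; apply: eq_ReIm => //=; set x := 2 * atan _.
have m0 := plog_dom_modulus_gt0 h.
rewrite {1}(polarE z) -(cos_2atan h) -(sin_2atan h) arg_plus_polar //.
have := atan_ltpi2 (Im z / (modulus z + Re z)).
have : 0 <= atan (Im z / (modulus z + Re z)).
  by rewrite -atan0 le_atan // divr_ge0 // ltW.
by move: (atan _) => y *; lra.
Qed.

Lemma log_minus_lower z : Im z <= 0 -> 0 < modulus z + Re z -> log_minus z = plog z.
Proof.
move=> I0 h.
have mc : modulus z^* = modulus z by rewrite !modulusE /sqmod; case: (z) => a b /=; rewrite sqrrN.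
have Rc : Re z^* = Re z by case: (z).
have Ic : Im z^* = - Im z by case: (z).
have := @log_plus_upper z^*; rewrite mc Rc Ic oppr_ge0 => /(_ I0 h) e.
apply: eq_ReIm => //=; rewrite arg_minus_conj.
have := congr1 (@complex.Im R) e; rewrite /= => ->.
by rewrite mc Rc Ic mulNr atanN mulrN opprK.
Qed.

(** If [mu] is an eigenvalue of [V] then [turn mu phi] is one of [cos phi + sin phi V]. For
    non-real [mu] the curve leaves 1 at angle 0 and makes one turn around 0, in the
    direction given by the sign of [Im mu], staying in the slit plane for
    [0 < phi < 2 pi]. *)
Definition turn mu (phi : R) : R[i] := (cos phi)%:C + (sin phi)%:C * mu.
Definition turn' mu (phi : R) : R[i] := (- sin phi)%:C + (cos phi)%:C * mu.

Lemma cderive_turn mu phi : cderive (turn mu) phi (turn' mu phi).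
Proof.
apply: cderiveD; first by apply: cderive_real; exact: is_derive_cos.
apply: cderive_eq.
  by apply: cderiveM; [apply: cderive_real; exact: is_derive_sin|exact: cderive_cst].
by rewrite mulr0 addr0.
Qed.

Lemma Im_turn mu phi : Im (turn mu phi) = sin phi * Im mu.
Proof. by rewrite /turn ImD ImM /= add0r mul0r addr0. Qed.

Lemma turn_slit_plane mu phi : Im mu != 0 -> 0 < phi < 2 * pi ->
  slit_plane (turn mu phi).
Proof.
move=> mu0 /andP[p0 p2]; rewrite /slit_plane /= lecE /= Im_turn => /andP[].
rewrite mulf_eq0 (negbTE mu0) orbF => /eqP s0.
have [pp|pp|pp] := ltgtP phi pi.
- by move: s0 => /eqP; rewrite gt_eqF // sin_gt0_pi // p0.
- move: s0; rewrite -[phi](subrK pi) sinDpi => /eqP; rewrite oppr_eq0.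
  by rewrite gt_eqF // sin_gt0_pi // subr_gt0 pp /=; lra.
- by rewrite /turn pp cospi sinpi mul0r addr0 /= ler0N1.
Qed.

(** The branch is the one that vanishes at the start of the curve, so this is the
    continuous logarithm along the whole turn. *)
Definition turn_log mu (phi : R) : R[i] :=
  if 0 < Im mu then log_plus (turn mu phi) else log_minus (turn mu phi).

Lemma turn0 mu : turn mu 0 = 1.
Proof. by rewrite /turn cos0 sin0 mul0r addr0. Qed.

Lemma modulus1 : modulus 1 = 1 :> R.
Proof. by apply: complexI; rewrite -normc_modulus normr1. Qed.

Lemma turn_log0 mu : turn_log mu 0 = 0.
Proof.
have e : Im (1 : R[i]) = 0 by [].
rewrite /turn_log turn0; case: ifP => _; apply: eq_ReIm => /=;
  by rewrite ?modulus1 ?ln1 // /arg_plus /arg_minus modulus1 e lexx divr1 /= acos1 ?oppr0.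
Qed.

Lemma cderive_turn_log mu phi : Im mu != 0 -> 0 < phi < 2 * pi ->
  cderive (turn_log mu) phi (turn' mu phi / turn mu phi).
Proof.
move=> mu0 h; have sl := turn_slit_plane mu0 h.
rewrite /turn_log; case: (0 < Im mu).
- exact: (cderive_log_plus sl (cderive_turn _ _)).
- exact: (cderive_log_minus sl (cderive_turn _ _)).
Qed.

Lemma cexp_turn_log mu phi : Im mu != 0 -> 0 <= phi < 2 * pi ->
  cexp (turn_log mu phi) = turn mu phi.
Proof.
move=> mu0 /andP[]; rewrite le_eqVlt => /orP[/eqP<- _|p0 p2].
  by rewrite turn_log0 cexp0 turn0.
have sl : slit_plane (turn mu phi) by apply: turn_slit_plane; rewrite ?p0.
by rewrite /turn_log; case: ifP => _; rewrite ?cexp_log_plus ?cexp_log_minus.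
Qed.

Lemma within_continuous_at (f : R -> R) (A : set R) x :
  {for x, continuous f} -> f y @[y --> within A (nbhs x)] --> f x.
Proof. by move=> h; apply: cvg_within_filter. Qed.

(** The angle 0 is the only delicate point: there the curve sits on the cut, and the
    branch is compared with [plog] on the side from which the curve leaves. *)
Lemma ccont_turn_log mu alpha : Im mu != 0 -> 0 < alpha < 2 * pi ->
  ccont `[0, alpha] (turn_log mu).
Proof.
move=> mu0 /andP[a0 a2].
have hg : 0 < modulus (turn mu 0) + Re (turn mu 0).
  by rewrite turn0 modulus1 /= addr_gt0.
have dg := cderive_plog hg (cderive_turn mu 0).
have near0 : \forall s \near within `[0, alpha] (nbhs 0),
    turn_log mu s = plog (turn mu s).
  have t0 : turn mu 0 != 0 by rewrite turn0 oner_neq0.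
  have hm := is_derive_add (is_derive_modulus t0 (cderive_turn mu 0))
    (cderive_turn mu 0).1.
  have n1 : \forall s \near (0 : R), 0 < modulus (turn mu s) + Re (turn mu s).
    exact: (cvgr_gt _ (is_derive_continuous hm)).
  have n2 : \forall s \near (0 : R), s < pi by apply: lt_nbhsl; exact: pi_gt0.
  rewrite near_withinE; near=> s => /=; rewrite in_itv /= => /andP[s0 s1].
  have sp : 0 <= sin s by rewrite sin_ge0_pi // s0 ltW //; near: s.
  have m1 : 0 < modulus (turn mu s) + Re (turn mu s) by near: s.
  rewrite /turn_log; case: ltP => I0.
  - by rewrite log_plus_upper // Im_turn mulr_ge0 // ltW.
  - by rewrite log_minus_lower // Im_turn mulr_ge0_le0.
have key (p : R[i] -> R) : {for 0, continuous (fun s => p (plog (turn mu s)))} ->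
   (forall x, 0 < x < 2 * pi -> {for x, continuous (fun s => p (turn_log mu s))}) ->
   {within `[0, alpha], continuous (fun s => p (turn_log mu s))}.
  move=> c0 c1; apply/subspace_continuousP => x /=; rewrite in_itv /= => /andP[].
  rewrite le_eqVlt => /orP[/eqP<- _|x0 xa]; last first.
    by apply: within_continuous_at; apply: c1; rewrite x0 (le_lt_trans xa).
  have e0 : turn_log mu 0 = plog (turn mu 0).
    by rewrite turn_log0 turn0; apply: eq_ReIm;
      rewrite /= ?modulus1 ?ln1 // mul0r atan0 mulr0.
  change ((fun s => p (turn_log mu s)) y @[y --> within `[0, alpha] (nbhs 0)]
    --> p (turn_log mu 0)).
  rewrite e0; apply: cvg_trans (@within_continuous_at _ `[0, alpha] _ c0).
  by apply: near_eq_cvg; apply: filterS near0 => s ->.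
split; apply: key.
- exact: is_derive_continuous dg.1.
- by move=> x hx; exact: is_derive_continuous (cderive_turn_log mu0 hx).1.
- exact: is_derive_continuous dg.2.
- by move=> x hx; exact: is_derive_continuous (cderive_turn_log mu0 hx).2.
Unshelve. all: by end_near. Qed.

End Logarithm.

(** * Integrals over circles *)

Section CircleIntegrals.
Context {R : realType}.
Local Notation leb := (@lebesgue_measure R).
Implicit Types (h H : R -> R[i]) (z c mu nu : R[i]).

Lemma integrable_within_continuous (f : R -> R) (a b : R) :
  {within `[a, b], continuous f} -> leb.-integrable `[a, b] (EFin \o f).
Proof. by move=> hf; apply: continuous_compact_integrable => //; exact: segment_compact. Qed.

Lemma Rintegral_derive (f F : R -> R) (a b : R) : a < b ->
  (forall t : R, is_derive t 1 F (f t)) -> {within `[a, b], continuous f} ->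
  (\int[leb]_(t in `[a, b]) f t)%R = F b - F a.
Proof.
move=> ab hd hc; rewrite /Rintegral (@continuous_FTC2 _ f F a b) //.
- have hF t : F x @[x --> t] --> F t by exact: is_derive_continuous (hd t).
  by split => [t _||]; [case: (hd t)|exact: cvg_at_right_filter|exact: cvg_at_left_filter].
- by move=> t _; rewrite derive1E; case: (hd t).
Qed.

(** The integral is differentiated in the parameter on the open interval from [- eta] to [eta],
    so that it is also continuous at both ends of [0, 1]. *)
Lemma parametric_integral_const (f df : R -> R -> R) (a b K eta : R) :
  a < b -> 1 < eta ->
  (forall s t : R, - eta < s < eta -> is_derive s 1 (f^~ t) (df s t)) ->
  (forall s t, - eta < s < eta -> `|df s t| <= K) ->
  (forall s, - eta < s < eta -> {within `[a, b], continuous (f s)}) ->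
  (forall s, 0 < s < eta -> (\int[leb]_(t in `[a, b]) df s t)%R = 0) ->
  (\int[leb]_(t in `[a, b]) f 1 t)%R = (\int[leb]_(t in `[a, b]) f 0 t)%R.
Proof.
move=> ab eta1 hd hK hc h0.
pose G s := (\int[leb]_(t in `[a, b]) f s t)%R.
have mB : measurable (`[a, b] : set R) by exact: measurable_itv.
have K0 : 0 <= K by apply: le_trans (hK 0 0 _); rewrite ?normr_ge0 //; lra.
have intf s : `](- eta), eta[%classic s -> leb.-integrable `[a, b] (EFin \o f s).
  by rewrite /= in_itv /= => hs; apply: integrable_within_continuous; exact: hc.
have derf s t : `](- eta), eta[%classic s -> `[a, b]%classic t -> derivable (f^~ t) s 1.
  by rewrite /= in_itv /= => hs _; case: (hd s t hs).
have intK : leb.-integrable `[a, b] (EFin \o (fun _ : R => K)).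
  by apply: integrable_within_continuous => x; exact: cvg_cst.
have p1 (s t : R) : - eta < s < eta -> partial1of2 f s t = df s t.
  by move=> hs; rewrite partial1of2E; case: (hd s t hs).
have Kub s t : `](- eta), eta[%classic s -> `[a, b]%classic t ->
    `|partial1of2 f s t| <= K.
  by rewrite /= in_itv /= => hs _; rewrite p1 // hK.
have dG (s : R) : - eta < s < eta -> derivable G s 1.
  move=> hs; apply: (@derivable_under_integral _ _ _ leb f _ mB s (- eta) eta
    _ intf derf (fun _ => K) (fun _ => K0) intK Kub).
  by rewrite /= in_itv.
have dG0 (s : R) : 0 < s < 1 -> is_derive s 1 G 0.
  move=> /andP[s0 s1].
  have hs : - eta < s < eta by lra.
  have E : 'D_1 G s = 0; last by rewrite -E; apply: derivableP; exact: dG.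
  rewrite -derive1E (@differentiation_under_integral _ _ _ leb f _ mB s (- eta) eta
    _ intf derf (fun _ => K) (fun _ => K0) intK Kub); last by rewrite /= in_itv.
  rewrite -(h0 s); last by lra.
  by apply: eq_Rintegral => t _; rewrite p1.
apply: (@real_cst_of_derive0 _ G 0 1); rewrite ?ler01 ?lexx //.
apply: derivable_within_continuous => s; rewrite in_itv /= => hs.
by apply: dG; lra.
Qed.

Lemma cintegral_derive h H (a b : R) : a < b ->
  (forall t, cderive H t (h t)) -> ccont `[a, b] h ->
  complex_integral a b h = H b - H a.
Proof.
move=> ab hd [c1 c2]; apply: eq_ReIm; rewrite ?(ReD, ImD, ReN, ImN) /=.
- by apply: (@Rintegral_derive (fun t => Re (h t)) (fun t => Re (H t))) => // t; case: (hd t).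
- by apply: (@Rintegral_derive (fun t => Im (h t)) (fun t => Im (H t))) => // t; case: (hd t).
Qed.

Lemma eq_cintegral h H (a b : R) : (forall t, h t = H t) ->
  complex_integral a b h = complex_integral a b H.
Proof. by move=> e; congr (complex_integral _ _ _); apply/funext. Qed.

Lemma cintegralD h H (a b : R) : ccont `[a, b] h -> ccont `[a, b] H ->
  complex_integral a b (fun t => h t + H t) =
  complex_integral a b h + complex_integral a b H.
Proof.
move=> [c1 c2] [c3 c4]; apply: eq_ReIm; rewrite ?(ReD, ImD) /=.
- rewrite -RintegralD //; try exact: integrable_within_continuous.
  by apply: eq_Rintegral => t _; rewrite ReD.
- rewrite -RintegralD //; try exact: integrable_within_continuous.
  by apply: eq_Rintegral => t _; rewrite ImD.
Qed.

Lemma cintegralZ c h (a b : R) : ccont `[a, b] h ->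
  complex_integral a b (fun t => c * h t) = c * complex_integral a b h.
Proof.
move=> [c1 c2].
have i1 := integrable_within_continuous c1.
have i2 := integrable_within_continuous c2.
have s1 (x : R) (k : R -> R) : {within `[a, b], continuous k} ->
    {within `[a, b], continuous (fun t => x * k t)}.
  by move=> hk t; apply: cvgM; [exact: cvg_cst|exact: hk].
apply: eq_ReIm; rewrite ?(ReM, ImM) /=.
- rewrite -!RintegralZl // -RintegralB //;
    try by apply: integrable_within_continuous; exact: s1.
  by apply: eq_Rintegral => t _; rewrite ReM.
- rewrite -!RintegralZl // -RintegralD //;
    try by apply: integrable_within_continuous; exact: s1.
  by apply: eq_Rintegral => t _; rewrite ImM.
Qed.

Lemma cintegral_sum (I : Type) (r : seq I) (h : I -> R -> R[i]) (a b : R) :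
  (forall i, ccont `[a, b] (h i)) ->
  complex_integral a b (fun t => \sum_(i <- r) h i t) =
  \sum_(i <- r) complex_integral a b (h i).
Proof.
move=> hc; elim: r => [|i r ih].
  rewrite big_nil (eq_cintegral (H := fun _ => 0 * 0)).
    by rewrite (cintegralZ 0 (ccont_cst _ _)) mul0r.
  by move=> t; rewrite big_nil mul0r.
rewrite big_cons -ih -cintegralD //; last exact: ccont_sum.
by apply: eq_cintegral => t; rewrite big_cons.
Qed.

Lemma cintegral_cst c (a b : R) : a < b ->
  complex_integral a b (fun _ => c) = c * (b - a)%:C.
Proof.
move=> ab; rewrite (cintegral_derive (H := fun t => c * t%:C)) //.
- by rewrite -mulrBr rmorphB.
- move=> t; apply: cderive_eq; first by apply: cderiveZ; apply: cderive_real; exact: is_derive_id.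
  by rewrite mulr1.
- exact: ccont_cst.
Qed.

(** Complex differentiability on [D], stated as the chain rule along differentiable real
    curves: this form is all that is needed for integrals over circles, and it is closed
    under the algebraic operations and under composition with the logarithm. *)
Definition holo (D : set R[i]) F (F' : R[i] -> R[i]) : Prop := forall (g : R -> R[i]) (t : R) d,
  D (g t) -> cderive g t d -> cderive (fun s => F (g s)) t (F' (g t) * d).

Definition circle c (rho t : R) : R[i] := c + rho%:C * cexp (0 +i* t).

Lemma cderive_cis (t : R) : cderive (fun s : R => cexp (0 +i* s)) t (cexp (0 +i* t) * 'i).
Proof.
apply: cderive_exp; split; first exact: is_derive_cst.
exact: is_derive_id.
Qed.

Lemma cderive_circle c (rho t : R) :
  cderive (circle c rho) t (0 +i* rho * cexp (0 +i* t)).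
Proof.
apply: cderive_eq.
  by apply: cderiveD; [exact: cderive_cst|apply: cderiveZ; exact: cderive_cis].
rewrite add0r mulrCA mulrC; congr (_ * _).
by apply: eq_ReIm; rewrite ?ReM ?ImM /=; ring.
Qed.

Lemma circle_period c (rho : R) : circle c rho (2 * pi) = circle c rho 0.
Proof.
by rewrite /circle cexp_2pi; congr (_ + _ * _); rewrite -[LHS]cexp0.
Qed.

Lemma holo_ccont A (D : set R[i]) F F' (g d : R -> R[i]) : holo D F F' ->
  (forall t, D (g t)) -> (forall t, cderive g t (d t)) -> ccont A (fun s => F (g s)).
Proof.
move=> hF hD hg; apply: (@cderive_ccont _ _ _ (fun t => F' (g t) * d t)) => t.
exact: hF.
Qed.

(** Mean value property: the integral of [F] over the circle of radius [s rho] does not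
    depend on [s], since its derivative in [s] is, up to the factor [- i / s], the integral
    of an angular derivative over a full period. At [s = 0] the circle is the centre.
    The bound [K] allows differentiation under the integral sign. *)
Lemma mean_value c (rho eta K : R) F F' F'' : 1 < eta ->
  let D := [set z | exists s t, [/\ - eta < s < eta & z = circle c (s * rho) t]] in
  holo D F F' -> holo D F' F'' -> (forall z, D z -> modulus (F' z) <= K) ->
  complex_integral 0 (2 * pi) (fun t => F (circle c rho t)) = F c * (2 * pi)%:C.
Proof.
move=> eta1 D hF hF' hK.
have pi2 : 0 < 2 * pi :> R by rewrite mulr_gt0 // pi_gt0.
pose f (s t : R) := F (circle c (s * rho) t).
pose df (s t : R) := F' (circle c (s * rho) t) * (rho%:C * cexp (0 +i* t)).
have inD s t : - eta < s < eta -> D (circle c (s * rho) t) by move=> hs; exists s, t.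
have dfE (s t : R) : - eta < s < eta -> cderive (f^~ t) s (df s t).
  move=> hs; apply: hF; first exact: inD.
  apply: cderive_eq.
    apply: cderiveD; first exact: cderive_cst.
    apply: cderiveM; last exact: cderive_cst.
    exact: cderive_real (is_derive_mul (is_derive_id s 1) (is_derive_cst rho s 1)).
  by rewrite add0r mulr0 addr0 mul1r mulr0 addr0.
have cf s : - eta < s < eta -> ccont `[0, 2 * pi] (f s).
  by move=> hs; apply: (holo_ccont _ hF) (cderive_circle c (s * rho)) => t; exact: inD.
have df0 (s : R) : 0 < s < eta -> complex_integral 0 (2 * pi) (df s) = 0.
  move=> hs; have hs' : - eta < s < eta by lra.
  have s0 : s != 0 by rewrite gt_eqF //; lra.
  rewrite (cintegral_derive (H := fun t => (0 +i* (- s^-1)) * f s t)) //.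
  - by rewrite /f circle_period subrr.
  - move=> t; apply: cderive_eq.
      by apply: cderiveZ; apply: hF; [exact: inD|exact: cderive_circle].
    rewrite /df mulrCA; congr (_ * _); rewrite mulrA; congr (_ * _).
    by apply: eq_ReIm; rewrite ?ReM ?ImM /=; field.
  - apply: ccontM; first by apply: (holo_ccont _ hF') (cderive_circle c (s * rho)) => t; exact: inD.
    apply: cderive_ccont => t; apply: cderiveZ; exact: cderive_cis.
have hdf s t : - eta < s < eta -> modulus (df s t) <= K * `|rho|.
  move=> hs; rewrite /df modulusM [modulus (rho%:C * _)]modulusM modulus_cis mulr1 modulus_real.
  by apply: ler_wpM2r => //; apply: hK; exact: inD.
have f1 t : F (circle c rho t) = f 1 t by rewrite /f mul1r.
have f0 t : f 0 t = F c by rewrite /f mul0r /circle mul0r addr0.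
rewrite (eq_cintegral _ _ f1) -[2 * pi in RHS]subr0 -cintegral_cst // -(eq_cintegral _ _ f0).
apply: eq_ReIm => /=.
- apply: (@parametric_integral_const (fun s t => Re (f s t)) (fun s t => Re (df s t))
      _ _ (K * `|rho|) eta) => //.
  + by move=> s t hs; case: (dfE s t hs).
  + move=> s t hs; apply: le_trans (hdf s t hs).
    by rewrite modulusE -sqrtr_sqr ler_sqrt ?sqmod_ge0 // lerDl sqr_ge0.
  + by move=> s hs; case: (cf s hs).
  + by move=> s hs; have /(congr1 (@complex.Re R)) := df0 s hs.
- apply: (@parametric_integral_const (fun s t => Im (f s t)) (fun s t => Im (df s t))
      _ _ (K * `|rho|) eta) => //.
  + by move=> s t hs; case: (dfE s t hs).
  + move=> s t hs; apply: le_trans (hdf s t hs).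
    by rewrite modulusE -sqrtr_sqr ler_sqrt ?sqmod_ge0 // lerDr sqr_ge0.
  + by move=> s hs; case: (cf s hs).
  + by move=> s hs; have /(congr1 (@complex.Im R)) := df0 s hs.
Qed.

End CircleIntegrals.

(** * Cauchy's formula for powers *)

Section CauchyPowers.
Context {R : realType}.
Implicit Types (z c mu nu kappa : R[i]) (F : R[i] -> R[i]).

(** Falling factorials: the coefficients of the derivatives of [z ^ kappa]. *)
Fixpoint ffactc kappa (j : nat) : R[i] :=
  if j is j'.+1 then kappa * ffactc (kappa - 1) j' else 1.

Lemma ffactcSr kappa j : ffactc kappa j.+1 = ffactc kappa j * (kappa - j%:R).
Proof.
elim: j kappa => [|j ih] kappa; first by rewrite /= subr0 mulr1 mul1r.
rewrite [LHS]/= -[_ * ffactc _ j]/(ffactc (kappa - 1) j.+1) ih /= -[in RHS]natr1.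
by ring.
Qed.

Lemma holo_cst D c : holo D (fun _ : R[i] => c) (fun _ => 0).
Proof. by move=> g t d _ _; rewrite mul0r; exact: cderive_cst. Qed.

Lemma holo_sub D c : holo D (fun z : R[i] => z - c) (fun _ => 1).
Proof.
move=> g t d _ hg; rewrite mul1r -[d]addr0.
by apply: cderiveD => //; exact: cderive_cst.
Qed.

Arguments holo_cst D c : clear implicits.
Arguments holo_sub D c : clear implicits.

Lemma holoM D F F' G G' : holo D F F' -> holo D G G' ->
  holo D (fun z => F z * G z) (fun z => F' z * G z + F z * G' z).
Proof.
move=> hF hG g t d Dg hg; apply: cderive_eq.
  by apply: cderiveM; [exact: (hF _ _ _ Dg hg)|exact: (hG _ _ _ Dg hg)].
by rewrite /=; ring.
Qed.

Lemma holoD D F F' G G' : holo D F F' -> holo D G G' ->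
  holo D (fun z => F z + G z) (fun z => F' z + G' z).
Proof.
move=> hF hG g t d Dg hg; rewrite mulrDl.
by apply: cderiveD; [exact: (hF _ _ _ Dg hg)|exact: (hG _ _ _ Dg hg)].
Qed.

Lemma holoV D F F' : (forall z, D z -> F z != 0) -> holo D F F' ->
  holo D (fun z => (F z)^-1) (fun z => - F' z * ((F z)^-1 * (F z)^-1)).
Proof.
move=> h0 hF g t d Dg hg; apply: cderive_eq.
  by apply: cderiveV; [exact: h0|exact: (hF _ _ _ Dg hg)].
by rewrite /= -exprVn; ring.
Qed.

Lemma holo_eq D F F' G : F' =1 G -> holo D F F' -> holo D F G.
Proof. by move=> e hF g t d Dg hg; rewrite -e; exact: hF. Qed.

Lemma pow_plusB1 kappa z : slit_plane z ->
  pow_plus (kappa - 1) z = pow_plus kappa z / z.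
Proof.
move=> h; rewrite /pow_plus mulrBl mul1r cexpD cexpN cexp_log_plus //.
Qed.

Lemma holo_pow_plus (D : set R[i]) kappa : (forall z, D z -> slit_plane z) ->
  holo D (pow_plus kappa) (fun z => kappa * pow_plus (kappa - 1) z).
Proof.
move=> hD g t d Dg hg; apply: cderive_eq.
  apply: cderive_exp; apply: cderiveZ.
  by apply: cderive_log_plus hg; exact: hD.
rewrite pow_plusB1; last exact: hD.
by rewrite /pow_plus; ring.
Qed.

Definition bounded_on (D : set R[i]) F := exists K : R, forall z, D z -> modulus (F z) <= K.

Lemma bounded_onM D F G : bounded_on D F -> bounded_on D G ->
  bounded_on D (fun z => F z * G z).
Proof.
move=> [K hK] [L hL]; exists (K * L) => z Dz; rewrite modulusM.
by apply: ler_pM; rewrite ?modulus_ge0 ?hK ?hL.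
Qed.

Lemma bounded_onD D F G : bounded_on D F -> bounded_on D G ->
  bounded_on D (fun z => F z + G z).
Proof.
move=> [K hK] [L hL]; exists (K + L) => z Dz.
by apply: le_trans (modulusD _ _) _; apply: lerD; rewrite ?hK ?hL.
Qed.

Lemma bounded_on_cst D c : bounded_on D (fun _ => c).
Proof. by exists (modulus c). Qed.

Lemma arg_plus_bound z : `|arg_plus z| <= 2 * pi.
Proof.
have x1 : -1 <= Re z / modulus z <= 1.
  rewrite -ler_norml normf_div [`|modulus z|]ger0_norm ?modulus_ge0 //.
  have [->|z0] := eqVneq z 0; first by rewrite modulus0 invr0 mulr0.
  by rewrite ler_pdivrMr ?modulus_gt0 // mul1r normRe_modulus.
have := acos_ge0 x1; have := acos_lepi x1; have := pi_ge0 R.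
rewrite /arg_plus ler_norml; case: ifP => _; move: (acos _) => y *; lra.
Qed.

(** Explicit because [mean_value] asks for a bound of the derivative, and powers have
    powers as derivatives. *)
Lemma bounded_on_pow_plus (D : set R[i]) kappa (lo hi : R) : 0 < lo ->
  (forall z, D z -> lo <= modulus z <= hi) -> bounded_on D (pow_plus kappa).
Proof.
move=> lo0 hD.
exists (expR (`|Re kappa| * (`|ln lo| + `|ln hi|) + `|Im kappa| * (2 * pi))) => z Dz.
have /andP[h1 h2] := hD _ Dz.
rewrite /pow_plus modulus_cexp ler_expR ReM /=.
have z0 : 0 < modulus z by exact: lt_le_trans h1.
have l1 : ln lo <= ln (modulus z) by rewrite ler_ln ?posrE.
have l2 : ln (modulus z) <= ln hi by rewrite ler_ln ?posrE // (lt_le_trans z0).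
have hl : `|ln (modulus z)| <= `|ln lo| + `|ln hi|.
  have := ler_norm (ln hi); have := ler_norm (- ln lo); rewrite normrN => a1 a2.
  have := normr_ge0 (ln hi); have := normr_ge0 (ln lo) => a3 a4.
  by rewrite ler_norml; apply/andP; split; lra.
apply: lerD.
  apply: le_trans (ler_norm _) _; rewrite normrM; exact: ler_wpM2l.
apply: le_trans (ler_norm _) _; rewrite normrN normrM.
by apply: ler_wpM2l => //; exact: arg_plus_bound.
Qed.

Section Circle.
Variables (nu : R[i]) (rho : R).
Hypothesis rho0 : 0 < rho.
Hypothesis disc : forall z, modulus (z - nu) <= rho -> slit_plane z.

(** A slightly larger disc, written as a union of circles to match [mean_value]. *)
Let fat (eta : R) := [set z | exists s t, [/\ - eta < s < eta & z = circle nu (s * rho) t]].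

Lemma circle_sub_modulus (r t : R) : modulus (circle nu r t - nu) = `|r|.
Proof. by rewrite /circle addrC addKr modulusM modulus_cis mulr1 modulus_real. Qed.

Lemma circle_slit t : slit_plane (circle nu rho t).
Proof. by apply: disc; rewrite circle_sub_modulus ger0_norm // ltW. Qed.

(** A closed disc in the slit plane has positive distance from the cut: with
    [Re nu >= 0] it avoids the point [Re nu], otherwise it avoids 0, and in both cases
    that is the point of the cut nearest to [nu]. *)
Lemma fat_disc : exists eta lo : R, [/\ 1 < eta <= 2, 0 < lo,
  forall z, fat eta z -> slit_plane z &
  forall z, fat eta z -> lo <= modulus z].
Proof.
have [delta [d1 d2 d3]] : exists delta : R, [/\ rho < delta, delta <= modulus nu &
    forall z, modulus (z - nu) < delta -> slit_plane z].
  have [R0|R0] := leP 0 (Re nu).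
    exists `|Im nu|; split; last 2 first.
    - exact: normIm_modulus.
    - move=> z hz; rewrite /slit_plane /= lecE /= => /andP[/eqP I0 _].
      by move: hz; apply/negP; rewrite -leNgt (le_trans _ (normIm_modulus _)) // ImD ImN I0 sub0r normrN.
    rewrite ltNge; apply/negP => h; have := @disc (Re nu)%:C.
    rewrite /slit_plane /= lecE /= eqxx R0 /= => /(_ _)/(_ isT); apply.
    by rewrite modulusE /sqmod ReD ImD ReN ImN /= subrr sub0r expr0n add0r sqrrN sqrtr_sqr.
  exists (modulus nu); split => //.
    rewrite ltNge; apply/negP => h; have := @disc 0.
    by rewrite /slit_plane /= sub0r modulusN lexx => /(_ h)/(_ isT).
  move=> z hz; rewrite /slit_plane /= lecE /= => /andP[/eqP I0 Rz].
  move: hz; apply/negP; rewrite -leNgt !modulusE ler_sqrt ?sqmod_ge0 //.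
  rewrite /sqmod ReD ImD ReN ImN I0 sub0r sqrrN lerD2r.
  by rewrite -sqrrN ler_sqr ?nnegrE; lra.
(* The bound 2 keeps the enlarged disc away from [mu] when [2 rho < modulus (mu - nu)]. *)
pose eta := Num.min 2 ((1 + delta / rho) / 2).
have q1 : 1 < delta / rho by rewrite ltr_pdivlMr // mul1r.
have e1 : 1 < eta <= 2.
  by rewrite /eta lt_min ge_min lexx andbT; apply/andP; split; lra.
have e2 : eta * rho < delta.
  rewrite -ltr_pdivlMr //.
  by rewrite /eta gt_min; apply/orP; right; lra.
have hs (s t : R) : - eta < s < eta -> `|s * rho| <= eta * rho.
  move=> hs; rewrite normrM [`|rho|]gtr0_norm // ler_pM2r //.
  by rewrite ler_norml; lra.
exists eta, (delta - eta * rho); split => //; first by rewrite subr_gt0.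
  move=> z [s [t [h ->]]]; apply: d3; rewrite circle_sub_modulus.
  by apply: le_lt_trans e2; exact: hs.
move=> z [s [t [h ->]]].
have := modulusD (circle nu (s * rho) t) (- (circle nu (s * rho) t - nu)).
rewrite opprB addrC subrK -opprB modulusN circle_sub_modulus.
move=> h2; rewrite lerBlDr; apply: le_trans d2 (le_trans h2 _).
by rewrite lerD2l; exact: hs.
Qed.

Variable mu : R[i].
Hypothesis mu_nu : mu = nu \/ 2 * rho < modulus (mu - nu).

Lemma circle_neq t : circle nu rho t - mu != 0.
Proof.
case: mu_nu => [->|h].
  by rewrite -modulus_gt0 circle_sub_modulus normr_gt0 gt_eqF.
apply/eqP => e; have := circle_sub_modulus rho t.
have -> : circle nu rho t = mu by apply/eqP; rewrite -subr_eq0 e.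
by rewrite gtr0_norm // => e2; move: h; rewrite e2 mulr_natl mulr2n gtrDl => /(lt_trans rho0); rewrite ltxx.
Qed.

Definition cauchy_kernel kappa (j : nat) : R[i] :=
  circle_integral (fun z => pow_plus kappa z * (z - mu)^-1 ^+ j.+1) nu rho.

(** For [mu = nu] this is the mean value property of [z ^ kappa]. For [mu] outside the
    disc it is that of [z ^ kappa (z - nu) / (z - mu)], which vanishes at the centre. *)
Lemma cauchy_kernel0 kappa : cauchy_kernel kappa 0 =
  if mu == nu then (0 +i* (2 * pi)) * pow_plus kappa mu else 0.
Proof.
have [eta [lo [/andP[eta1 eta2] lo0 hsl hlo]]] := fat_disc.
have hhi z : fat eta z -> lo <= modulus z <= modulus nu + 2 * rho.
  move=> hz; rewrite hlo //=; have [s [t [h ->]]] := hz.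
  have := modulusD nu (circle nu (s * rho) t - nu).
  rewrite addrC subrK circle_sub_modulus normrM [`|rho|]gtr0_norm // => h1.
  apply: le_trans h1 _; rewrite lerD2l ler_pM2r //.
  by rewrite ler_norml; lra.
have bp k := bounded_on_pow_plus k lo0 hhi.
have hp k := holo_pow_plus k hsl.
have ii : 'i%C * (2 * pi)%:C = 0 +i* (2 * pi) :> R[i].
  by apply: eq_ReIm; rewrite ?ReM ?ImM /=; ring.
have E t : 0 +i* rho * cexp (0 +i* t) = 'i * (circle nu rho t - nu).
  rewrite /circle addrC addKr [RHS]mulrA; congr (_ * _).
  by apply: eq_ReIm; rewrite ?ReM ?ImM /=; ring.
rewrite /cauchy_kernel /circle_integral.
case: eqVneq => [e|ne].
- have M := mean_value eta1 (hp kappa)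
     (holoM (holo_cst _ kappa) (hp (kappa - 1))).
  have [K hK] := bounded_onM (bounded_on_cst (fat eta) kappa) (bp (kappa - 1)).
  transitivity ('i * complex_integral 0 (2 * pi) (fun t => pow_plus kappa (circle nu rho t))).
    rewrite -cintegralZ.
      apply: eq_cintegral => t; rewrite -/(circle nu rho t) E expr1.
      by have := circle_neq t; rewrite e => nz; field.
    apply: (holo_ccont _ (holo_pow_plus kappa (fun z (h : slit_plane z) => h))
       circle_slit (cderive_circle _ _)).
  by rewrite (M K hK) mulrCA ii e mulrC.
- have h2 : 2 * rho < modulus (mu - nu) by case: mu_nu => // e; rewrite e eqxx in ne.
  have far z : fat eta z -> (modulus (mu - nu) - eta * rho) <= modulus (z - mu).
    move=> [s [t [h ->]]].
    have := modulusD (circle nu (s * rho) t - nu) (- (circle nu (s * rho) t - mu)).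
    have -> : circle nu (s * rho) t - nu - (circle nu (s * rho) t - mu) = mu - nu by ring.
    rewrite modulusN circle_sub_modulus normrM [`|rho|]gtr0_norm // => h1.
    have h3 : `|s| * rho <= eta * rho by rewrite ler_pM2r // ler_norml; lra.
    by rewrite lerBlDr; apply: le_trans h1 _; rewrite addrC lerD2l.
  have far0 : 0 < modulus (mu - nu) - eta * rho.
    have h3 : eta * rho <= 2 * rho by rewrite ler_pM2r.
    by rewrite subr_gt0 (le_lt_trans h3).
  have nz z : fat eta z -> z - mu != 0.
    by move=> hz; rewrite -modulus_gt0 (lt_le_trans far0) // far.
  have hV := holoV nz (holo_sub (fat eta) mu).
  have hN := holo_sub (fat eta) nu.
  have bV : bounded_on (fat eta) (fun z => (z - mu)^-1).
    exists (modulus (mu - nu) - eta * rho)^-1 => z hz.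
    by rewrite modulusV lef_pV2 ?posrE ?modulus_gt0 ?nz // far.
  have bN : bounded_on (fat eta) (fun z => z - nu).
    apply: bounded_onD (bounded_on_cst _ _).
    by exists (modulus nu + 2 * rho) => z /hhi/andP[].
  have hF := holoM (hp kappa) (holoM hN hV).
  have hF1 := holoM (holoM (holo_cst _ kappa) (hp (kappa - 1))) (holoM hN hV).
  have hF2 := holoM (hp kappa) (holoD (holoM (holo_cst _ 1) hV)
    (holoM hN (holoM (holo_cst _ (- 1)) (holoM hV hV)))).
  have M := mean_value eta1 hF (holoD hF1 hF2).
  have [K hK] := bounded_onD
    (bounded_onM (bounded_onM (bounded_on_cst (fat eta) kappa) (bp (kappa - 1))) (bounded_onM bN bV))
    (bounded_onM (bp kappa) (bounded_onD (bounded_onM (bounded_on_cst _ 1) bV)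
      (bounded_onM bN (bounded_onM (bounded_on_cst _ (- 1)) (bounded_onM bV bV))))).
  transitivity ('i * complex_integral 0 (2 * pi) (fun t => pow_plus kappa (circle nu rho t) *
      ((circle nu rho t - nu) * (circle nu rho t - mu)^-1))).
    rewrite -cintegralZ.
      by apply: eq_cintegral => t; rewrite -/(circle nu rho t) E expr1; ring.
    apply: (@holo_ccont _ _ (fat eta) _ _ _ _ hF _ (cderive_circle nu rho)) => t.
    by exists 1, t; rewrite mul1r; split => //; lra.
  by rewrite (M K hK) subrr mul0r mulr0 mul0r mulr0.
Qed.

(** Integration by parts: the derivative of [z ^ kappa (z - mu) ^ - (j + 1)] integrates
    to 0 over the closed circle. *)
Lemma cauchy_kernelS kappa j :
  cauchy_kernel kappa j.+1 = kappa / j.+1%:R * cauchy_kernel (kappa - 1) j.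
Proof.
pose D := [set z | slit_plane z /\ z - mu != 0].
have hD t : D (circle nu rho t) by split; [exact: circle_slit|exact: circle_neq].
have hp k := @holo_pow_plus D k (fun z (h : D z) => h.1).
have hV := holoV (fun z (h : D z) => h.2) (holo_sub D mu).
have hVn n : holo D (fun z => (z - mu)^-1 ^+ n) (fun z => - n%:R * (z - mu)^-1 ^+ n.+1).
  elim: n => [|n ih].
    apply: holo_eq (holo_cst _ 1) => z; by rewrite oppr0 mul0r.
  have -> : (fun z => (z - mu)^-1 ^+ n.+1) = (fun z => (z - mu)^-1 * (z - mu)^-1 ^+ n).
    by apply/funext => z; rewrite exprS.
  apply: holo_eq (holoM hV ih) => z /=.
  by rewrite !exprS -[n.+1%:R]natr1; ring.
have hcis A : ccont A (fun t : R => 0 +i* rho * cexp (0 +i* t) : R[i]).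
  by apply: cderive_ccont => t; apply: cderiveZ; exact: cderive_cis.
have cc k n A : ccont A (fun t => pow_plus k (circle nu rho t) *
    (circle nu rho t - mu)^-1 ^+ n * (0 +i* rho * cexp (0 +i* t))).
  apply: ccontM; last exact: hcis.
  exact: (holo_ccont _ (holoM (hp k) (hVn n)) hD (cderive_circle _ _)).
have n0 : (j.+1%:R : R[i]) != 0 by rewrite pnatr_eq0.
have pi2 : 0 < 2 * pi :> R by rewrite mulr_gt0 // pi_gt0.
have H t := holoM (hp kappa) (hVn j.+1) (hD t) (cderive_circle nu rho t).
have := cintegral_derive pi2 H.
rewrite circle_period subrr => Z.
apply: (mulfI n0); rewrite mulrA mulrCA divff // mulr1.
apply/eqP; rewrite eq_sym -subr_eq0 -mulNr; apply/eqP.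
rewrite /cauchy_kernel /circle_integral -!cintegralZ; try exact: cc.
rewrite -cintegralD; last 2 first.
- by apply: ccontM; [exact: ccont_cst|exact: cc].
- by apply: ccontM; [exact: ccont_cst|exact: cc].
rewrite -[RHS]Z.
  by apply: eq_cintegral => t; rewrite -/(circle nu rho t); ring.
have := ccontD (ccontM (ccont_cst `[0, 2 * pi]%classic kappa) (cc (kappa - 1) j.+1 `[0, 2 * pi]%classic))
  (ccontM (ccont_cst `[0, 2 * pi]%classic (- j.+1%:R)) (cc kappa j.+2 `[0, 2 * pi]%classic)).
by apply: ccont_eq => t _; ring.
Qed.

Lemma cauchy_kernelE kappa j : cauchy_kernel kappa j =
  if mu == nu then (0 +i* (2 * pi)) * (ffactc kappa j / j`!%:R * pow_plus (kappa - j%:R) mu)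
  else 0.
Proof.
elim: j kappa => [|j ih] kappa.
  by rewrite cauchy_kernel0 fact0 invr1 mulr1 mul1r subr0.
rewrite cauchy_kernelS ih; case: ifP => _; last by rewrite mulr0.
have n0 : (j.+1%:R : R[i]) != 0 by rewrite pnatr_eq0.
have f0 : (j`!%:R : R[i]) != 0 by rewrite pnatr_eq0 -lt0n fact_gt0.
have -> : kappa - 1 - j%:R = kappa - j.+1%:R by rewrite -[j.+1%:R]natr1; ring.
rewrite factS natrM -[ffactc kappa j.+1]/(kappa * ffactc (kappa - 1) j).
set p := pow_plus _ _; set a := j.+1%:R in n0 *; set b := j`!%:R in f0 *.
by field; rewrite f0 -[1 + _]mulrS n0.
Qed.

End Circle.
End CauchyPowers.

Arguments holo_cst {R} D c : rename.
Arguments holo_sub {R} D c : rename.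

(** * Generalized eigenvectors *)

Section GeneralizedEigenvectors.
Variable F : closedFieldType.

Lemma mxexpS n (M : 'M[F]_n) k : M ^+ k.+1 = M *m M ^+ k.
Proof. by rewrite exprS. Qed.

Lemma mxexpSr n (M : 'M[F]_n) k : M ^+ k.+1 = M ^+ k *m M.
Proof. by rewrite exprSr. Qed.

Lemma mxexp0 n (M : 'M[F]_n) : M ^+ 0 = 1%:M.
Proof. by rewrite expr0. Qed.

Lemma trmx_exp n (M : 'M[F]_n) k : M^T ^+ k = (M ^+ k)^T.
Proof.
elim: k => [|k ih]; first by rewrite !mxexp0 trmx1.
by rewrite mxexpS mxexpSr ih trmx_mul.
Qed.

(** Over an algebraically closed field the generalized eigenvectors span: by
    Cayley-Hamilton the characteristic polynomial annihilates the matrix, and its coprime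
    factors split the kernel. Linear statements are therefore checked on generalized
    eigenvectors, which replaces the Jordan form. *)
Lemma generalized_eigenrow_ind n (A : 'M[F]_n) (P : 'rV[F]_n -> Prop) :
  P 0 -> (forall u v, P u -> P v -> P (u + v)) ->
  (forall a k v, v *m (A - a%:M) ^+ k = 0 -> P v) -> forall v, P v.
Proof.
case: n A P => [|n] A P P0 PD Pg v; first by rewrite thinmx0.
have [r cpE] := closed_field_poly_normal (char_poly A).
rewrite (eqP (char_poly_monic A)) scale1r -prodr_undup_exp_count big_tnth in cpE.
have : (v <= kermxpoly A (char_poly A))%MS.
  by rewrite (kermxpoly_min (mxminpoly_dvd_char A)) submx1.
rewrite cpE (kermxpoly_prod A _); last first.
  move=> i j _ _ ji; rewrite coprimep_expl // coprimep_expr //.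
  rewrite coprimep_XsubC root_XsubC; apply: contra ji => /eqP.
  move=> /(tuple_uniqP (in_tuple (undup r)) (undup_uniq r)) e.
  by rewrite e.
move=> /sub_sumsmxP[u ->].
elim/big_ind: _ => // i _.
apply: (Pg (tnth (in_tuple (undup r)) i) (count_mem (tnth (in_tuple (undup r)) i) r)).
rewrite -mulmxA /kermxpoly rmorphXn rmorphB /= horner_mx_X horner_mx_C mulmx_ker.
exact: mulmx0.
Qed.

Lemma generalized_eigencol_ind n (A : 'M[F]_n) (P : 'cV[F]_n -> Prop) :
  P 0 -> (forall u v, P u -> P v -> P (u + v)) ->
  (forall a k v, (A - a%:M) ^+ k *m v = 0 -> P v) -> forall v, P v.
Proof.
move=> P0 PD Pg v; rewrite -[v]trmxK.
apply: (@generalized_eigenrow_ind n A^T (fun u => P u^T)) => [|u w Pu Pw|a k u h].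
- by rewrite trmx0.
- by rewrite linearD; exact: PD.
- apply: (Pg a k); apply: trmx_inj.
  by rewrite trmx_mul trmxK trmx0 -trmx_exp linearB /= tr_scalar_mx.
Qed.

Lemma noneigenvalue_exp_unitmx n (A : 'M[F]_n) a k :
  ~~ eigenvalue A a -> (A - a%:M) ^+ k \in unitmx.
Proof.
move=> na; elim: k => [|k ih]; first by rewrite mxexp0 unitmx1.
rewrite mxexpS unitmx_mul ih andbT -row_free_unit -kermx_eq0.
by move: na; rewrite /eigenvalue negbK.
Qed.

Lemma generalized_eigencol_value n (A : 'M[F]_n) a k (v : 'cV_n) :
  (A - a%:M) ^+ k *m v = 0 -> v != 0 -> eigenvalue A a.
Proof.
move=> h v0; apply: contraT => /(noneigenvalue_exp_unitmx k) u.
by rewrite -(mulKmx u v) h mulmx0 eqxx in v0.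
Qed.

Lemma generalized_eigenrow_value n (A : 'M[F]_n) a k (v : 'rV_n) :
  v *m (A - a%:M) ^+ k = 0 -> v != 0 -> eigenvalue A a.
Proof.
move=> h v0; apply: contraT => /(noneigenvalue_exp_unitmx k) u.
by rewrite -(mulmxK u v) h mul0mx eqxx in v0.
Qed.

(** The Neumann series of the resolvent, which is finite here. *)
Lemma resolvent_generalized_eigencol n (A : 'M[F]_n) a k (v : 'cV_n) z :
  (A - a%:M) ^+ k *m v = 0 -> z != a -> z%:M - A \in unitmx ->
  invmx (z%:M - A) *m v =
  \sum_(j < k) (z - a)^-1 ^+ j.+1 *: ((A - a%:M) ^+ j *m v).
Proof.
move=> h za u; rewrite -[RHS](mulKmx u); congr (_ *m _); apply/esym.
have -> : z%:M - A = (z - a)%:M - (A - a%:M) by rewrite rmorphB opprB addrA subrK.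
rewrite mulmxBl mul_scalar_mx scaler_sumr mulmx_sumr -sumrB.
pose f j := (z - a)^-1 ^+ j *: ((A - a%:M) ^+ j *m v).
have tel m : \sum_(j < m) (f j - f j.+1) = f 0%N - f m.
  elim: m => [|m ih]; first by rewrite big_ord0 subrr.
  by rewrite big_ord_recr /= ih addrA subrK.
transitivity (\sum_(j < k) (f j - f j.+1)).
  apply: eq_bigr => j _; congr (_ - _).
    by rewrite scalerA exprS mulrA divff ?subr_eq0 // mul1r.
  by rewrite -scalemxAr mulmxA -mxexpS.
by rewrite tel /f h scaler0 subr0 mxexp0 mul1mx expr0 scale1r.
Qed.

End GeneralizedEigenvectors.

(** * The functional calculus of powers *)

Section HolomorphicCalculusOfPowers.
Context {R : realType} {l : nat}.
Variable Z : 'M[R[i]]_l.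
Hypothesis specZ : forall mu, spectrum Z mu -> slit_plane mu.

(** Finitely many conditions, each valid for all small radii, hold simultaneously for all
    small radii. *)
Lemma small_radius (T : eqType) (s : seq T) (Q : T -> R -> Prop) :
  (forall x, x \in s -> exists2 d : R, 0 < d & forall r, 0 < r <= d -> Q x r) ->
  exists2 d : R, 0 < d & forall r, 0 < r <= d -> forall x, x \in s -> Q x r.
Proof.
elim: s => [|y s ih] h; first by exists 1.
have [|d d0 hd] := ih; first by move=> x xs; apply: h; rewrite in_cons xs orbT.
have [e e0 he] := h y (mem_head _ _).
exists (Num.min d e); first by rewrite lt_min d0.
move=> r; rewrite le_min => /and3P[r0 rd re] x; rewrite in_cons => /predU1P[->|xs].
- by apply: he; rewrite r0.
- by apply: hd; rewrite ?r0.
Qed.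

(** Both [modulus] and [Re] are 1-Lipschitz, so their difference stays positive within a
    third of its value. *)
Lemma slit_plane_ball mu : slit_plane mu -> exists2 d : R, 0 < d &
  forall z, modulus (z - mu) <= d -> slit_plane z.
Proof.
move=> /slit_planeP h; exists ((modulus mu - Re mu) / 3); first by rewrite divr_gt0 // subr_gt0.
move=> z hz; apply/slit_planeP.
have h1 := modulusD z (- (z - mu)).
have e1 : z - (z - mu) = mu by ring.
rewrite e1 modulusN in h1.
have := normRe_modulus (z - mu); rewrite ler_norml => /andP[_].
rewrite ReD ReN => h2.
lra.
Qed.

Lemma spectrum_seq : exists s : seq R[i], uniq s /\ spectrum Z = [set` s].
Proof.
have [r cpE] := closed_field_poly_normal (char_poly Z).
exists (undup r); split; first exact: undup_uniq.
apply/seteqP; split => x; rewrite /spectrum /= mem_undup eigenvalue_root_char cpE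
  (eqP (char_poly_monic Z)) scale1r root_prod_XsubC //.
Qed.

Lemma admissible_radius_ex : exists rho, admissible_radius slit_plane Z rho.
Proof.
have [s [us es]] := spectrum_seq.
have [d1 d10 h1] : exists2 d : R, 0 < d & forall r, 0 < r <= d ->
    forall mu, mu \in s -> forall z, modulus (z - mu) <= r -> slit_plane z.
  apply: small_radius => mu hmu.
  have smu : slit_plane mu by apply: specZ; rewrite es.
  have [d d0 hd] := slit_plane_ball smu; exists d => // r /andP[_ rd] z hz.
  by apply: hd; exact: le_trans rd.
have [d2 d20 h2] : exists2 d : R, 0 < d & forall r, 0 < r <= d ->
    forall mu, mu \in s -> forall nu, nu \in s -> mu != nu -> 2 * r < modulus (mu - nu).
  apply: small_radius => mu _; apply: small_radius => nu _.
  have [->|ne] := eqVneq mu nu; first by exists 1.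
  have m0 : 0 < modulus (mu - nu) by rewrite modulus_gt0 subr_eq0.
  exists (modulus (mu - nu) / 3); first by rewrite divr_gt0.
  by move=> r /andP[r0 hr] _; lra.
exists (Num.min d1 d2).
have m0 : 0 < Num.min d1 d2 by rewrite lt_min d10.
split; first exact: m0.
- move=> mu z; rewrite es /= => hmu; apply: h1 => //.
  by rewrite m0 ge_min lexx.
- move=> mu nu; rewrite es /= => hmu hnu; apply: h2 => //.
  by rewrite m0 ge_min lexx orbT.
Qed.

(** The constant [e] lets the same argument serve both branches of the power. *)
Variables (lam e : R[i]) (f : R[i] -> R[i]).
Hypothesis fE : forall z, slit_plane z -> f z = e * pow_plus lam z.

Let rho := xget 0 (admissible_radius slit_plane Z).
Let rhoP : admissible_radius slit_plane Z rho := xgetPex 0 admissible_radius_ex.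

Let rho0 : 0 < rho. Proof. by case: rhoP. Qed.
Let disc nu : spectrum Z nu -> forall z, modulus (z - nu) <= rho -> slit_plane z.
Proof. by move=> h z; case: rhoP => _ H _; exact: H. Qed.
Let sep nu mu : spectrum Z nu -> spectrum Z mu -> mu = nu \/ 2 * rho < modulus (mu - nu).
Proof.
by move=> h1 h2; have [->|ne] := eqVneq mu nu; [left|right; case: rhoP => _ _; apply].
Qed.

Let circle_resolvent nu t : spectrum Z nu -> (circle nu rho t)%:M - Z \in unitmx.
Proof.
move=> hnu; rewrite -opprB -scaleN1r unitmxZ ?unitrN1 //.
rewrite -row_free_unit -kermx_eq0; apply: contraT => h.
have hz : spectrum Z (circle nu rho t) by exact: h.
by have := circle_neq rho0 (sep hnu hz) t; rewrite subrr eqxx.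
Qed.

Let integrand nu (g : R[i] -> R[i]) t := f (circle nu rho t) * g (circle nu rho t) *
  (0 +i* rho * cexp (0 +i* t)).

Let pow_kernel nu mu j t := pow_plus lam (circle nu rho t) *
  (circle nu rho t - mu)^-1 ^+ j * (0 +i* rho * cexp (0 +i* t)).

Let pow_kernel_ccont nu mu j (A : set R) : spectrum Z nu -> spectrum Z mu ->
  ccont A (pow_kernel nu mu j).
Proof.
move=> hnu hmu; pose D := [set z : R[i] | slit_plane z /\ z - mu != 0].
have hD t : D (circle nu rho t).
  by split; [exact: circle_slit (disc hnu) t|exact: circle_neq (sep hnu hmu) t].
have hV := holoV (fun z (h : D z) => h.2) (holo_sub D mu).
have hVn n : exists F', holo D (fun z => (z - mu)^-1 ^+ n) F'.
  elim: n => [|n [F' ih]]; first by exists (fun _ => 0); exact: holo_cst.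
  eexists; have -> : (fun z => (z - mu)^-1 ^+ n.+1) = (fun z => (z - mu)^-1 * (z - mu)^-1 ^+ n).
    by apply/funext => z; rewrite exprS.
  exact: holoM hV ih.
have [F' hF'] := hVn j.
apply: ccontM; last by apply: cderive_ccont => t; apply: cderiveZ; exact: cderive_cis.
apply: ccontM; last exact: (holo_ccont _ hF' hD (cderive_circle _ _)).
exact: (holo_ccont _ (@holo_pow_plus _ D lam (fun z (h : D z) => h.1)) hD (cderive_circle _ _)).
Qed.

Let integrandE nu mu j t : spectrum Z nu ->
  integrand nu (fun z => (z - mu)^-1 ^+ j) t = e * pow_kernel nu mu j t.
Proof.
move=> hnu; rewrite /integrand /pow_kernel fE; last exact: circle_slit (disc hnu) t.
by ring.
Qed.

Let kernel_ccont nu mu j (A : set R) : spectrum Z nu -> spectrum Z mu ->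
  ccont A (integrand nu (fun z => (z - mu)^-1 ^+ j)).
Proof.
move=> hnu hmu; apply: (@ccont_eq _ _ (fun t => e * pow_kernel nu mu j t)).
  by move=> t _; rewrite integrandE.
by apply: ccontM; [exact: ccont_cst|exact: pow_kernel_ccont].
Qed.

Let resolvent_eigencol nu mu k (c : 'cV_l) t : spectrum Z nu -> (Z - mu%:M) ^+ k *m c = 0 ->
  c != 0 -> invmx ((circle nu rho t)%:M - Z) *m c =
  \sum_(j < k) (circle nu rho t - mu)^-1 ^+ j.+1 *: ((Z - mu%:M) ^+ j *m c).
Proof.
move=> hnu h c0; have hmu := generalized_eigencol_value h c0.
apply: resolvent_generalized_eigencol => //; last exact: circle_resolvent.
by rewrite -subr_eq0; exact: circle_neq (sep hnu hmu) t.
Qed.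

(** The integrals are additive only for integrable functions; continuity of the entries of
    the resolvent on the circle follows from its expansion on generalized eigenvectors. *)
Let resolvent_ccont nu (c : 'cV_l) i A : spectrum Z nu ->
  ccont A (integrand nu (fun z => (invmx (z%:M - Z) *m c) i 0)).
Proof.
move=> hnu; move: c.
apply: (@generalized_eigencol_ind _ _ Z) => [|u v hu hv|mu k c h].
- apply: (ccont_eq _ (ccont_cst A 0)) => t _.
  by rewrite /integrand mulmx0 mxE mulr0 mul0r.
- apply: (ccont_eq _ (ccontD hu hv)) => t _.
  by rewrite /integrand mulmxDr [in RHS]mxE; ring.
- have [->|c0] := eqVneq c 0.
    apply: (ccont_eq _ (ccont_cst A 0)) => t _.
    by rewrite /integrand mulmx0 mxE mulr0 mul0r.
  have hmu := generalized_eigencol_value h c0.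
  apply: (@ccont_eq _ _ (fun t => \sum_(j < k) ((Z - mu%:M) ^+ j *m c) i 0 *
     integrand nu (fun z => (z - mu)^-1 ^+ j.+1) t)).
    move=> t _; rewrite /integrand (resolvent_eigencol t hnu h c0) summxE.
    rewrite mulr_sumr mulr_suml; apply: eq_bigr => j _; rewrite [in RHS]mxE; ring.
  apply: ccont_sum => j _; apply: ccontM; first exact: ccont_cst.
  exact: (kernel_ccont j.+1 _ hnu hmu).
Qed.

(** On a generalized eigenvector [f(Z)] acts by the Taylor polynomial of [f] at the
    eigenvalue: by the finite expansion of the resolvent the integrals are those of
    Cauchy's formula, and only the circle around [mu] contributes. In particular the value
    does not depend on the radius. *)
Lemma holomorphic_calculus_eigencol mu k (c : 'cV_l) : (Z - mu%:M) ^+ k *m c = 0 ->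
  holomorphic_calculus slit_plane f Z *m c =
  \sum_(j < k) (e * (ffactc lam j / j`!%:R * pow_plus (lam - j%:R) mu)) *:
     ((Z - mu%:M) ^+ j *m c).
Proof.
move=> h; have [->|c0] := eqVneq c 0.
  by rewrite mulmx0 big1 // => j _; rewrite mulmx0 scaler0.
have hmu := generalized_eigencol_value h c0.
have [s [us es]] := spectrum_seq.
have ins nu : nu \in s -> spectrum Z nu by rewrite es.
have pi2 : (0 +i* (2 * pi) : R[i]) != 0.
  by rewrite eq_complex /= negb_and; apply/orP; right; rewrite gt_eqF // mulr_gt0 // pi_gt0.
apply/matrixP => i q; rewrite ord1 {q}.
have step nu : nu \in s -> \sum_q circle_integral (fun z => f z * invmx (z%:M - Z) i q) nu rho * c q 0
   = \sum_(j < k) (if mu == nu then (0 +i* (2 * pi)) *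
      (e * (ffactc lam j / j`!%:R * pow_plus (lam - j%:R) mu)) * ((Z - mu%:M) ^+ j *m c) i 0 else 0).
  move=> /ins hnu.
  transitivity (complex_integral 0 (2 * pi) (integrand nu (fun z => (invmx (z%:M - Z) *m c) i 0))).
    have cc q : ccont `[0, 2 * pi] (integrand nu (fun z => invmx (z%:M - Z) i q)).
      have := resolvent_ccont (delta_mx q 0) i `[0, 2 * pi] hnu.
      by apply: ccont_eq => t _; rewrite /integrand -colE mxE.
    transitivity (\sum_q complex_integral 0 (2 * pi) (fun t => c q 0 * integrand nu (fun z => invmx (z%:M - Z) i q) t)).
      by apply: eq_bigr => q _; rewrite cintegralZ // mulrC.
    rewrite -cintegral_sum; last by move=> q; apply: ccontM; [exact: ccont_cst|].
    apply: eq_cintegral => t; rewrite /integrand mxE mulr_sumr mulr_suml.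
    by apply: eq_bigr => q _; ring.
  transitivity (\sum_(j < k) ((Z - mu%:M) ^+ j *m c) i 0 * e * cauchy_kernel nu rho mu lam j).
    transitivity (\sum_(j < k) complex_integral 0 (2 * pi) (fun t => ((Z - mu%:M) ^+ j *m c) i 0 *
       integrand nu (fun z => (z - mu)^-1 ^+ j.+1) t)).
      rewrite -cintegral_sum; last first.
        by move=> j; apply: ccontM; [exact: ccont_cst|exact: (kernel_ccont j.+1 _ hnu hmu)].
      apply: eq_cintegral => t; rewrite /integrand (resolvent_eigencol t hnu h c0) summxE.
      rewrite mulr_sumr mulr_suml; apply: eq_bigr => j _; rewrite [in LHS]mxE; ring.
    apply: eq_bigr => j _; rewrite cintegralZ; last exact: (kernel_ccont j.+1 _ hnu hmu).
    rewrite -mulrA; congr (_ * _).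
    rewrite /cauchy_kernel /circle_integral -cintegralZ.
      by apply: eq_cintegral => t; rewrite integrandE.
    exact: (pow_kernel_ccont j.+1 _ hnu hmu).
  apply: eq_bigr => j _; rewrite (cauchy_kernelE rho0 (disc hnu) (sep hnu hmu)).
  by case: ifP => _; [ring|rewrite mulr0].
rewrite mxE; under eq_bigr => q _.
  rewrite mxE -/rho es -fsbig_seq // mulr_sumr mulr_suml. over.
rewrite exchange_big /=.
transitivity (\sum_(nu <- s) (0 +i* (2 * pi))^-1 * \sum_(j < k) (if mu == nu then
    (0 +i* (2 * pi)) * (e * (ffactc lam j / j`!%:R * pow_plus (lam - j%:R) mu)) *
    ((Z - mu%:M) ^+ j *m c) i 0 else 0)).
  apply: eq_big_seq => nu hnu; rewrite -(step nu hnu) mulr_sumr.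
  by apply: eq_bigr => q _; rewrite mulrA.
have mus : mu \in s by have : spectrum Z mu by []; rewrite es.
rewrite (bigD1_seq mu) //= eqxx [X in _ + X]big1 ?addr0; last first.
  move=> nu; rewrite eq_sym => /negbTE ->.
  by rewrite big1 ?mulr0.
rewrite mulr_sumr summxE; apply: eq_bigr => j _.
by rewrite [in RHS]mxE !mulrA mulVf // mul1r.
Qed.

End HolomorphicCalculusOfPowers.

(** * The matrix curve [cos phi + sin phi * V] *)

Section Turn.
Context {R : realType} {l : nat}.
Implicit Types (V : 'M[R[i]]_l) (phi alpha : R) (mu kappa lam : R[i]).

Definition turnmx V phi : 'M[R[i]]_l := (cos phi)%:C%:M + (sin phi)%:C *: V.
Definition turnmx' V phi : 'M[R[i]]_l := (- sin phi)%:C%:M + (cos phi)%:C *: V.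

Definition vderive (y : R -> 'cV[R[i]]_l) (t : R) (d : 'cV[R[i]]_l) : Prop :=
  forall i, cderive (fun s => y s i 0) t (d i 0).

Lemma vderive_eq y t d e : vderive y t d -> d = e -> vderive y t e.
Proof. by move=> h <-. Qed.

Lemma vderive_near y z t d :
  (\forall s \near t, y s = z s) -> vderive y t d -> vderive z t d.
Proof.
by move=> h hy i; apply: cderive_near (hy i); apply: filterS h => s ->.
Qed.

Lemma vderiveD y z t d e : vderive y t d -> vderive z t e ->
  vderive (fun s => y s + z s) t (d + e).
Proof.
move=> hy hz i; rewrite mxE; under eq_fun do rewrite mxE.
exact: cderiveD.
Qed.

Lemma vderiveN y t d : vderive y t d -> vderive (fun s => - y s) t (- d).
Proof.
move=> hy i; rewrite mxE; under eq_fun do rewrite mxE.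
exact: cderiveN.
Qed.

Lemma vderiveM (a : R -> R[i]) y t b d : cderive a t b -> vderive y t d ->
  vderive (fun s => a s *: y s) t (b *: y t + a t *: d).
Proof.
move=> ha hy i; rewrite !mxE; under eq_fun do rewrite mxE.
exact: cderiveM.
Qed.

Lemma vderive_mulmx (A : 'M[R[i]]_l) y t d : vderive y t d ->
  vderive (fun s => A *m y s) t (A *m d).
Proof.
move=> hy i; rewrite mxE; under eq_fun do rewrite mxE.
by apply: cderive_sum => j _; exact: cderiveZ.
Qed.

Lemma eigenvalue_turnmx V phi nu : eigenvalue (turnmx V phi) nu ->
  (exists2 mu, eigenvalue V mu & nu = turn mu phi) \/ (sin phi = 0 /\ nu = (cos phi)%:C).
Proof.
move=> /eigenvalueP[v hv v0].
have [s0|s0] := eqVneq (sin phi) 0; [right|left].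
  split => //; move: hv; rewrite /turnmx s0 scale0r addr0 mul_mx_scalar.
  move=> /eqP; rewrite -subr_eq0 -scalerBl scaler_eq0 (negbTE v0) orbF subr_eq0.
  by move=> /eqP.
have s1 : (sin phi)%:C != 0 :> R[i] by rewrite eq_complex /= eqxx andbT.
exists ((nu - (cos phi)%:C) / (sin phi)%:C); last first.
  by rewrite /turn mulrC divfK // addrC subrK.
apply/eigenvalueP; exists v => //.
apply: (scalerI s1); rewrite scalerA mulrC divfK // scalerBl -hv.
by rewrite /turnmx mulmxDr mul_mx_scalar addrC addKr -scalemxAr.
Qed.

Lemma turnmx_slit_plane V phi : (forall mu, spectrum V mu -> Im mu != 0) ->
  0 < phi < 2 * pi -> forall nu, spectrum (turnmx V phi) nu -> slit_plane nu.
Proof.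
move=> hV hphi nu /eigenvalue_turnmx [[mu hmu ->]|[s0 ->]].
  by apply: turn_slit_plane => //; exact: hV.
have := @turn_slit_plane R 'i phi _ hphi.
rewrite /turn s0 mul0r addr0; apply; exact: oner_neq0.
Qed.

Lemma turnmx_sub V phi mu : turnmx V phi - (turn mu phi)%:M = (sin phi)%:C *: (V - mu%:M).
Proof.
rewrite /turnmx /turn rmorphD /= scalerBr scale_scalar_mx opprD addrACA subrr add0r.
by [].
Qed.

Lemma turnmx'_sub V phi mu : turnmx' V phi - (turn' mu phi)%:M = (cos phi)%:C *: (V - mu%:M).
Proof.
by rewrite /turnmx' /turn' rmorphD /= scalerBr scale_scalar_mx opprD addrACA subrr add0r.
Qed.

End Turn.

(** * Homogeneous solutions built from powers *)

Section SmoothClass.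
Context {R : realType}.
Variable alpha : R.
Hypothesis halpha : 0 < alpha < 2 * pi.
Implicit Types (f g : R -> R[i]) (mu kappa : R[i]) (t : R).

(** A class of functions that is closed under differentiation, which gives smoothness
    without formulas for higher derivatives. *)
Inductive trigpow : (R -> R[i]) -> Prop :=
| trigpow_cst c : trigpow (fun _ => c)
| trigpow_cos : trigpow (fun t => (cos t)%:C)
| trigpow_sin : trigpow (fun t => (sin t)%:C)
| trigpow_pow kappa mu of Im mu != 0 : trigpow (fun t => cexp (kappa * turn_log mu t))
| trigpow_add f g of trigpow f & trigpow g : trigpow (fun t => f t + g t)
| trigpow_mul f g of trigpow f & trigpow g : trigpow (fun t => f t * g t).

Lemma cderive_turn_pow kappa mu (t : R) : Im mu != 0 -> 0 < t < alpha ->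
  cderive (fun s => cexp (kappa * turn_log mu s)) t
    (kappa * turn' mu t * cexp ((kappa - 1) * turn_log mu t)).
Proof.
move=> mu0 ht; have ht' : 0 < t < 2 * pi.
  by move: halpha ht => /andP[_ a2] /andP[-> ta] /=; exact: lt_trans a2.
apply: cderive_eq.
  by apply: cderive_exp; apply: cderiveZ; exact: cderive_turn_log mu0 ht'.
rewrite mulrBl mul1r cexpD cexpN cexp_turn_log //; last by move: ht' => /andP[/ltW-> ->].
by ring.
Qed.

Lemma trigpow_ccont f : trigpow f -> ccont `[0, alpha] f.
Proof.
elim=> {f} [c|||kappa mu mu0|f g _ cf _ cg|f g _ cf _ cg].
- exact: ccont_cst.
- apply: cderive_ccont => t; apply: cderive_real; exact: is_derive_cos.
- apply: cderive_ccont => t; apply: cderive_real; exact: is_derive_sin.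
- apply: ccont_exp; apply: ccontM; first exact: ccont_cst.
  exact: ccont_turn_log.
- exact: ccontD.
- exact: ccontM.
Qed.

Lemma trigpow_turn' mu : trigpow (turn' mu).
Proof.
have -> : turn' mu = (fun t => - 1 * (sin t)%:C + (cos t)%:C * mu).
  by apply/funext => t; rewrite /turn' rmorphN mulN1r.
apply: trigpow_add; apply: trigpow_mul; first exact: trigpow_cst.
- exact: trigpow_sin.
- exact: trigpow_cos.
- exact: trigpow_cst.
Qed.

Lemma trigpow_derive f : trigpow f ->
  exists2 f', trigpow f' & forall t, 0 < t < alpha -> cderive f t (f' t).
Proof.
elim=> {f} [c|||kappa mu mu0|f g tf [f' tf' hf] tg [g' tg' hg]
   |f g tf [f' tf' hf] tg [g' tg' hg]].
- by exists (fun _ => 0) => [|t _]; [exact: trigpow_cst|exact: cderive_cst].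
- exists (fun t => -1 * (sin t)%:C).
    by apply: trigpow_mul; [exact: trigpow_cst|exact: trigpow_sin].
  move=> t _; rewrite mulN1r -rmorphN; apply: cderive_real; exact: is_derive_cos.
- exists (fun t => (cos t)%:C); first exact: trigpow_cos.
  by move=> t _; apply: cderive_real; exact: is_derive_sin.
- exists (fun t => kappa * turn' mu t * cexp ((kappa - 1) * turn_log mu t)).
    apply: trigpow_mul; last exact: trigpow_pow.
    by apply: trigpow_mul; [exact: trigpow_cst|exact: trigpow_turn'].
  by move=> t ht; exact: cderive_turn_pow.
- exists (fun t => f' t + g' t); first exact: trigpow_add.
  by move=> t ht; apply: cderiveD; [exact: hf|exact: hg].
- exists (fun t => f' t * g t + f t * g' t).
    by apply: trigpow_add; exact: trigpow_mul.
  by move=> t ht; apply: cderiveM; [exact: hf|exact: hg].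
Qed.

(** Derivatives of all orders are chosen successively within the class. *)
Lemma trigpow_smooth f : trigpow f ->
  smooth_on_itv 0 alpha (fun t => Re (f t)) /\ smooth_on_itv 0 alpha (fun t => Im (f t)).
Proof.
move=> tf.
have next (g : {g | trigpow g}) : exists h : {g | trigpow g},
    forall t, 0 < t < alpha -> cderive (sval g) t (sval h t).
  by case: g => g tg; have [h th hh] := trigpow_derive tg; exists (exist _ h th).
have [D hD] := choice next.
pose u n := iter n D (exist _ f tf).
have cu n : ccont `[0, alpha] (sval (u n)) by apply: trigpow_ccont; exact: svalP.
have du n t : 0 < t < alpha -> cderive (sval (u n)) t (sval (u n.+1) t) by exact: hD.
split.
- exists (fun n t => Re (sval (u n) t)); split => //.
  + by move=> n; case: (cu n).
  + by move=> n t /(du n) [].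
- exists (fun n t => Im (sval (u n) t)); split => //.
  + by move=> n; case: (cu n).
  + by move=> n t /(du n) [].
Qed.

Lemma trigpow_exp f n : trigpow f -> trigpow (fun t => f t ^+ n).
Proof.
move=> tf; elim: n => [|n ih].
  by under eq_fun do rewrite expr0; exact: trigpow_cst.
by under eq_fun do rewrite exprS; exact: trigpow_mul.
Qed.

Lemma trigpow_sum (I : Type) (r : seq I) (F : I -> R -> R[i]) :
  (forall i, trigpow (F i)) -> trigpow (fun t => \sum_(i <- r) F i t).
Proof.
move=> h; elim: r => [|i r ih].
  by under eq_fun do rewrite big_nil; exact: trigpow_cst.
by under eq_fun do rewrite big_cons; exact: trigpow_add.
Qed.

Section Solution.
Context {l : nat}.
Variables (up : bool) (V : 'M[R[i]]_l) (lam : R[i]).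
Hypothesis specV : forall mu, spectrum V mu -> if up then 0 < Im mu else Im mu < 0.

Lemma spectrum_nonreal mu : spectrum V mu -> Im mu != 0.
Proof. by move=> /specV; case: (up) => h; [rewrite gt_eqF|rewrite lt_eqF]. Qed.

(** [up] selects the branch that belongs to eigenvalues [mu] of [V] with [Im mu > 0]. *)
Definition mxpow (Z : 'M[R[i]]_l) : 'M[R[i]]_l :=
  if up then mxpow_plus Z lam else mxpow_minus Z lam.

Lemma cexp_mulrn n z : cexp (n%:R * z) = cexp z ^+ n :> R[i].
Proof.
elim: n => [|n ih]; first by rewrite mul0r cexp0 expr0.
by rewrite -natr1 mulrDl mul1r cexpD ih exprSr.
Qed.

Lemma pow_minusE kappa z : slit_plane z ->
  pow_minus kappa z = cexp (- (kappa * (0 +i* (2 * pi)))) * pow_plus kappa z.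
Proof. by move=> h; rewrite /pow_minus log_minusE // mulrBr cexpD mulrC. Qed.

(** For the lower branch the factor [exp (- 2 pi i lambda)] between the two powers is
    absorbed in each Taylor coefficient, because [exp (2 pi i j) = 1]. *)
Lemma mxpow_eigencol (Z : 'M[R[i]]_l) mu k (c : 'cV_l) :
  (forall nu, spectrum Z nu -> slit_plane nu) -> slit_plane mu ->
  (Z - mu%:M) ^+ k *m c = 0 ->
  mxpow Z *m c = \sum_(j < k) (ffactc lam j / j`!%:R *
     (if up then pow_plus (lam - j%:R) mu else pow_minus (lam - j%:R) mu)) *:
     ((Z - mu%:M) ^+ j *m c).
Proof.
move=> hZ hmu h; rewrite /mxpow; case: up.
- rewrite (holomorphic_calculus_eigencol hZ (e := 1) (lam := lam) _ h).
    by apply: eq_bigr => j _; rewrite mul1r.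
  by move=> z _; rewrite mul1r.
- rewrite (holomorphic_calculus_eigencol hZ (lam := lam) (@pow_minusE lam) h).
  apply: eq_bigr => j _; congr (_ *: _).
  rewrite pow_minusE // mulrBl opprB cexpD cexp_mulrn cexp_2pi expr1n mul1r.
  by ring.
Qed.

Lemma natr_fact_neq0 n : n`!%:R != 0 :> R[i].
Proof. by rewrite pnatr_eq0 -lt0n fact_gt0. Qed.

Lemma natS_neq0 n : n.+1%:R != 0 :> R[i].
Proof. by rewrite pnatr_eq0. Qed.

(** With [b = turn mu phi] and [N = V - mu], the Taylor expansion of the [m]-th
    derivative of [z ^ lam] at [cos phi + sin phi V = b + sin phi N] has these coefficients
    of [N ^ j]. *)
Definition power_coef mu (m j : nat) (t : R) : R[i] :=
  ffactc lam (j + m) / j`!%:R * cexp ((lam - (j + m)%:R) * turn_log mu t) *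
  (sin t)%:C ^+ j.

Lemma cderive_power_coef mu m j t : Im mu != 0 -> 0 < t < alpha ->
  cderive (power_coef mu m j) t (turn' mu t * power_coef mu m.+1 j t +
    (if j is j'.+1 then (cos t)%:C * power_coef mu m.+1 j' t else 0)).
Proof.
move=> mu0 ht.
have hp := cderive_turn_pow (lam - (j + m)%:R) mu0 ht.
have hs n : cderive (fun s => (sin s)%:C ^+ n : R[i]) t
    (if n is n'.+1 then n%:R * (sin t)%:C ^+ n' * (cos t)%:C else 0).
  elim: n => [|n ih].
    by under eq_fun do rewrite expr0; exact: cderive_cst.
  under eq_fun do rewrite exprS.
  apply: cderive_eq.
    by apply: cderiveM ih; apply: cderive_real; exact: is_derive_sin.
  case: n {ih} => [|n]; first by rewrite mulr0 addr0 !expr0; ring.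
  by rewrite -[n.+2%:R]natr1 exprS; ring.
apply: cderive_eq.
  by apply: cderiveM (hs j); apply: cderiveZ hp.
have kE : lam - (j + m)%:R - 1 = lam - (j + m.+1)%:R by rewrite addnS -natr1; ring.
have fE : ffactc lam (j + m.+1) = ffactc lam (j + m) * (lam - (j + m)%:R).
  by rewrite addnS ffactcSr.
rewrite kE /power_coef fE.
case: j {hp kE fE} => [|j]; first by rewrite mulr0 !addr0 !expr0; ring.
rewrite -[(j + m.+1)%N]addSnnS factS natrM exprS.
move: ((j.+1 + m)%:R : R[i]) (ffactc _ _) (cexp _) (cexp _)
  (natr_fact_neq0 j) (natS_neq0 j) => N F E1 E2.
by move: (j`!%:R : R[i]) (j.+1%:R : R[i]) => a b a0 b0; field; rewrite a0 b0.
Qed.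

Lemma turn_power_coef mu m j t : Im mu != 0 -> 0 <= t <= alpha ->
  turn mu t * power_coef mu m.+1 j t +
    (if j is j'.+1 then (sin t)%:C * power_coef mu m.+1 j' t else 0) =
  (lam - m%:R) * power_coef mu m j t.
Proof.
move=> mu0 ht.
have ht' : 0 <= t < 2 * pi.
  by move: halpha ht => /andP[_ a2] /andP[-> ta] /=; exact: le_lt_trans a2.
have tE : turn mu t * cexp ((lam - (j + m.+1)%:R) * turn_log mu t) =
    cexp ((lam - (j + m)%:R) * turn_log mu t).
  rewrite -{1}(cexp_turn_log mu0 ht') -cexpD addnS.
  by congr cexp; rewrite -natr1; ring.
have fE : ffactc lam (j + m.+1) = ffactc lam (j + m) * (lam - (j + m)%:R).
  by rewrite addnS ffactcSr.
rewrite /power_coef.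
transitivity (ffactc lam (j + m) * (lam - (j + m)%:R) / j`!%:R *
  (turn mu t * cexp ((lam - (j + m.+1)%:R) * turn_log mu t)) * (sin t)%:C ^+ j +
  (if j is j'.+1 then (sin t)%:C * (ffactc lam (j' + m.+1) / j'`!%:R *
    cexp ((lam - (j' + m.+1)%:R) * turn_log mu t) * (sin t)%:C ^+ j') else 0)).
  by congr (_ + _); rewrite fE; ring.
rewrite tE.
case: j {tE fE} => [|j]; first by rewrite addr0 add0n; ring.
rewrite -[(j + m.+1)%N]addSnnS factS natrM exprS natrD.
move: (ffactc _ _) (cexp _) (natr_fact_neq0 j) (natS_neq0 j) => F E.
by move: (j`!%:R : R[i]) (j.+1%:R : R[i]) => a b a0 b0; field; rewrite a0 b0.
Qed.

Lemma mxexpZ a (M : 'M[R[i]]_l) n : (a *: M) ^+ n = a ^+ n *: M ^+ n.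
Proof.
elim: n => [|n ih]; first by rewrite !expr0 scale1r.
by rewrite !mxexpS ih exprS -scalemxAl -scalemxAr scalerA.
Qed.

Lemma nilpotent_shift_sum (M : 'M[R[i]]_l) k (c : 'cV_l) (b : nat -> R[i]) :
  M ^+ k *m c = 0 ->
  \sum_(j < k) b j *: (M ^+ j.+1 *m c) =
  \sum_(j < k) (if val j is j'.+1 then b j' else 0) *: (M ^+ j *m c).
Proof.
case: k => [|k] h; first by rewrite !big_ord0.
rewrite big_ord_recr big_ord_recl /= h scaler0 addr0 scale0r add0r.
by apply: eq_bigr => j _.
Qed.

(** [y m phi] stands for the [m]-th derivative of [z ^ lam] evaluated at the matrix
    [turnmx V phi] and applied to [c]. The second condition is the chain rule in [phi], the
    third one is [z f'(z) = lam f(z)] and its derivatives. *)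
Definition power_family (c : 'cV[R[i]]_l) (y : nat -> R -> 'cV[R[i]]_l) : Prop :=
  [/\ forall m i, trigpow (fun t => y m t i 0),
      forall m t, 0 < t < alpha -> vderive (y m) t (turnmx' V t *m y m.+1 t),
      forall m t, 0 <= t <= alpha -> turnmx V t *m y m.+1 t = (lam - m%:R) *: y m t &
      forall m, y m 0 = ffactc lam m *: c].

Lemma power_family0 : power_family 0 (fun _ _ => 0).
Proof.
split.
- by move=> m i; under eq_fun do rewrite mxE; exact: trigpow_cst.
- by move=> m t _ i; rewrite mulmx0 !mxE; exact: cderive_cst.
- by move=> m t _; rewrite mulmx0 scaler0.
- by move=> m; rewrite scaler0.
Qed.

(** On a generalized eigenvector of [V] all the conditions reduce to identities between the
    coefficients of the nilpotent powers, and they are linear in [c]. *)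
Lemma power_solution (c : 'cV[R[i]]_l) : exists2 y, power_family c y &
  y 0%N alpha = mxpow (turnmx V alpha) *m c.
Proof.
move: c; apply: (@generalized_eigencol_ind _ _ V) => [|u v [y [y1 y2 y3 y4] y5] [z [z1 z2 z3 z4] z5]|mu k c h].
- by exists (fun _ _ => 0); [exact: power_family0|rewrite mulmx0].
- exists (fun m t => y m t + z m t); last by rewrite mulmxDr y5 z5.
  split.
  + by move=> m i; under eq_fun do rewrite mxE; exact: trigpow_add.
  + by move=> m t ht; rewrite mulmxDr; apply: vderiveD; [exact: y2|exact: z2].
  + by move=> m t ht; rewrite mulmxDr y3 // z3 // scalerDr.
  + by move=> m; rewrite y4 z4 scalerDr.
have [->|c0] := eqVneq c 0.
  by exists (fun _ _ => 0); [exact: power_family0|rewrite mulmx0].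
have hmu := generalized_eigencol_value h c0.
have mu0 : Im mu != 0 by exact: spectrum_nonreal.
have k0 : (0 < k)%N.
  by case: k h => // h; move: c0; rewrite -[c]mul1mx -(mxexp0 (V - mu%:M)) h eqxx.
set N := V - mu%:M in h.
exists (fun m t => \sum_(j < k) power_coef mu m j t *: (N ^+ j *m c)); first split.
- move=> m i; under eq_fun do rewrite summxE.
  apply: trigpow_sum => j; under eq_fun do rewrite mxE.
  apply: trigpow_mul; last exact: trigpow_cst.
  apply: trigpow_mul; last by apply: trigpow_exp; exact: trigpow_sin.
  by apply: trigpow_mul; [exact: trigpow_cst|exact: trigpow_pow].
- move=> m t ht.
  have -> : turnmx' V t = (turn' mu t)%:M + (cos t)%:C *: N.
    by rewrite -turnmx'_sub addrC subrK.
  rewrite mulmxDl mul_scalar_mx -scalemxAl mulmx_sumr !scaler_sumr.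
  under [X in _ + X]eq_bigr => j _.
    rewrite -scalemxAr mulmxA -mxexpS scalerA. over.
  rewrite (@nilpotent_shift_sum N k c (fun j => (cos t)%:C * power_coef mu m.+1 j t)) // -big_split /=.
  move=> i; rewrite summxE; under eq_fun do rewrite summxE.
  apply: cderive_sum => j _; rewrite scalerA -scalerDl mxE; under eq_fun do rewrite mxE.
  apply: cderive_eq.
    by apply: cderiveM; [exact: cderive_power_coef mu0 ht|exact: cderive_cst].
  by rewrite mulr0 addr0.
- move=> m t ht.
  have -> : turnmx V t = (turn mu t)%:M + (sin t)%:C *: N.
    by rewrite -turnmx_sub addrC subrK.
  rewrite mulmxDl mul_scalar_mx -scalemxAl mulmx_sumr !scaler_sumr.
  under [X in _ + X]eq_bigr => j _.
    rewrite -scalemxAr mulmxA -mxexpS scalerA. over.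
  rewrite (@nilpotent_shift_sum N k c (fun j => (sin t)%:C * power_coef mu m.+1 j t)) // -big_split /=.
  apply: eq_bigr => j _; rewrite !scalerA -scalerDl; congr (_ *: _).
  exact: turn_power_coef.
- move=> m; case: k h k0 => // k h _.
  rewrite big_ord_recl /= big1 => [|j _].
    rewrite addr0 /power_coef turn_log0 mulr0 cexp0 add0n fact0 divr1 expr0 !mulr1.
    by rewrite mxexp0 mul1mx.
  by rewrite /power_coef sin0 /= expr0n /= mulr0 scale0r.
- have Nj j : (turnmx V alpha - (turn mu alpha)%:M) ^+ j *m c = (sin alpha)%:C ^+ j *: (N ^+ j *m c).
    by rewrite turnmx_sub mxexpZ scalemxAl.
  rewrite (@mxpow_eigencol _ (turn mu alpha) k).
  + apply: eq_bigr => j _; rewrite Nj scalerA; congr (_ *: _).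
    rewrite /power_coef addn0 /turn_log /pow_plus /pow_minus.
    by move/specV: hmu; case: up => [->//|hi]; rewrite ltNge (ltW hi).
  + exact: (turnmx_slit_plane spectrum_nonreal halpha).
  + exact: turn_slit_plane.
  + by rewrite Nj h scaler0.
Qed.

End Solution.
End SmoothClass.

(** * Uniqueness for first-order systems *)

Section Uniqueness.
Context {R : realType} {l : nat}.
Variable alpha : R.
Hypothesis halpha : 0 < alpha < 2 * pi.

Definition vcont (A : set R) (y : R -> 'cV[R[i]]_l) := forall i, ccont A (fun t => y t i 0).

Lemma vcontD A y z : vcont A y -> vcont A z -> vcont A (fun t => y t + z t).
Proof. by move=> hy hz i; under eq_fun do rewrite mxE; exact: ccontD. Qed.

Lemma vcontN A y : vcont A y -> vcont A (fun t => - y t).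
Proof. by move=> hy i; under eq_fun do rewrite mxE; exact: ccontN. Qed.

Lemma vcontM A (a : R -> R[i]) y : ccont A a -> vcont A y -> vcont A (fun t => a t *: y t).
Proof. by move=> ha hy i; under eq_fun do rewrite mxE; exact: ccontM. Qed.

Lemma vcont_mulmx A (M : 'M[R[i]]_l) y : vcont A y -> vcont A (fun t => M *m y t).
Proof.
move=> hy i; under eq_fun do rewrite mxE.
by apply: ccont_sum => j _; apply: ccontM; [exact: ccont_cst|exact: hy].
Qed.

(** Applying a left generalized eigenvector [p] of order [k + 1] gives a scalar equation
    for [p w]: the coupling terms involve [p (V - mu)], of order [k], for which the product
    with [w] already vanishes. The scalar equation has the integrating factor
    [turn mu ^ - kappa]. *)
Lemma turn_equation_unique (V : 'M[R[i]]_l) (kappa : R[i]) (w w1 : R -> 'cV[R[i]]_l) :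
  (forall mu, spectrum V mu -> Im mu != 0) ->
  vcont `[0, alpha] w -> (forall t, 0 < t < alpha -> vderive w t (w1 t)) ->
  (forall t, 0 < t < alpha ->
    kappa *: (turnmx' V t *m w t) = turnmx V t *m w1 t) ->
  w 0 = 0 -> forall t, 0 <= t <= alpha -> w t = 0.
Proof.
move=> hV cw dw ew w0.
have main : forall p : 'rV[R[i]]_l, forall t, 0 <= t <= alpha -> p *m w t = 0.
  apply: (@generalized_eigenrow_ind _ _ V) => [t _|u v hu hv t ht|mu k].
  - by rewrite mul0mx.
  - by rewrite mulmxDl hu // hv // addr0.
  elim: k => [|k ih] p.
    by rewrite mxexp0 mulmx1 => -> t _; rewrite mul0mx.
  move=> h; have [-> t _|p0] := eqVneq p 0; first by rewrite mul0mx.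
  have mu0 : Im mu != 0 by apply: hV; exact: generalized_eigenrow_value h p0.
  set q := p *m (V - mu%:M).
  have hq : forall t, 0 <= t <= alpha -> q *m w t = 0.
    by apply: ih; rewrite -mulmxA -mxexpS.
  have dp (r : 'rV[R[i]]_l) t : 0 < t < alpha ->
      cderive (fun s => (r *m w s) 0 0) t ((r *m w1 t) 0 0).
    move=> ht; rewrite mxE; under eq_fun do rewrite mxE.
    by apply: cderive_sum => j _; apply: cderiveZ; exact: dw.
  have hq1 t : 0 < t < alpha -> (q *m w1 t) 0 0 = 0.
    move=> ht; apply: cderive_unique (dp q t ht) _.
    apply: (@cderive_near _ (fun _ => 0)); last exact: cderive_cst.
    have : t \in `]0, alpha[ by rewrite in_itv.
    move=> /near_in_itvoo; apply: filterS => s; rewrite in_itv /= => /andP[s0 s1].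
    by rewrite hq ?mxE // ltW //= ltW.
  have key t : 0 < t < alpha ->
      kappa * turn' mu t * (p *m w t) 0 0 = turn mu t * (p *m w1 t) 0 0.
    move=> ht; have := congr1 (fun M => (p *m M) 0 0) (ew t ht).
    have -> : turnmx' V t = (turn' mu t)%:M + (cos t)%:C *: (V - mu%:M).
      by rewrite -turnmx'_sub addrC subrK.
    have -> : turnmx V t = (turn mu t)%:M + (sin t)%:C *: (V - mu%:M).
      by rewrite -turnmx_sub addrC subrK.
    have split_row (a b : R[i]) y : p *m ((a%:M + b *: (V - mu%:M)) *m y) =
        a *: (p *m y) + b *: (q *m y).
      by rewrite mulmxDl mul_scalar_mx mulmxDr -scalemxAr -scalemxAl -scalemxAr mulmxA.
    rewrite -scalemxAr !split_row hq; last by move: ht => /andP[/ltW-> /ltW->].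
    rewrite scaler0 addr0 scalerA mxE => ->.
    by rewrite mxE [X in _ + X]mxE hq1 // mulr0 addr0 mxE.
  have ht2 t : 0 < t < alpha -> 0 < t < 2 * pi.
    by move: halpha => /andP[_ a2] /andP[-> ta] /=; exact: lt_trans a2.
  pose f t := cexp (- kappa * turn_log mu t) * (p *m w t) 0 0.
  have f0 : forall t, 0 <= t <= alpha -> f t = f 0.
    apply: cst_of_cderive0.
      move=> t ht; apply: cderive_eq.
        apply: cderiveM (dp p t ht); apply: cderive_exp; apply: cderiveZ.
        exact: cderive_turn_log mu0 (ht2 t ht).
      have t0 := slit_plane_neq0 (turn_slit_plane mu0 (ht2 t ht)).
      apply: (mulfI t0); rewrite mulr0 mulrDr mulrCA -[turn mu t * (_ * (p *m w1 t) 0 0)]mulrCA.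
      by rewrite -key //; field.
    apply: ccontM.
      by apply: ccont_exp; apply: ccontM; [exact: ccont_cst|exact: ccont_turn_log].
    apply: (@ccont_eq _ _ (fun t => \sum_j p 0 j * w t j 0)) => [t _|].
      by rewrite [RHS]mxE.
    by apply: ccont_sum => j _; apply: ccontM; [exact: ccont_cst|exact: cw].
  move=> t ht; have := f0 t ht; rewrite /f w0 mulmx0 [X in _ = _ * X]mxE mulr0 => /eqP.
  rewrite mulf_eq0 (negbTE (cexp_neq0 _)) /= => /eqP e.
  by apply/matrixP => i j; rewrite !ord1 e mxE.
move=> t ht; apply/matrixP => i j; rewrite ord1 [RHS]mxE.
have := congr1 (fun M : 'M[R[i]]_1 => M 0 0) (main (delta_mx 0 i) t ht).
by rewrite -rowE !mxE.
Qed.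

End Uniqueness.

(** * Cartesian derivatives in polar coordinates *)

Section PolarDerivatives.
Variables (F : comNzRingType) (l : nat) (c s : F).
Implicit Types (kappa : F) (x y z : 'cV[F]_l) (V W : 'M[F]_l).

(** With [c = cos phi] and [s = sin phi], [r ^ (kappa - 1)] times these vectors are the
    Cartesian derivatives of [r ^ kappa x(phi)], where [x'] stands for the derivative of
    [x]. *)
Definition polar_d1 kappa x x' := (kappa * c) *: x - s *: x'.
Definition polar_d2 kappa x x' := (kappa * s) *: x + c *: x'.

Lemma polar_d1_lin kappa V W x x' y y' z z' :
  polar_d1 kappa (V *m x - y + W *m z) (V *m x' - y' + W *m z') =
  V *m polar_d1 kappa x x' - polar_d1 kappa y y' + W *m polar_d1 kappa z z'.
Proof.
rewrite /polar_d1 !mulmxBr -!scalemxAr.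
move: (V *m x) (V *m x') (W *m z) (W *m z') => a a' b b'.
by apply/matrixP => i j; rewrite !mxE; ring.
Qed.

Lemma polar_d2_lin kappa V W x x' y y' z z' :
  polar_d2 kappa (V *m x - y + W *m z) (V *m x' - y' + W *m z') =
  V *m polar_d2 kappa x x' - polar_d2 kappa y y' + W *m polar_d2 kappa z z'.
Proof.
rewrite /polar_d2 !mulmxDr -!scalemxAr.
move: (V *m x) (V *m x') (W *m z) (W *m z') => a a' b b'.
by apply/matrixP => i j; rewrite !mxE; ring.
Qed.

Lemma polar_d1B kappa x x' y y' :
  polar_d1 kappa (x - y) (x' - y') = polar_d1 kappa x x' - polar_d1 kappa y y'.
Proof. by rewrite /polar_d1; apply/matrixP => i j; rewrite !mxE; ring. Qed.

Lemma polar_d2B kappa x x' y y' :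
  polar_d2 kappa (x - y) (x' - y') = polar_d2 kappa x x' - polar_d2 kappa y y'.
Proof. by rewrite /polar_d2; apply/matrixP => i j; rewrite !mxE; ring. Qed.

Lemma polar_d1_mulmx kappa V x x' :
  polar_d1 kappa (V *m x) (V *m x') = V *m polar_d1 kappa x x'.
Proof. by rewrite /polar_d1 mulmxBr -!scalemxAr. Qed.

Lemma polar_d2_mulmx kappa V x x' :
  polar_d2 kappa (V *m x) (V *m x') = V *m polar_d2 kappa x x'.
Proof. by rewrite /polar_d2 mulmxDr -!scalemxAr. Qed.

(** The mixed second derivatives agree. The last argument on either side is the derivative
    in [phi] of the argument before it. *)
Lemma polar_derivatives_commute kappa x x' x'' :
  polar_d2 (kappa - 1) (polar_d1 kappa x x')
    ((kappa - 1) * c *: x' - kappa * s *: x - s *: x'') =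
  polar_d1 (kappa - 1) (polar_d2 kappa x x')
    (kappa * c *: x + (kappa - 1) * s *: x' + c *: x'').
Proof. by apply/matrixP => i j; rewrite !mxE; ring. Qed.

(** The first-order operator [V d1 - d2] becomes, up to sign, the ordinary differential
    operator [turnmx V x' - kappa turnmx' V x]. *)
Lemma polar_first_order kappa V s' x x' : s' = - s ->
  kappa *: ((s'%:M + c *: V) *m x) - (c%:M + s *: V) *m x' =
  V *m polar_d1 kappa x x' - polar_d2 kappa x x'.
Proof.
move=> ->; rewrite /polar_d1 /polar_d2 !mulmxDl !mul_scalar_mx -!scalemxAl mulmxBr -!scalemxAr.
move: (V *m x) (V *m x') => a a'.
by apply/matrixP => i j; rewrite !mxE; ring.
Qed.

(** The derivative in [x1] of [f (x1 + x2 V)] is [f' (x1 + x2 V)]; the next lemma is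
    [V f' (x1 + x2 V)] for the derivative in [x2]. *)
Lemma polar_d1_turn kappa V s' x y : s' = - s -> c * c + s * s = 1 ->
  (c%:M + s *: V) *m y = kappa *: x -> polar_d1 kappa x ((s'%:M + c *: V) *m y) = y.
Proof.
move=> -> cs; rewrite /polar_d1 mulrC -scalerA => <-.
rewrite !mulmxDl !mul_scalar_mx -!scalemxAl; move: (V *m y) => a.
apply/matrixP => i j; rewrite !mxE.
by transitivity ((c * c + s * s) * y i j); [ring|rewrite cs mul1r].
Qed.

Lemma polar_d2_turn kappa V s' x y : s' = - s -> c * c + s * s = 1 ->
  (c%:M + s *: V) *m y = kappa *: x -> polar_d2 kappa x ((s'%:M + c *: V) *m y) = V *m y.
Proof.
move=> -> cs; rewrite /polar_d2 mulrC -scalerA => <-.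
rewrite !mulmxDl !mul_scalar_mx -!scalemxAl; move: (V *m y) => a.
apply/matrixP => i j; rewrite !mxE.
by transitivity ((c * c + s * s) * a i j); [ring|rewrite cs mul1r].
Qed.

End PolarDerivatives.

Section PolarCoordinates.
Context {R : realType} {l : nat}.
Variable alpha : R.
Hypothesis halpha : 0 < alpha < 2 * pi.
Implicit Types (v : R -> 'cV[R[i]]_l) (u : R -> R -> 'cV[R[i]]_l) (lam : R[i]).

Lemma cV_deriveE (y : R -> 'cV[R[i]]_l) (t : R) d : vderive y t d -> cV_derive y t = d.
Proof.
move=> h; apply/matrixP => i j; rewrite ord1 mxE !derive1E.
have [h1 h2] := h i.
by rewrite (@derive_val _ _ _ _ _ _ _ h1) (@derive_val _ _ _ _ _ _ _ h2) -eqC_ReIm.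
Qed.

(** The interior of the angle, as a condition that is open along curves. *)
Definition sector (z : R[i]) := slit_plane z /\ arg_plus z < alpha.

Lemma arg_plus_gt0 (z : R[i]) : slit_plane z -> 0 < arg_plus z.
Proof.
move=> h; have := congr1 (@complex.Im R) (log_plusE h) => /= ->.
have := atan_gtNpi2 (Im (- z) / (modulus (- z) + Re (- z))).
by move: (atan _) => y hy; lra.
Qed.

Lemma near_sector (g : R -> R[i]) (t : R) d : cderive g t d -> sector (g t) ->
  \forall s \near t, sector (g s).
Proof.
move=> hg [h1 h2]; have n1 := near_slit_plane hg h1.
have n2 : \forall s \near t, arg_plus (g s) < alpha.
  have := is_derive_continuous (cderive_log_plus h1 hg).2.
  by move=> /cvgr_lt; apply.
by near=> s; split; near: s.
Unshelve. all: by end_near. Qed.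

(** Both polar coordinates come from [log_plus z = ln r + i phi], whose derivative along a
    curve is [z' / z]. *)
Lemma vderive_polar lam v v1 (g : R -> R[i]) (t : R) d :
  (forall phi : R, 0 < phi < alpha -> vderive v phi (v1 phi)) ->
  sector (g t) -> cderive g t d ->
  vderive (fun s => power_ansatz lam v (modulus (g s)) (arg_plus (g s))) t
    (real_pow (modulus (g t)) lam *: ((lam * (Re (d / g t))%:C) *: v (arg_plus (g t)) +
        (Im (d / g t))%:C *: v1 (arg_plus (g t)))).
Proof.
move=> hv [h1 h2] hg; have [d1 d2] := cderive_log_plus h1 hg.
have p0 := arg_plus_gt0 h1.
have dv : vderive (fun s => v (arg_plus (g s))) t
    ((Im (d / g t))%:C *: v1 (arg_plus (g t))).
  move=> i; rewrite mxE.
  have hp : 0 < arg_plus (g t) < alpha by rewrite p0.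
  have [e1 e2] := hv _ hp i; split => /=.
  - apply: (is_derive_eq (is_derive_comp1 d2 e1)).
    by rewrite ReM /= mul0r subr0 mulrC.
  - apply: (is_derive_eq (is_derive_comp1 d2 e2)).
    by move: (Im (d / g t)) => q; rewrite ImM /= mul0r addr0 mulrC.
apply: vderive_eq.
  apply: vderiveM dv; apply: cderive_exp; apply: cderiveZ.
  by apply: cderive_real; exact: d1.
by rewrite /real_pow scalerDr !scalerA.
Qed.

Lemma inv_polar (z : R[i]) : slit_plane z ->
  z^-1 = (expR (- ln (modulus z)))%:C * (cos (arg_plus z) +i* (- sin (arg_plus z))).
Proof.
move=> h; rewrite -{1}(cexp_log_plus h) -cexpN.
apply: eq_ReIm.
- by rewrite Re_cexp ReM /= cosN mul0r subr0.
- by rewrite Im_cexp ImM /= sinN mul0r addr0.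
Qed.

Lemma real_powB1 (r : R) lam : real_pow r (lam - 1) = real_pow r lam * (expR (- ln r))%:C.
Proof.
rewrite /real_pow mulrBl mul1r cexpD; congr (_ * _).
by apply: eq_ReIm; rewrite ?Re_cexp ?Im_cexp /= oppr0 ?cos0 ?sin0 ?mulr1 ?mulr0.
Qed.

Section Partials.
Variables (lam : R[i]) (v v1 : R -> 'cV[R[i]]_l) (u : R -> R -> 'cV[R[i]]_l).
Hypothesis dv : forall phi : R, 0 < phi < alpha -> vderive v phi (v1 phi).
(** Agreement on the sector suffices, since derivatives are local; the lemmas below can
    thus be iterated. *)
Hypothesis uE : forall x1 x2, sector (x1 +i* x2) ->
  u x1 x2 = cartesian (power_ansatz lam v) x1 x2.

Lemma partial1_polar (a : R -> 'cV[R[i]]_l) (x1 x2 : R) : sector (x1 +i* x2) ->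
  (forall phi : R, 0 < phi < alpha ->
     a phi = polar_d1 (cos phi)%:C (sin phi)%:C lam (v phi) (v1 phi)) ->
  partial1 u x1 x2 = cartesian (power_ansatz (lam - 1) a) x1 x2.
Proof.
move=> hx ha; apply: cV_deriveE.
have hg : cderive (fun t => t +i* x2) x1 1.
  by split; [exact: is_derive_id|exact: is_derive_cst].
apply: (@vderive_near _ _ (fun t => cartesian (power_ansatz lam v) t x2)).
  by apply: filterS (near_sector hg hx) => s hs; rewrite uE.
apply: vderive_eq; first exact: vderive_polar dv hx hg.
have [h1 h2] := hx; have hp : 0 < arg_plus (x1 +i* x2) < alpha by rewrite arg_plus_gt0.
rewrite /cartesian /power_ansatz (ha _ hp) real_powB1 -[RHS]scalerA.
congr (_ *: _).
rewrite /polar_d1 mul1r inv_polar // ReM ImM /= !mul0r subr0 addr0.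
by apply/matrixP => i j; rewrite !mxE !rmorphM rmorphN; ring.
Qed.

Lemma partial2_polar (a : R -> 'cV[R[i]]_l) (x1 x2 : R) : sector (x1 +i* x2) ->
  (forall phi : R, 0 < phi < alpha ->
     a phi = polar_d2 (cos phi)%:C (sin phi)%:C lam (v phi) (v1 phi)) ->
  partial2 u x1 x2 = cartesian (power_ansatz (lam - 1) a) x1 x2.
Proof.
move=> hx ha; apply: cV_deriveE.
have hg : cderive (fun t => x1 +i* t) x2 'i.
  by split; [exact: is_derive_cst|exact: is_derive_id].
apply: (@vderive_near _ _ (fun t => cartesian (power_ansatz lam v) x1 t)).
  by apply: filterS (near_sector hg hx) => s hs; rewrite uE.
apply: vderive_eq; first exact: vderive_polar dv hx hg.
have [h1 h2] := hx; have hp : 0 < arg_plus (x1 +i* x2) < alpha by rewrite arg_plus_gt0.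
rewrite /cartesian /power_ansatz (ha _ hp) real_powB1 -[RHS]scalerA.
congr (_ *: _).
have eR (E c s : R) : Re ('i * (E%:C * (c +i* (- s)))) = E * s.
  by rewrite ReM ImM /=; ring.
have eI (E c s : R) : Im ('i * (E%:C * (c +i* (- s)))) = E * c.
  by rewrite ImM ReM /=; ring.
rewrite /polar_d2 inv_polar // eR eI.
by apply/matrixP => i j; rewrite !mxE !rmorphM; ring.
Qed.

End Partials.

Lemma elliptic_operatorE (A11 A12 : 'M[R]_l) u (x1 x2 : R) (X Y Z : 'cV[R[i]]_l) :
  partial1 (partial1 u) x1 x2 = X -> partial1 (partial2 u) x1 x2 = Y ->
  partial2 (partial2 u) x1 x2 = Z ->
  elliptic_operator A11 A12 u x1 x2 =
  complex_mx A11 *m X + 2 *: (complex_mx A12 *m Y) + Z.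
Proof. by move=> <- <- <-. Qed.

Lemma second_orderZ (A B : 'M[R[i]]_l) (a : R[i]) (X Y Z : 'cV[R[i]]_l) :
  A *m (a *: X) + 2 *: (B *m (a *: Y)) + a *: Z = a *: (A *m X + 2 *: (B *m Y) + Z).
Proof. by rewrite -!scalemxAr scalerA [2 * _]mulrC -scalerA -!scalerDr. Qed.

Lemma elliptic_operator_polar (A11 A12 : 'M[R]_l) lam
    (v v1 a1 a2 b1 b2 : R -> 'cV[R[i]]_l) (r phi : R) :
  (forall t : R, 0 < t < alpha -> vderive v t (v1 t)) ->
  (forall phi : R, 0 < phi < alpha ->
     a1 phi = polar_d1 (cos phi)%:C (sin phi)%:C lam (v phi) (v1 phi)) ->
  (forall phi : R, 0 < phi < alpha ->
     a2 phi = polar_d2 (cos phi)%:C (sin phi)%:C lam (v phi) (v1 phi)) ->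
  (forall phi : R, 0 < phi < alpha -> vderive a1 phi (b1 phi)) ->
  (forall phi : R, 0 < phi < alpha -> vderive a2 phi (b2 phi)) ->
  0 < r -> 0 < phi < alpha ->
  elliptic_operator A11 A12 (cartesian (power_ansatz lam v)) (r * cos phi) (r * sin phi) =
  real_pow r (lam - 1 - 1) *:
   (complex_mx A11 *m polar_d1 (cos phi)%:C (sin phi)%:C (lam - 1) (a1 phi) (b1 phi)
   + 2 *: (complex_mx A12 *m polar_d1 (cos phi)%:C (sin phi)%:C (lam - 1) (a2 phi) (b2 phi))
   + polar_d2 (cos phi)%:C (sin phi)%:C (lam - 1) (a2 phi) (b2 phi)).
Proof.
move=> dv ha1 ha2 db1 db2 r0 hphi.
have hphi' : 0 <= phi < 2 * pi.
  by move: halpha hphi => /andP[_ a20] /andP[/ltW-> pa] /=; exact: lt_trans a20.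
have argE := arg_plus_polar r0 hphi'.
have modE : modulus ((r * cos phi) +i* (r * sin phi)) = r.
  by rewrite modulusE /sqmod /= !exprMn -mulrDr cos2Dsin2 mulr1 sqrtr_sqr gtr0_norm.
have hx : sector ((r * cos phi) +i* (r * sin phi)).
  split; last by rewrite argE; case/andP: hphi.
  apply/slit_planeP; rewrite modE /=.
  rewrite -[ltRHS]mulr1 ltr_pM2l //.
  have hphi2 : 0 < phi < 2 * pi by rewrite (andP hphi').2; case/andP: hphi => ->.
  have /slit_planeP := @turn_slit_plane R 'i phi (oner_neq0 _) hphi2.
  have -> : turn 'i phi = cos phi +i* sin phi.
    by apply: eq_ReIm; rewrite /turn ?ReD ?ImD ?ReM ?ImM /=; ring.
  by rewrite /= modulusE /sqmod /= cos2Dsin2 sqrtr1.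
have p1 x1 x2 : sector (x1 +i* x2) ->
    partial1 (cartesian (power_ansatz lam v)) x1 x2 = cartesian (power_ansatz (lam - 1) a1) x1 x2.
  by move=> hz; exact: (partial1_polar dv (fun _ _ _ => erefl) hz ha1).
have p2 x1 x2 : sector (x1 +i* x2) ->
    partial2 (cartesian (power_ansatz lam v)) x1 x2 = cartesian (power_ansatz (lam - 1) a2) x1 x2.
  by move=> hz; exact: (partial2_polar dv (fun _ _ _ => erefl) hz ha2).
have cartE (k : R[i]) (a : R -> 'cV[R[i]]_l) : cartesian (power_ansatz k a) (r * cos phi) (r * sin phi) = real_pow r k *: a phi.
  by rewrite /cartesian /power_ansatz argE modE.
pose c11 (t : R) : 'cV[R[i]]_l :=
  polar_d1 (cos t)%:C (sin t)%:C (lam - 1) (a1 t) (b1 t).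
pose c12 (t : R) : 'cV[R[i]]_l :=
  polar_d1 (cos t)%:C (sin t)%:C (lam - 1) (a2 t) (b2 t).
pose c22 (t : R) : 'cV[R[i]]_l :=
  polar_d2 (cos t)%:C (sin t)%:C (lam - 1) (a2 t) (b2 t).
have e11 := partial1_polar (a := c11) db1 p1 hx (fun _ _ => erefl).
have e12 := partial1_polar (a := c12) db2 p2 hx (fun _ _ => erefl).
have e22 := partial2_polar (a := c22) db2 p2 hx (fun _ _ => erefl).
have e := elliptic_operatorE A11 A12 (etrans e11 (cartE _ _)) (etrans e12 (cartE _ _))
  (etrans e22 (cartE _ _)).
by rewrite second_orderZ in e.
Qed.

End PolarCoordinates.

(** * The square root of a positive definite matrix *)

Section SquareRoot.
Context {R : realType}.

Lemma conj_real_complex (x : R) : Num.conj (x%:C) = x%:C.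
Proof. exact: conjc_real. Qed.

Lemma interpolation (F : fieldType) (f : F -> F) (s : seq F) :
  exists q : {poly F}, forall x, x \in s -> q.[x] = f x.
Proof.
elim: s => [|y s [q hq]]; first by exists 0.
have [ys|ys] := boolP (y \in s).
  by exists q => x; rewrite in_cons => /predU1P[->|]; exact: hq.
pose p := \prod_(z <- s) ('X - z%:P).
have py : p.[y] != 0 by rewrite -[_ == 0]/(root p y) root_prod_XsubC.
exists (q + ((f y - q.[y]) / p.[y]) *: p) => x.
rewrite hornerD hornerZ in_cons => /predU1P[->|xs]; first by rewrite divfK // addrC subrK.
have /eqP -> : root p x by rewrite root_prod_XsubC.
by rewrite mulr0 addr0 hq.
Qed.

Lemma trmx_horner (F : comNzRingType) n (A : 'M[F]_n.+1) (q : {poly F}) :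
  A^T = A -> (horner_mx A q)^T = horner_mx A q.
Proof.
move=> hA; elim/poly_ind: q => [|q c ih]; first by rewrite rmorph0 trmx0.
rewrite rmorphD rmorphM /= horner_mx_X horner_mx_C linearD /= tr_scalar_mx.
congr (_ + _); rewrite -[_ * _]/(_ *m _) trmx_mul hA ih.
by apply/esym; apply: (@comm_horner_mx _ _ A A q).
Qed.

Lemma complex_mx_inj n : injective (@complex_mx R n).
Proof. by move=> A B /matrixP h; apply/matrixP => i j; have := h i j; rewrite !mxE => /complexI. Qed.

Lemma complex_mxM n (A B : 'M[R]_n) : complex_mx (A *m B) = complex_mx A *m complex_mx B.
Proof. exact: map_mxM. Qed.

Lemma mulmx_conj_diag (F : fieldType) n (P : 'M[F]_n) (a b : 'rV[F]_n) : P \in unitmx ->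
  invmx P *m diag_mx a *m P *m (invmx P *m diag_mx b *m P) =
  invmx P *m diag_mx (\row_i (a 0 i * b 0 i)) *m P.
Proof.
move=> uP; rewrite !mulmxA (mulmxK uP) -[_ *m diag_mx a *m _]mulmxA mulmx_diag.
by [].
Qed.

Lemma posdef_unitmx n (A : 'M[R]_n) : positive_definite A -> A \in unitmx.
Proof.
move=> [hA pA]; rewrite -row_free_unit -kermx_eq0; apply/eqP/row_matrixP => i.
rewrite row0; apply/eqP; apply: contraT => v0.
have h : row i (kermx A) *m A = 0 by rewrite -row_mul mulmx_ker row0.
have := pA (row i (kermx A))^T; rewrite trmxK h mul0mx mxE ltxx.
by rewrite -(inj_eq trmx_inj) trmxK trmx0 => /(_ v0).
Qed.

Lemma sqnorm_gt0 n (x : 'cV[R]_n) : x != 0 -> 0 < (x^T *m x) 0 0.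
Proof.
move=> x0; rewrite mxE lt_neqAle; apply/andP; split; last first.
  by apply: sumr_ge0 => i _; rewrite mxE -expr2 sqr_ge0.
apply: contra x0; rewrite eq_sym psumr_eq0 => [/allP h|i _]; last first.
  by rewrite mxE -expr2 sqr_ge0.
apply/eqP/matrixP => i j; rewrite ord1 mxE; apply/eqP.
by have := h i (mem_index_enum _); rewrite mxE -expr2 sqrf_eq0.
Qed.

Lemma posdef_eigenvalue_gt0 n (A : 'M[R]_n) d :
  positive_definite A -> eigenvalue A d -> 0 < d.
Proof.
move=> [hA pA] /eigenvalueP[v hv v0].
have v0' : v^T != 0 by rewrite -(inj_eq trmx_inj) trmxK trmx0.
have := pA v^T v0'; rewrite trmxK hv -scalemxAl mxE.
have := sqnorm_gt0 v0'; rewrite trmxK => h.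
by rewrite pmulr_lgt0.
Qed.

(** The root is a real polynomial in [A], interpolating the fourth root on the
    eigenvalues of [A]: as such it is real and symmetric, and its powers are computed on the
    unitary diagonalization over the complex numbers. *)
Lemma posdef_fourth_root n (A : 'M[R]_n) : positive_definite A ->
  exists2 T : 'M[R]_n, T^T = T & T *m T *m (T *m T) = A.
Proof.
case: n A => [|n] A hA; first by exists A; rewrite ?[LHS]thinmx0 ?[RHS]thinmx0.
pose AC := complex_mx A.
have hAC : AC^t* = AC.
  rewrite /AC /complex_mx map_trmx hA.1 -map_mx_comp; apply/matrixP => i j.
  by rewrite !mxE /= conj_real_complex.
have nAC : AC \is normalmx by apply/normalmxP; rewrite hAC.
have rAC : AC \is hermsymmx by apply/is_hermitianmxP; rewrite expr0 scale1r hAC.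
have [P [d [uP dreal AE]]] : exists (P : 'M[R[i]]_n.+1) (d : 'rV[R[i]]_n.+1), [/\ P \in unitmx,
    forall i, d 0 i = (Re (d 0 i))%:C &
    map_mx (real_complex R) A = invmx P *m diag_mx d *m P].
  exists (spectralmx AC), (spectral_diag AC); split.
  - exact: spectral_unit.
  - have := hermitian_spectral_diag_real rAC => /mxOverP h i.
    by rewrite RRe_real.
  - by have /orthomx_spectralP e := nAC; exact: e.
have dpos i : 0 < Re (d 0 i).
  apply: (posdef_eigenvalue_gt0 hA).
  rewrite eigenvalue_root_char -(fmorph_root (real_complex R)) map_char_poly /= -dreal.
  rewrite -eigenvalue_root_char.
  apply/eigenvalueP; exists (row i P); last first.
    apply/negP => /eqP h; have := congr1 (fun M => M *m invmx P) h.
    rewrite -row_mul mulmxV // mul0mx => /rowP/(_ i); rewrite !mxE eqxx => /eqP.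
    by rewrite oner_eq0.
  rewrite AE -row_mul !mulmxA mulmxV // mul1mx.
  by apply/rowP => j; rewrite !mxE (bigD1 i) //= big1 => [|k ki];
    rewrite !mxE ?eqxx ?mulr1n ?addr0 // eq_sym (negbTE ki) mulr0n mul0r.
have [q hq] := interpolation (fun x => Num.sqrt (Num.sqrt x)) [seq Re (d 0 i) | i <- enum 'I_n.+1].
have TC : complex_mx (horner_mx A q) = invmx P *m diag_mx (\row_i (Num.sqrt (Num.sqrt (Re (d 0 i))))%:C) *m P.
  have uP' : P \is a GRing.unit by exact: uP.
  have e : complex_mx (horner_mx A q) = horner_mx (map_mx (real_complex R) A)
      (map_poly (real_complex R) q) by exact: map_horner_mx.
  rewrite [LHS]e AE.
  rewrite [LHS](horner_mx_uconjC _ _ uP').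
  rewrite horner_mx_diag.
  apply: (congr1 (fun x : 'rV[R[i]]_n.+1 => invmx P *m diag_mx x *m P)); apply/rowP => i.
  rewrite !mxE dreal horner_map hq //.
  by apply: map_f; rewrite mem_enum.
exists (horner_mx A q); first by rewrite trmx_horner // hA.1.
have sq (a b : 'rV[R[i]]_n.+1) := mulmx_conj_diag a b uP.
apply: complex_mx_inj; rewrite !complex_mxM TC !sq.
rewrite [RHS]AE; apply: (congr1 (fun x : 'rV[R[i]]_n.+1 => invmx P *m diag_mx x *m P)); apply/rowP => i.
rewrite !mxE -!rmorphM /= -!expr2 sqr_sqrtr ?sqrtr_ge0 // sqr_sqrtr ?ltW //.
Qed.

(** With [T ^ 4 = A] and [T] symmetric and invertible, [T ^ 2] is positive definite because
    its quadratic form is the square norm of [T x]. *)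
Lemma posdef_sqrtP n (A : 'M[R]_n) : positive_definite A ->
  positive_definite (posdef_sqrt A) /\ posdef_sqrt A *m posdef_sqrt A = A.
Proof.
move=> hA; have [T hT TA] := posdef_fourth_root hA.
have uT : T \in unitmx.
  have := posdef_unitmx hA; rewrite -TA -!mulmxA unitmx_mul.
  by case/andP.
apply: (xgetPex 0 (P := [set Q | positive_definite Q /\ Q *m Q = A])).
exists (T *m T); split => //; split; first by rewrite trmx_mul hT.
move=> x x0.
have -> : x^T *m (T *m T) *m x = (T *m x)^T *m (T *m x) by rewrite trmx_mul hT !mulmxA.
apply: sqnorm_gt0.
by apply: contra x0 => /eqP e; rewrite -(mulKmx uT x) e mulmx0.
Qed.

End SquareRoot.

(** * Similar matrices and complex conjugation *)

Lemma mxexp_intertwine (F : closedFieldType) n (Z B Q : 'M[F]_n) a j (c : 'cV_n) :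
  Z *m Q = Q *m B -> (Z - a%:M) ^+ j *m (Q *m c) = Q *m ((B - a%:M) ^+ j *m c).
Proof.
move=> ZQ; elim: j => [|j ih]; first by rewrite !mxexp0 !mul1mx.
by rewrite !mxexpS -mulmxA ih !mulmxA mulmxBl mulmxBr ZQ scalar_mxC.
Qed.

Lemma eigenvalue_trmx (F : fieldType) n (A : 'M[F]_n) a : eigenvalue A^T a = eigenvalue A a.
Proof.
by rewrite /eigenvalue /eigenspace !kermx_eq0 !row_free_unit -unitmx_tr linearB /= trmxK tr_scalar_mx.
Qed.

Section Similarity.
Context {R : realType} {l : nat}.
Implicit Types (Z B Q : 'M[R[i]]_l).

Lemma eigenvalue_intertwine Z B Q nu : Q \in unitmx -> Z *m Q = Q *m B ->
  eigenvalue Z nu -> eigenvalue B nu.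
Proof.
move=> uQ ZQ /eigenvalueP[v hv v0]; apply/eigenvalueP; exists (v *m Q).
  by rewrite -mulmxA -ZQ mulmxA hv scalemxAl.
by apply: contra v0 => /eqP e; rewrite -(mulmxK uQ v) e mul0mx.
Qed.

(** Both sides are given by the same Taylor polynomial on generalized eigenvectors of [B]. *)
Lemma mxpow_intertwine up lam Z B Q : Q \in unitmx -> Z *m Q = Q *m B ->
  (forall nu, spectrum B nu -> slit_plane nu) ->
  mxpow up lam Z *m Q = Q *m mxpow up lam B.
Proof.
move=> uQ ZQ hB.
have hZ nu : spectrum Z nu -> slit_plane nu.
  by move=> h; apply: hB; exact: eigenvalue_intertwine uQ ZQ h.
have gZ mu k (c : 'cV_l) hmu h := @mxpow_eigencol _ _ up lam Z mu k c hZ hmu h.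
have gB mu k (c : 'cV_l) hmu h := @mxpow_eigencol _ _ up lam B mu k c hB hmu h.
move: (mxpow up lam Z) (mxpow up lam B) gZ gB => X Y gX gY.
have main (c : 'cV[R[i]]_l) : X *m (Q *m c) = Q *m (Y *m c).
  move: c; apply: (@generalized_eigencol_ind _ _ B) => [|u v hu hv|mu k c h].
  - by rewrite !mulmx0.
  - by rewrite !mulmxDr hu hv.
  have [->|c0] := eqVneq c 0; first by rewrite !mulmx0.
  have hmu : slit_plane mu by apply: hB; exact: generalized_eigencol_value h c0.
  have shift j : (Z - mu%:M) ^+ j *m (Q *m c) = Q *m ((B - mu%:M) ^+ j *m c).
    exact: mxexp_intertwine.
  have hq : (Z - mu%:M) ^+ k *m (Q *m c) = 0 by rewrite shift h mulmx0.
  rewrite (gX _ _ _ hmu hq) (gY _ _ _ hmu h) mulmx_sumr.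
  by apply: eq_bigr => j _; rewrite shift scalemxAr.
apply/matrixP => i j.
have := congr1 (fun M : 'cV[R[i]]_l => M i 0) (main (delta_mx j 0)).
by rewrite !mulmxA -!colE !mxE.
Qed.

Lemma singular_colP Z : spectrum Z 0 <-> exists2 c : 'cV[R[i]]_l, c != 0 & Z *m c = 0.
Proof.
rewrite /spectrum /= /eigenvalue /eigenspace raddf0 subr0.
rewrite kermx_eq0 row_free_unit -unitmx_tr -row_free_unit -kermx_eq0.
split=> [|[c c0 hc]].
  move=> /rowV0Pn[v /sub_kermxP hv v0]; exists v^T.
    by rewrite -(inj_eq trmx_inj) trmxK trmx0.
  by apply: trmx_inj; rewrite trmx_mul trmxK trmx0.
apply/rowV0Pn; exists c^T; last by rewrite -(inj_eq trmx_inj) trmxK trmx0.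
by apply/sub_kermxP; rewrite -trmx_mul hc trmx0.
Qed.

Lemma conj_mxM Z B : conj_mx (Z *m B) = conj_mx Z *m conj_mx B.
Proof. exact: map_mxM. Qed.

Lemma conj_mxD Z B : conj_mx (Z + B) = conj_mx Z + conj_mx B.
Proof. exact: map_mxD. Qed.

Lemma conj_mxZ a Z : conj_mx (a *: Z) = Num.conj a *: conj_mx Z.
Proof. exact: map_mxZ. Qed.

Lemma conj_scalar_mx a : conj_mx (a%:M : 'M[R[i]]_l) = (Num.conj a)%:M.
Proof. exact: map_scalar_mx. Qed.

Lemma conj_complex_mx (A : 'M[R]_l) : conj_mx (complex_mx A) = complex_mx A.
Proof. by apply/matrixP => i j; rewrite !mxE conj_real_complex. Qed.

Lemma conj_mx_eigenvalue Z mu : eigenvalue (conj_mx Z) mu -> eigenvalue Z (Num.conj mu).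
Proof.
move=> /eigenvalueP[v hv v0]; apply/eigenvalueP; exists (map_mx Num.conj v); last first.
  by rewrite map_mx_eq0.
have := congr1 (map_mx Num.conj) hv; rewrite map_mxZ map_mxM => <-.
by congr (_ *m _); apply/matrixP => i j; rewrite !mxE; exact/esym/conjcK.
Qed.

Lemma conj_turnmx Z phi : conj_mx (turnmx Z phi) = turnmx (conj_mx Z) phi.
Proof. by rewrite /turnmx conj_mxD conj_mxZ conj_scalar_mx !conj_real_complex. Qed.

Lemma Im_conj (z : R[i]) : Im (Num.conj z) = - Im z.
Proof. by case: z. Qed.

(** The root [Q] of [D] satisfies [Q V = (Q S Q + i D) Q], hence [Z_alpha] is similar to
    [cos alpha + sin alpha V]. As [Q] is real, the conjugates are similar by the same
    matrix. *)
Lemma Zmx_intertwine (S D : 'M[R]_l) phi : positive_definite D ->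
  Zmx S D phi *m complex_mx (posdef_sqrt D) =
  complex_mx (posdef_sqrt D) *m
    turnmx ((complex_mx S + 'i%C%:M) *m complex_mx D) phi.
Proof.
move=> /posdef_sqrtP[_]; set Q := posdef_sqrt D => QD.
rewrite /Zmx /turnmx -/Q mulmxDl mulmxDl mulmxDr scalar_mxC -addrA; congr (_ + _).
rewrite -!scalemxAl -scalemxAr.
have -> : 0 +i* sin phi = (sin phi)%:C * 'i%C :> R[i].
  by apply: eq_ReIm; rewrite ?ReM ?ImM /=; ring.
rewrite -scalerA -scalerDr; congr (_ *: _).
rewrite mulmxDl mul_scalar_mx mulmxDr -scalemxAr -!complex_mxM -QD.
by rewrite !mulmxA.
Qed.

End Similarity.

(** * All solutions of the model problem *)

(** [A], [B], [W], [V] play the role of [A11], [A12], the adjoint of [V] and [V]: this is the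
    factorization of the operator in terms of the second derivatives [x], [y], [z]. *)
Lemma second_order_factor (F : comNzRingType) l (V W A B : 'M[F]_l) (x y z : 'cV[F]_l) :
  A = W *m V -> 2 *: B = - (W + V) ->
  A *m x + 2 *: (B *m y) + z = W *m (V *m x - y) - (V *m y - z).
Proof.
move=> -> hB; rewrite scalemxAl hB mulNmx mulmxDl mulmxBr mulmxA.
move: (W *m V *m x) (W *m y) (V *m y) => a b c.
by apply/matrixP => i j; rewrite !mxE; ring.
Qed.

(** The two sides differ by the quadratic matrix polynomial [A + 2 B X + X ^ 2] at
    [X = U], applied to [y]. *)
Lemma second_order_annihilates (F : comNzRingType) l (V W U A B : 'M[F]_l) (y : 'cV[F]_l) :
  A = W *m V -> 2 *: B = - (W + V) -> A + (2 *: B) *m U + U *m U = 0 ->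
  W *m ((V - U) *m y) = (V - U) *m (U *m y).
Proof.
move=> -> -> hU; apply/eqP; rewrite -subr_eq0; apply/eqP.
rewrite !mulmxA -mulmxBl -[RHS](mul0mx _ y) -[in RHS]hU; congr (_ *m y).
rewrite mulmxBr mulmxBl mulNmx mulmxDl.
move: (W *m V) (W *m U) (V *m U) (U *m U) => a b c d.
by apply/matrixP => i j; rewrite !mxE; ring.
Qed.

Lemma second_order_roots (F : comNzRingType) l (V W U A B : 'M[F]_l) (y z : 'cV[F]_l) :
  A = W *m V -> 2 *: B = - (W + V) -> A + (2 *: B) *m U + U *m U = 0 ->
  A *m (y - z) + 2 *: (B *m (V *m y - U *m z)) + (V *m (V *m y) - U *m (U *m z)) = 0.
Proof.
move=> hA hB hU; rewrite (second_order_factor _ _ _ hA hB).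
have -> : V *m (y - z) - (V *m y - U *m z) = - ((V - U) *m z).
  rewrite mulmxBr mulmxBl; move: (V *m y) (V *m z) (U *m z) => a b d.
  by apply/matrixP => i j; rewrite !mxE; ring.
rewrite mulmxN (second_order_annihilates z hA hB hU).
move: (U *m z) => u; rewrite mulmxBl mulmxBr.
move: (V *m (V *m y)) (V *m u) (U *m u) => a b d.
by apply/matrixP => i j; rewrite !mxE; ring.
Qed.

Lemma mulmx_add_cancel (F : comNzRingType) l (W : 'M[F]_l) (x y n k : 'cV[F]_l) :
  W *m n = k -> W *m (x + n) - (y + k) = W *m x - y.
Proof. by move=> <-; rewrite mulmxDr opprD addrACA subrr addr0. Qed.

Lemma mulmx_difference (F : comNzRingType) l (V U : 'M[F]_l) (p q r s : 'cV[F]_l) :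
  V *m (p - (r - s)) - (q - (V *m r - U *m s)) = V *m p - q + (V - U) *m s.
Proof.
rewrite !mulmxBr mulmxBl; move: (V *m p) (V *m r) (V *m s) (U *m s) => a b c d.
by apply/matrixP => i j; rewrite !mxE; ring.
Qed.

Section ModelProblem.
Context {R : realType} {l : nat}.
Variable alpha : R.
Hypothesis halpha : 0 < alpha < 2 * pi.
Variables (A11 A12 : 'M[R]_l) (V W U : 'M[R[i]]_l) (lam : R[i]).
Hypothesis A11E : complex_mx A11 = W *m V.
Hypothesis A12E : 2 *: complex_mx A12 = - (W + V).
Hypothesis U_root : complex_mx A11 + (2 *: complex_mx A12) *m U + U *m U = 0.

Local Notation d1 t := (polar_d1 (cos t)%:C (sin t)%:C).
Local Notation d2 t := (polar_d2 (cos t)%:C (sin t)%:C).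

Lemma cos2Dsin2C (t : R) : (cos t)%:C * (cos t)%:C + (sin t)%:C * (sin t)%:C = 1 :> R[i].
Proof. by rewrite -!rmorphM -rmorphD /= -!expr2 cos2Dsin2. Qed.

Lemma turn_first_order (M : 'M[R[i]]_l) kappa (t : R) (x x' : 'cV[R[i]]_l) :
  kappa *: (turnmx' M t *m x) - turnmx M t *m x' = M *m d1 t kappa x x' - d2 t kappa x x'.
Proof. by apply: polar_first_order; rewrite rmorphN. Qed.

Lemma power_family_d1 (M : 'M[R[i]]_l) c y m (t : R) : power_family alpha M lam c y ->
  0 <= t <= alpha ->
  d1 t (lam - m%:R) (y m t) (turnmx' M t *m y m.+1 t) = y m.+1 t.
Proof.
move=> [_ _ h _] ht; apply: polar_d1_turn; rewrite ?rmorphN ?cos2Dsin2C //.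
exact: h.
Qed.

Lemma power_family_d2 (M : 'M[R[i]]_l) c y m (t : R) : power_family alpha M lam c y ->
  0 <= t <= alpha ->
  d2 t (lam - m%:R) (y m t) (turnmx' M t *m y m.+1 t) = M *m y m.+1 t.
Proof.
move=> [_ _ h _] ht; apply: polar_d2_turn; rewrite ?rmorphN ?cos2Dsin2C //.
exact: h.
Qed.

Lemma power_family_vcont (M : 'M[R[i]]_l) c y m : power_family alpha M lam c y ->
  vcont `[0, alpha] (y m).
Proof. by move=> [h _ _ _] i; apply: trigpow_ccont => //; exact: h. Qed.

Lemma cderive_cosC (t : R) : cderive (fun s => (cos s)%:C) t (- (sin t)%:C).
Proof. by rewrite -rmorphN; apply: cderive_real; exact: is_derive_cos. Qed.

Lemma cderive_sinC (t : R) : cderive (fun s => (sin s)%:C) t (cos t)%:C.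
Proof. by apply: cderive_real; exact: is_derive_sin. Qed.

Lemma vderive_d1 kappa (x x' : R -> 'cV[R[i]]_l) (t : R) (y : 'cV[R[i]]_l) :
  vderive x t (x' t) -> vderive x' t y ->
  vderive (fun s => d1 s kappa (x s) (x' s)) t
    ((kappa - 1) * (cos t)%:C *: x' t - kappa * (sin t)%:C *: x t - (sin t)%:C *: y).
Proof.
move=> hx hx'; apply: vderive_eq.
  apply: vderiveD; first by apply: vderiveM hx; apply: cderiveZ; exact: cderive_cosC.
  by apply: vderiveN; apply: vderiveM hx'; exact: cderive_sinC.
by apply/matrixP => i j; rewrite !mxE; ring.
Qed.

Lemma vderive_d2 kappa (x x' : R -> 'cV[R[i]]_l) (t : R) (y : 'cV[R[i]]_l) :
  vderive x t (x' t) -> vderive x' t y ->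
  vderive (fun s => d2 s kappa (x s) (x' s)) t
    (kappa * (cos t)%:C *: x t + (kappa - 1) * (sin t)%:C *: x' t + (cos t)%:C *: y).
Proof.
move=> hx hx'; apply: vderive_eq.
  apply: vderiveD; first by apply: vderiveM hx; apply: cderiveZ; exact: cderive_sinC.
  by apply: vderiveM hx'; exact: cderive_cosC.
by apply/matrixP => i j; rewrite !mxE; ring.
Qed.

Lemma itvoo_cc (t : R) : 0 < t < alpha -> 0 <= t <= alpha.
Proof. by move=> /andP[/ltW-> /ltW->]. Qed.

(** Write the difference of the two sides as [x]. The operator factors as
    [W d1 - d2] after [V d1 - d2]. First, [w = (V d1 - d2) x] solves the first-order system
    of [W] and vanishes at 0 by the condition on [v1 0], so it is 0; then [x] solves the system of
    [V] and vanishes at 0. *)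
Lemma dirichlet_representation (v0 v1 v2 : R -> 'cV[R[i]]_l) c (y z : nat -> R -> 'cV[R[i]]_l) :
  (forall mu, spectrum V mu -> complex.Im mu != 0) ->
  (forall mu, spectrum W mu -> complex.Im mu != 0) ->
  vcont `[0, alpha] v0 -> vcont `[0, alpha] v1 ->
  (forall t, 0 < t < alpha -> vderive v0 t (v1 t)) ->
  (forall t, 0 < t < alpha -> vderive v1 t (v2 t)) ->
  (forall t, 0 < t < alpha ->
    complex_mx A11 *m d1 t (lam - 1) (d1 t lam (v0 t) (v1 t))
      ((lam - 1) * (cos t)%:C *: v1 t - lam * (sin t)%:C *: v0 t - (sin t)%:C *: v2 t)
    + 2 *: (complex_mx A12 *m d1 t (lam - 1) (d2 t lam (v0 t) (v1 t))
      (lam * (cos t)%:C *: v0 t + (lam - 1) * (sin t)%:C *: v1 t + (cos t)%:C *: v2 t))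
    + d2 t (lam - 1) (d2 t lam (v0 t) (v1 t))
      (lam * (cos t)%:C *: v0 t + (lam - 1) * (sin t)%:C *: v1 t + (cos t)%:C *: v2 t) = 0) ->
  power_family alpha V lam c y -> power_family alpha U lam c z ->
  v0 0 = 0 -> v1 0 = lam *: ((V - U) *m c) ->
  forall t, 0 <= t <= alpha -> v0 t = y 0%N t - z 0%N t.
Proof.
move=> hV hW cv0 cv1 dv0 dv1 ode fy fz v00 v10.
have [_ dy _ y0] := fy; have [_ dz _ z0] := fz.
pose a1 (t : R) := d1 t lam (v0 t) (v1 t); pose a2 (t : R) := d2 t lam (v0 t) (v1 t).
pose b1 (t : R) := (lam - 1) * (cos t)%:C *: v1 t - lam * (sin t)%:C *: v0 t - (sin t)%:C *: v2 t.
pose b2 (t : R) := lam * (cos t)%:C *: v0 t + (lam - 1) * (sin t)%:C *: v1 t + (cos t)%:C *: v2 t.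
(* [V d1 - d2] sends [y] to 0 and [z] to [(V - U) z 1]: this is its value on [v0 - y + z]. *)
pose w (t : R) := V *m a1 t - a2 t + (V - U) *m z 1%N t.
pose w1 (t : R) := V *m b1 t - b2 t + (V - U) *m (turnmx' U t *m z 2%N t).
have da1 t : 0 < t < alpha -> vderive a1 t (b1 t).
  by move=> ht; apply: vderive_d1; [exact: dv0|exact: dv1].
have da2 t : 0 < t < alpha -> vderive a2 t (b2 t).
  by move=> ht; apply: vderive_d2; [exact: dv0|exact: dv1].
have dw t : 0 < t < alpha -> vderive w t (w1 t).
  move=> ht; apply: vderiveD; last by apply: vderive_mulmx; exact: dz.
  by apply: vderiveD; [apply: vderive_mulmx; exact: da1|apply: vderiveN; exact: da2].
have ccos : ccont `[0, alpha] (fun t : R => (cos t)%:C : R[i]).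
  exact: cderive_ccont cderive_cosC.
have csin : ccont `[0, alpha] (fun t : R => (sin t)%:C : R[i]).
  exact: cderive_ccont cderive_sinC.
have ca1 : vcont `[0, alpha] a1.
  apply: vcontD; first by apply: vcontM cv0; apply: ccontM ccos; exact: ccont_cst.
  by apply: vcontN; exact: vcontM.
have ca2 : vcont `[0, alpha] a2.
  apply: vcontD; first by apply: vcontM cv0; apply: ccontM csin; exact: ccont_cst.
  exact: vcontM.
have cw : vcont `[0, alpha] w.
  apply: vcontD; last by apply: vcont_mulmx; exact: power_family_vcont fz.
  by apply: vcontD; [exact: vcont_mulmx|exact: vcontN].
have w_eq t : 0 < t < alpha -> (lam - 1) *: (turnmx' W t *m w t) = turnmx W t *m w1 t.
  move=> ht; apply/eqP; rewrite -subr_eq0 turn_first_order; apply/eqP.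
  rewrite /w /w1 polar_d1_lin polar_d2_lin.
  have ez1 : d1 t (lam - 1) (z 1%N t) (turnmx' U t *m z 2%N t) = z 2%N t.
    exact: (power_family_d1 1%N fz (itvoo_cc ht)).
  have ez2 : d2 t (lam - 1) (z 1%N t) (turnmx' U t *m z 2%N t) = U *m z 2%N t.
    exact: (power_family_d2 1%N fz (itvoo_cc ht)).
  rewrite ez1 ez2.
  have e := polar_derivatives_commute (cos t)%:C (sin t)%:C lam (v0 t) (v1 t) (v2 t).
  rewrite [d2 t (lam - 1) (a1 t) (b1 t)]e.
  have E := second_order_annihilates (z 2%N t) A11E A12E U_root.
  apply: (etrans (mulmx_add_cancel _ _ E)).
  apply: (etrans (esym (second_order_factor _ _ _ A11E A12E))).
  exact: ode.
have w0 : w 0 = 0.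
  rewrite /w /a1 /a2 /polar_d1 /polar_d2 v00 v10 cos0 sin0 z0 /= !scaler0 scale0r subrr.
  by rewrite mulmx0 add0r scale1r mulr1 add0r -scalemxAr addNr.
have wz := turn_equation_unique halpha hW cw dw w_eq w0.
pose x (t : R) := v0 t - (y 0%N t - z 0%N t).
pose x1 (t : R) := v1 t - (turnmx' V t *m y 1%N t - turnmx' U t *m z 1%N t).
have dx t : 0 < t < alpha -> vderive x t (x1 t).
  move=> ht; apply: vderiveD; first exact: dv0.
  by apply: vderiveN; apply: vderiveD; [exact: dy|apply: vderiveN; exact: dz].
have cx : vcont `[0, alpha] x.
  apply: vcontD => //; apply: vcontN; apply: vcontD; first exact: power_family_vcont fy.
  by apply: vcontN; exact: power_family_vcont fz.
have x_eq t : 0 < t < alpha -> lam *: (turnmx' V t *m x t) = turnmx V t *m x1 t.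
  move=> ht; apply/eqP; rewrite -subr_eq0 turn_first_order; apply/eqP.
  rewrite -[RHS](wz t (itvoo_cc ht)) /w /a1 /a2.
  have ey1 := power_family_d1 0%N fy (itvoo_cc ht); have ey2 := power_family_d2 0%N fy (itvoo_cc ht).
  have ez1 := power_family_d1 0%N fz (itvoo_cc ht); have ez2 := power_family_d2 0%N fz (itvoo_cc ht).
  rewrite subr0 in ey1 ey2 ez1 ez2.
  have l1 : d1 t lam (x t) (x1 t) = d1 t lam (v0 t) (v1 t) - (y 1%N t - z 1%N t).
    rewrite -{1}ey1 -{1}ez1 /x /x1 /polar_d1.
    by apply/matrixP => i j; rewrite !mxE; ring.
  have l2 : d2 t lam (x t) (x1 t) = d2 t lam (v0 t) (v1 t) - (V *m y 1%N t - U *m z 1%N t).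
    rewrite -ey2 -ez2 /x /x1 /polar_d2.
    by apply/matrixP => i j; rewrite !mxE; ring.
  by rewrite l1 l2; exact: mulmx_difference.
have x0 : x 0 = 0 by rewrite /x v00 y0 z0 subrr subr0.
move=> t ht; have := turn_equation_unique halpha hV cx dx x_eq x0 ht.
by rewrite /x => /eqP; rewrite subr_eq0 => /eqP.
Qed.

End ModelProblem.

(** * The standard root *)

Section StandardRoot.
Context {R : realType} {l : nat}.
Variables (A11 A12 : 'M[R]_l) (V : 'M[R[i]]_l).
Hypothesis hV : standard_root A11 A12 V.

Lemma standard_root_A11 : complex_mx A11 = V ^t* *m V.
Proof.
have z0 : 0%:M = 0 :> 'M[R[i]]_l by exact: raddf0.
have := hV.2 0; rewrite /symbol expr1n scale1r mulr0 mulr0 scale0r addr0.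
by rewrite expr0n /= z0 addr0 !subr0.
Qed.

Lemma standard_root_A12 : 2 *: complex_mx A12 = - (V ^t* + V).
Proof.
have := hV.2 1; rewrite /symbol !expr1n scale1r !mulr1 standard_root_A11.
rewrite mulmxBl !mulmxBr mulmx1 mul1mx mulmx1.
move: (V ^t*) (2 *: _) (V ^t* *m V) => W B P.
move=> /(congr1 (fun M => M - P - 1%:M)) e.
have -> : B = P + B + 1%:M - P - 1%:M by rewrite addrAC addrK addrC addKr.
by rewrite e; apply/matrixP => i j; rewrite !mxE; ring.
Qed.

Lemma conj_root : complex_mx A11 + (2 *: complex_mx A12) *m conj_mx V +
  conj_mx V *m conj_mx V = 0.
Proof.
have : complex_mx A11 + (2 *: complex_mx A12) *m V + V *m V = 0.
  rewrite standard_root_A11 standard_root_A12 mulNmx mulmxDl opprD addrA subrr add0r.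
  by rewrite addNr.
move=> /(congr1 conj_mx); rewrite !conj_mxD !conj_mxM conj_mxZ !conj_complex_mx rmorph_nat => ->.
exact: map_mx0.
Qed.

Lemma adjoint_root_spectrum mu : spectrum (V ^t*) mu -> complex.Im mu < 0.
Proof.
move=> /conj_mx_eigenvalue; rewrite eigenvalue_trmx => /hV.1.
by rewrite Im_conj oppr_gt0.
Qed.

Lemma conj_root_spectrum mu : spectrum (conj_mx V) mu -> complex.Im mu < 0.
Proof. by move=> /conj_mx_eigenvalue /hV.1; rewrite Im_conj oppr_gt0. Qed.

End StandardRoot.

(** The difference is [2 i D]. *)
Lemma standard_root_sub_conj (R : realType) l (V : 'M[R[i]]_l) (S D : 'M[R]_l) :
  standard_root_decomposition V S D -> V - conj_mx V \in unitmx.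
Proof.
move=> [_ pD ->]; rewrite conj_mxM conj_mxD !conj_complex_mx conj_scalar_mx -mulmxBl.
rewrite opprD addrACA subrr add0r -rmorphB /= mul_scalar_mx unitmxZ.
  by rewrite map_unitmx; exact: posdef_unitmx.
by rewrite unitfE eq_complex /= opprK negb_and; apply/orP; right; rewrite gt_eqF // addr_gt0.
Qed.

(** * The Dirichlet problem *)

Section DirichletProblem.
Context {R : realType} {l : nat}.
Variable alpha : R.
Hypothesis halpha : 0 < alpha < 2 * pi.
Variables (A11 A12 : 'M[R]_l) (V W U : 'M[R[i]]_l) (lam : R[i]).
Hypothesis A11E : complex_mx A11 = W *m V.
Hypothesis A12E : 2 *: complex_mx A12 = - (W + V).
Hypothesis U_root : complex_mx A11 + (2 *: complex_mx A12) *m U + U *m U = 0.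
Hypothesis specV : forall mu, spectrum V mu -> 0 < complex.Im mu.
Hypothesis specU : forall mu, spectrum U mu -> complex.Im mu < 0.
Hypothesis specW : forall mu, spectrum W mu -> complex.Im mu < 0.
Hypothesis VU_unit : V - U \in unitmx.
Hypothesis lam0 : lam != 0.

Lemma real_pow_neq0 (r : R) k : real_pow r k != 0.
Proof. exact: cexp_neq0. Qed.

Lemma power_ansatz_eq0 (v : R -> 'cV[R[i]]_l) r t :
  power_ansatz lam v r t = 0 -> v t = 0.
Proof.
by rewrite /power_ansatz => /eqP; rewrite scaler_eq0 (negbTE (real_pow_neq0 _ _)) => /eqP.
Qed.

Let alpha0 : 0 < alpha. Proof. by case/andP: halpha. Qed.

Let half : 0 < alpha / 2 < alpha.
Proof. by rewrite divr_gt0 //= ltr_pdivrMr // mulr_natr mulr2n ltrDl. Qed.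

Lemma near_interior (P : R -> Prop) (t : R) : 0 < t < alpha ->
  (forall s, 0 < s < alpha -> P s) -> \forall s \near t, P s.
Proof.
move=> ht h; have : t \in `]0, alpha[ by rewrite in_itv.
by move=> /near_in_itvoo; apply: filterS => s; rewrite in_itv; exact: h.
Qed.

(** The given function is prescribed on the closed interval only; a representative with
    derivatives inside and continuous up to the ends is chosen entry by entry. *)
Lemma exists_smooth_extension (v : R -> 'cV[R[i]]_l) : smooth_cV 0 alpha v ->
  exists g : nat -> R -> 'cV[R[i]]_l,
  [/\ forall t, 0 <= t <= alpha -> v t = g 0%N t,
      forall n, vcont `[0, alpha] (g n) &
      forall n t, 0 < t < alpha -> vderive (g n) t (g n.+1 t)].
Proof.
move=> hs.
have [gR hR] := choice (fun i => (hs i).1).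
have [gI hI] := choice (fun i => (hs i).2).
exists (fun n t => \col_i (gR i n t +i* gI i n t)); split.
- move=> t ht; apply/matrixP => i j; rewrite ord1 mxE.
  have [hR0 _ _] := hR i; have [hI0 _ _] := hI i.
  by rewrite hR0 // hI0 // -eqC_ReIm.
- move=> n i; have [_ cR _] := hR i; have [_ cI _] := hI i.
  apply: (@ccont_eq _ _ (fun t => gR i n t +i* gI i n t)) => [t _|]; first by rewrite mxE.
  by split; [exact: cR|exact: cI].
- move=> n t ht i; have [_ _ dR] := hR i; have [_ _ dI] := hI i.
  rewrite mxE; under eq_fun do rewrite mxE.
  by split; [exact: dR|exact: dI].
Qed.

(** The vector [c] is chosen so that the power solution has the same derivative at 0 as [v];
    the boundary condition at [alpha] then says that [c] is in the kernel. *)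
Lemma solution_to_kernel (v : R -> 'cV[R[i]]_l) :
  dirichlet_solution A11 A12 alpha lam v ->
  (exists r phi : R, [/\ 0 < r, 0 <= phi <= alpha & power_ansatz lam v r phi != 0]) ->
  exists2 c : 'cV[R[i]]_l, c != 0 &
    mxpow true lam (turnmx V alpha) *m c = mxpow false lam (turnmx U alpha) *m c.
Proof.
move=> [smv pde bc] [r [phi [r0 hphi vne0]]].
have [g [vg cg dg]] := exists_smooth_extension smv.
have [/power_ansatz_eq0 v_0 /power_ansatz_eq0 v_a] := bc 1 ltr01.
have dv t : 0 < t < alpha -> vderive v t (g 1%N t).
  move=> ht; apply: vderive_near (dg 0%N t ht).
  by apply: near_interior ht _ => s /itvoo_cc hs; rewrite vg.
pose a1 (t : R) := polar_d1 (cos t)%:C (sin t)%:C lam (g 0%N t) (g 1%N t).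
pose a2 (t : R) := polar_d2 (cos t)%:C (sin t)%:C lam (g 0%N t) (g 1%N t).
pose b1 (t : R) := (lam - 1) * (cos t)%:C *: g 1%N t - lam * (sin t)%:C *: g 0%N t
  - (sin t)%:C *: g 2%N t.
pose b2 (t : R) := lam * (cos t)%:C *: g 0%N t + (lam - 1) * (sin t)%:C *: g 1%N t
  + (cos t)%:C *: g 2%N t.
have da1 t : 0 < t < alpha -> vderive a1 t (b1 t).
  by move=> ht; apply: vderive_d1; exact: dg.
have da2 t : 0 < t < alpha -> vderive a2 t (b2 t).
  by move=> ht; apply: vderive_d2; exact: dg.
have a1v t : 0 < t < alpha -> a1 t = polar_d1 (cos t)%:C (sin t)%:C lam (v t) (g 1%N t).
  by move=> /itvoo_cc ht; rewrite vg.
have a2v t : 0 < t < alpha -> a2 t = polar_d2 (cos t)%:C (sin t)%:C lam (v t) (g 1%N t).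
  by move=> /itvoo_cc ht; rewrite vg.
have ode t (ht : 0 < t < alpha) :=
  elliptic_operator_polar halpha A11 A12 dv a1v a2v da1 da2 ltr01 ht.
have ode0 t : 0 < t < alpha ->
    complex_mx A11 *m polar_d1 (cos t)%:C (sin t)%:C (lam - 1) (a1 t) (b1 t)
    + 2 *: (complex_mx A12 *m polar_d1 (cos t)%:C (sin t)%:C (lam - 1) (a2 t) (b2 t))
    + polar_d2 (cos t)%:C (sin t)%:C (lam - 1) (a2 t) (b2 t) = 0.
  move=> ht; have := ode t ht; rewrite pde // => /esym/eqP.
  by rewrite scaler_eq0 (negbTE (real_pow_neq0 _ _)) => /eqP.
have repr c (y z : nat -> R -> 'cV[R[i]]_l) : g 1%N 0 = lam *: ((V - U) *m c) ->
    power_family alpha V lam c y -> power_family alpha U lam c z ->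
    forall t, 0 <= t <= alpha -> v t = y 0%N t - z 0%N t.
  move=> hc fy fz t ht; rewrite vg //.
  apply: (dirichlet_representation halpha A11E A12E U_root _ _ (cg 0%N) (cg 1%N)
    (dg 0%N) (dg 1%N) ode0 fy fz _ hc ht).
  - by move=> mu /specV h; rewrite gt_eqF.
  - by move=> mu /specW h; rewrite lt_eqF.
  - by rewrite -vg ?lexx ?ltW.
pose c := lam^-1 *: (invmx (V - U) *m g 1%N 0).
have hc : g 1%N 0 = lam *: ((V - U) *m c).
  by rewrite /c -scalemxAr mulKVmx // scalerA divff // scale1r.
have [y fy ya] := power_solution halpha (up := true) lam specV c.
have [z fz za] := power_solution halpha (up := false) lam specU c.
exists c; last first.
  have yz : y 0%N alpha = z 0%N alpha.
    apply/eqP; rewrite -subr_eq0 -(repr c y z hc fy fz) ?v_a //.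
    by rewrite lexx ltW.
  exact: (etrans (esym ya) (etrans yz za)).
apply: contra_neq vne0 => c0.
have := repr c _ _ hc; rewrite c0 => /(_ _ _ (power_family0 _ _ _) (power_family0 _ _ _)) h.
by rewrite /power_ansatz h // subrr scaler0.
Qed.

(** The boundary conditions are immediate. If the solution were 0, then so would be its
    derivative in [x2], [V y 1 - U z 1], which tends to [lam (V - U) c] at the angle 0. *)
Lemma kernel_to_solution (c : 'cV[R[i]]_l) : c != 0 ->
  mxpow true lam (turnmx V alpha) *m c = mxpow false lam (turnmx U alpha) *m c ->
  exists v : R -> 'cV[R[i]]_l, dirichlet_solution A11 A12 alpha lam v /\
    exists r phi : R, [/\ 0 < r, 0 <= phi <= alpha & power_ansatz lam v r phi != 0].
Proof.
move=> c0 hc.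
have [y fy ya] := power_solution halpha (up := true) lam specV c.
have [z fz za] := power_solution halpha (up := false) lam specU c.
have [ty dy _ y0] := fy; have [tz dz _ z0] := fz.
pose v (t : R) := y 0%N t - z 0%N t.
pose v1 (t : R) := turnmx' V t *m y 1%N t - turnmx' U t *m z 1%N t.
have dv t : 0 < t < alpha -> vderive v t (v1 t).
  by move=> ht; apply: vderiveD; [exact: dy|apply: vderiveN; exact: dz].
have cy m := power_family_vcont halpha m fy; have cz m := power_family_vcont halpha m fz.
pose a1 (t : R) := y 1%N t - z 1%N t.
pose a2 (t : R) := V *m y 1%N t - U *m z 1%N t.
pose b1 (t : R) := turnmx' V t *m y 2%N t - turnmx' U t *m z 2%N t.
pose b2 (t : R) := V *m (turnmx' V t *m y 2%N t) - U *m (turnmx' U t *m z 2%N t).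
have da1 t : 0 < t < alpha -> vderive a1 t (b1 t).
  by move=> ht; apply: vderiveD; [exact: dy|apply: vderiveN; exact: dz].
have da2 t : 0 < t < alpha -> vderive a2 t (b2 t).
  move=> ht; apply: vderiveD; first by apply: vderive_mulmx; exact: dy.
  by apply: vderiveN; apply: vderive_mulmx; exact: dz.
have a1v t : 0 < t < alpha -> a1 t = polar_d1 (cos t)%:C (sin t)%:C lam (v t) (v1 t).
  move=> /itvoo_cc ht.
  have := power_family_d1 0%N fy ht; have := power_family_d1 0%N fz ht.
  by rewrite polar_d1B subr0 /a1 => -> ->.
have a2v t : 0 < t < alpha -> a2 t = polar_d2 (cos t)%:C (sin t)%:C lam (v t) (v1 t).
  move=> /itvoo_cc ht.
  have := power_family_d2 0%N fy ht; have := power_family_d2 0%N fz ht.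
  by rewrite polar_d2B subr0 /a2 => -> ->.
exists v; split; first split.
- have ts i : trigpow (fun t => v t i 0).
    have -> : (fun t => v t i 0) = (fun t => y 0%N t i 0 + -1 * z 0%N t i 0).
      by apply/funext => t; rewrite /v !mxE mulN1r.
    by apply: trigpow_add; [exact: ty|apply: trigpow_mul; [exact: trigpow_cst|exact: tz]].
  by move=> i; exact: trigpow_smooth.
- move=> r phi r0 hphi.
  rewrite (elliptic_operator_polar halpha A11 A12 dv a1v a2v da1 da2 r0 hphi).
  have ht := itvoo_cc hphi.
  have ey1 : polar_d1 (cos phi)%:C (sin phi)%:C (lam - 1) (y 1%N phi)
      (turnmx' V phi *m y 2%N phi) = y 2%N phi by exact: (power_family_d1 1%N fy ht).
  have ez1 : polar_d1 (cos phi)%:C (sin phi)%:C (lam - 1) (z 1%N phi)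
      (turnmx' U phi *m z 2%N phi) = z 2%N phi by exact: (power_family_d1 1%N fz ht).
  have ey2 : polar_d2 (cos phi)%:C (sin phi)%:C (lam - 1) (y 1%N phi)
      (turnmx' V phi *m y 2%N phi) = V *m y 2%N phi by exact: (power_family_d2 1%N fy ht).
  have ez2 : polar_d2 (cos phi)%:C (sin phi)%:C (lam - 1) (z 1%N phi)
      (turnmx' U phi *m z 2%N phi) = U *m z 2%N phi by exact: (power_family_d2 1%N fz ht).
  rewrite /a1 /a2 /b1 /b2 !polar_d1B !polar_d2B !polar_d1_mulmx !polar_d2_mulmx.
  rewrite ey1 ey2 ez1 ez2.
  by rewrite (second_order_roots _ _ A11E A12E U_root) scaler0.
- have v_0 : v 0 = 0 by rewrite /v y0 z0 subrr.
  have v_a : v alpha = 0.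
    by apply/eqP; rewrite subr_eq0; apply/eqP; exact: (etrans ya (etrans hc (esym za))).
  by move=> r _; rewrite /power_ansatz v_0 v_a !scaler0; split.
apply: contrapT => hno.
have v_0 t : 0 <= t <= alpha -> v t = 0.
  move=> ht; apply: (@power_ansatz_eq0 _ 1).
  apply: contrapT => /eqP hne; apply: hno; exists 1, t.
  by split; [exact: ltr01|exact: ht|exact: hne].
have a2_0 t : 0 < t < alpha -> a2 t = 0.
  move=> ht; rewrite (a2v t ht) (v_0 t (itvoo_cc ht)) /polar_d2 scaler0 add0r.
  suff -> : v1 t = 0 by rewrite scaler0.
  apply/matrixP => i j; rewrite ord1 [RHS]mxE.
  apply: cderive_unique (dv t ht i) _.
  apply: (@cderive_near _ (fun _ => 0)); last exact: cderive_cst.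
  by apply: near_interior ht _ => s /itvoo_cc hs; rewrite (v_0 s hs) mxE.
have ca2 : vcont `[0, alpha] a2.
  by apply: vcontD; [|apply: vcontN]; apply: vcont_mulmx; [exact: cy|exact: cz].
have a20 : a2 0 = 0.
  apply/matrixP => i j; rewrite ord1 [RHS]mxE.
  have d0 t : 0 < t < alpha -> cderive (fun s => a2 s i 0) t 0.
    move=> ht; apply: (@cderive_near _ (fun _ => 0)); last exact: cderive_cst.
    by apply: near_interior ht _ => s hs; rewrite (a2_0 s hs) mxE.
  rewrite -(cst_of_cderive0 d0 (ca2 i) (itvoo_cc half)).
  by rewrite (a2_0 _ half) mxE.
move: a20; rewrite /a2 y0 z0 /= mulr1 -!scalemxAr -scalerBr -mulmxBl => /eqP.
rewrite scaler_eq0 (negbTE lam0) => /eqP h.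
by move: c0; rewrite -(mulKmx VU_unit c) h mulmx0 eqxx.
Qed.

End DirichletProblem.

Lemma mulmx_intertwineB (F : fieldType) n (A B Q X Y : 'M[F]_n) :
  A *m Q = Q *m X -> B *m Q = Q *m Y -> (A - B) *m Q = Q *m (X - Y).
Proof. by move=> hX hY; rewrite mulmxBl mulmxBr hX hY. Qed.

Lemma intertwine_kernel (F : fieldType) n (M Q X Y : 'M[F]_n) :
  Q \in unitmx -> M *m Q = Q *m (X - Y) ->
  (exists2 c : 'cV[F]_n, c != 0 & M *m c = 0) <->
  (exists2 c : 'cV[F]_n, c != 0 & X *m c = Y *m c).
Proof.
move=> uQ ME; split=> [[c c0 hc]|[c c0 hc]].
- exists (invmx Q *m c).
    by apply: contra c0 => /eqP e; rewrite -(mulKVmx uQ c) e mulmx0.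
  apply/eqP; rewrite -subr_eq0 -mulmxBl -(mulKmx uQ (_ *m _)) [Q *m (_ *m _)]mulmxA -ME.
  by rewrite -mulmxA (mulKVmx uQ) hc mulmx0.
- exists (Q *m c).
    by apply: contra c0 => /eqP e; rewrite -(mulKmx uQ c) e mulmx0.
  by rewrite mulmxA ME -mulmxA mulmxBl hc subrr mulmx0.
Qed.

(** The matrix [M] is similar to the difference of the powers of [turnmx V alpha] and
    [turnmx (conj_mx V) alpha], by the real matrix [D ^ (1/2)]. *)
Lemma Mmx_kernel (R : realType) l (alpha : R) (halpha : 0 < alpha < 2 * pi)
    (V : 'M[R[i]]_l) (S D : 'M[R]_l) lam :
  standard_root_decomposition V S D -> (forall mu, spectrum V mu -> complex.Im mu != 0) ->
  spectrum (Mmx S D alpha lam) 0 <->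
  exists2 c : 'cV[R[i]]_l, c != 0 & mxpow true lam (turnmx V alpha) *m c =
     mxpow false lam (turnmx (conj_mx V) alpha) *m c.
Proof.
move=> [_ pD VE] specV.
have specU mu : spectrum (conj_mx V) mu -> complex.Im mu != 0.
  by move=> /conj_mx_eigenvalue /specV; rewrite Im_conj oppr_eq0.
pose Q := complex_mx (posdef_sqrt D).
have uQ : Q \in unitmx.
  by rewrite map_unitmx; apply: posdef_unitmx; exact: (posdef_sqrtP pD).1.
have ZQ : Zmx S D alpha *m Q = Q *m turnmx V alpha by rewrite VE; exact: Zmx_intertwine.
have cZQ : conj_mx (Zmx S D alpha) *m Q = Q *m turnmx (conj_mx V) alpha.
  by have := congr1 conj_mx ZQ; rewrite !conj_mxM conj_turnmx conj_complex_mx.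
have e1 := mxpow_intertwine true lam uQ ZQ (turnmx_slit_plane specV halpha).
have e2 := mxpow_intertwine false lam uQ cZQ (turnmx_slit_plane specU halpha).
have ME := mulmx_intertwineB e1 e2.
exact: (iff_trans (singular_colP _) (intertwine_kernel uQ ME)).
Qed.

Theorem proposition5p1 (R : realType) (l : nat) (alpha : R)
    (halpha : 0 < alpha < 2 * pi)
    (A11 A12 : 'M[R]_l) (hA : monic_elliptic A11 A12)
    (V : 'M[R[i]]_l) (hV : standard_root A11 A12 V)
    (S D : 'M[R]_l) (hSD : standard_root_decomposition V S D)
    (lambda : R[i]) (hlambda : lambda != 0) :
  (exists v : R -> 'cV[R[i]]_l,
      dirichlet_solution A11 A12 alpha lambda v /\
      exists r phi : R, [/\ 0 < r, 0 <= phi <= alpha &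
                            power_ansatz lambda v r phi != 0])
  <-> spectrum (Mmx S D alpha lambda) 0.
Proof.
have specV := hV.1; have specW := adjoint_root_spectrum hV.
have specU := conj_root_spectrum hV; have uVU := standard_root_sub_conj hSD.
have A11E := standard_root_A11 hV; have A12E := standard_root_A12 hV.
have rootU := conj_root hV.
have kerP := Mmx_kernel halpha lambda hSD (fun mu (h : spectrum V mu) => lt0r_neq0 (specV mu h)).
split=> [[v [sol ne0]]|/kerP[c c0 hc]].
  apply/kerP.
  exact: (solution_to_kernel halpha A11E A12E rootU specV specU specW uVU hlambda sol ne0).
exact: (kernel_to_solution halpha A11E A12E rootU specV specU uVU hlambda c0 hc).
Qed.
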